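(* Let $X$ and $Y$ be Banach spaces, $T:X\to Y$ a bounded linear operator such that $T^\ast(Y^\ast)$ is norm non-separable, and $\mathcal{T}$ a downwards-closed subtree of $\Omega$. Then: (i) if $X$ is separable, then $\Sigma_\mathcal{T}$ factors through $T$; (ii) if $Y$ is separable, then $\sigma_\mathcal{T}$ factors through $T$, and hence $\Sigma_\mathcal{T}$ factors through $T$. Moreover, if $\mathcal{S}$ is a downwards-closed subtree of $\Omega$ such that $\partial\mathcal{S}$ is uncountable, then: (iii) $\Sigma_\mathcal{S}$ is universal for the class of non-Asplund operators; (iv) $\sigma_\mathcal{S}$ is universal for the class of operators $P$ with separable codomain such that $P^\ast$ has non-separable range, and this class coincides with the class of non-Asplund operators having separable codomain. In particular (iii) and (iv) hold for $\mathcal{S}=\Omega$ and for $\mathcal{S}=\mathcal{D}$, the tree of all finite sequences in $\{0,1\}$.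
   Context: Operators are bounded linear maps between real or complex Banach spaces. An operator $S:W\to Z$ factors through $T:X\to Y$ if there exist operators $U:W\to X$ and $V:Y\to Z$ with $VTU=S$. For a class $\mathscr{C}$ of operators, an operator $\Upsilon\in\mathscr{C}$ is universal for $\mathscr{C}$ if $\Upsilon$ factors through every element of $\mathscr{C}$. An operator $T:X\to Y$ is Asplund if for every separable closed subspace $Z\subseteq X$ the adjoint $(T|_Z)^\ast$ has norm-separable range. $\Omega$ denotes the set of all finite (possibly empty) sequences of natural numbers, ordered by $s\sqsubseteq t$ iff $s$ is an initial segment of $t$; $\mathcal{T}\subseteq\Omega$ is downwards closed if $t\in\mathcal{T}$, $s\sqsubseteq t$ imply $s\in\mathcal{T}$. For such $\mathcal{T}$, $\partial\mathcal{T}$ is the set of infinite branches (infinite maximal totally ordered subsets) of $\mathcal{T}$, $\overline{\mathcal{T}}:=\mathcal{T}\cup\partial\mathcal{T}$, with partial order $s\sqsubseteq' t$ iff ($s,t\in\Omega$ and $s\sqsubseteq t$) or ($s\in\Omega$, $t\in\partial\mathcal{T}$, $s\in t$) or ($s=t\in\partial\mathcal{T}$); write $s\sqsubset' t$ for $s\sqsubseteq' t$, $s\neq t$. $\overline{\mathcal{T}}$ carries the coarse wedge topology, generated by the subbase of sets $\{u\in\overline{\mathcal{T}}:t\sqsubseteq' u\}$ and their complements, $t\in\mathcal{T}$; it is compact Hausdorff, and $C(\overline{\mathcal{T}})$ denotes the continuous scalar functions on it with the sup norm. For a tree $\mathcal{T}$, $\ell_1(\mathcal{T})$ has unit vectors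 $e_t$, $t\in\mathcal{T}$. $\Sigma_\mathcal{T}:\ell_1(\mathcal{T})\to\ell_\infty(\mathcal{T})$ is the operator $(\Sigma_\mathcal{T}w)(t)=\sum_{s\sqsubseteq t}w(s)$, i.e. $\Sigma_\mathcal{T}e_t=\chi_{\{u\in\mathcal{T}:t\sqsubseteq u\}}$. For downwards-closed $\mathcal{T}\subseteq\Omega$, $\sigma_\mathcal{T}:\ell_1(\mathcal{T})\to C(\overline{\mathcal{T}})$ is given by $(\sigma_\mathcal{T}x)(t)=\sum_{s\sqsubseteq' t}x(s)$ for $t\in\mathcal{T}$ and $(\sigma_\mathcal{T}x)(t)=\sum_{s\sqsubset' t}x(s)$ for $t\in\partial\mathcal{T}$, i.e. $\sigma_\mathcal{T}e_t=\chi_{\{u\in\overline{\mathcal{T}}:t\sqsubseteq' u\}}$. *)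

(* Defs.v *)
From Stdlib Require Import Reals List Classical ClassicalEpsilon.
Import ListNotations.
Set Implicit Arguments.
Open Scope R_scope.

Record Cx := mkCx { Cre : R; Cim : R }.
Definition Cadd (a b : Cx) := mkCx (Cre a + Cre b) (Cim a + Cim b).
Definition Cmul (a b : Cx) :=
  mkCx (Cre a * Cre b - Cim a * Cim b) (Cre a * Cim b + Cim a * Cre b).
Definition Copp (a : Cx) := mkCx (- Cre a) (- Cim a).
Definition C0 := mkCx 0 0.
Definition C1 := mkCx 1 0.
Definition Cabs (a : Cx) := sqrt (Cre a * Cre a + Cim a * Cim a).

Definition K (c : bool) : Type := if c then Cx else R.
Definition Kadd {c : bool} : K c -> K c -> K c :=
  if c return K c -> K c -> K c then Cadd else Rplus.
Definition Kmul {c : bool} : K c -> K c -> K c :=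
  if c return K c -> K c -> K c then Cmul else Rmult.
Definition Kopp {c : bool} : K c -> K c :=
  if c return K c -> K c then Copp else Ropp.
Definition K0 (c : bool) : K c := if c return K c then C0 else 0.
Definition K1 (c : bool) : K c := if c return K c then C1 else 1.
Definition Kabs {c : bool} : K c -> R :=
  if c return K c -> R then Cabs else Rabs.
Definition Ksub {c : bool} (a b : K c) : K c := Kadd a (Kopp b).

(* supremum (meaningful when the least upper bound exists) *)
Definition Rsup (E : R -> Prop) : R := epsilon (inhabits 0) (fun m => is_lub E m).

(* ---------- Normed spaces (a subset [mem] of a carrier with operations) ---------- *)
Record NS (c : bool) : Type := {
  car : Type;
  mem : car -> Prop;
  zero : car;
  add : car -> car -> car;
  opp : car -> car;
  scal : K c -> car -> car;
  norm : car -> R }.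
Arguments car {c} n.
Arguments mem {c} n _.
Arguments zero {c} n.
Arguments add {c} n _ _.
Arguments opp {c} n _.
Arguments scal {c} n _ _.
Arguments norm {c} n _.

Definition dist {c} (X : NS c) (x y : car X) : R := norm X (add X x (opp X y)).

Definition is_Banach {c} (X : NS c) : Prop :=
  mem X (zero X) /\
  (forall x y, mem X x -> mem X y -> mem X (add X x y)) /\
  (forall x, mem X x -> mem X (opp X x)) /\
  (forall a x, mem X x -> mem X (scal X a x)) /\
  (forall x y z, mem X x -> mem X y -> mem X z -> add X x (add X y z) = add X (add X x y) z) /\
  (forall x y, mem X x -> mem X y -> add X x y = add X y x) /\
  (forall x, mem X x -> add X x (zero X) = x) /\
  (forall x, mem X x -> add X x (opp X x) = zero X) /\
  (forall a b x, mem X x -> scal X a (scal X b x) = scal X (Kmul a b) x) /\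
  (forall x, mem X x -> scal X (K1 c) x = x) /\
  (forall a x y, mem X x -> mem X y -> scal X a (add X x y) = add X (scal X a x) (scal X a y)) /\
  (forall a b x, mem X x -> scal X (Kadd a b) x = add X (scal X a x) (scal X b x)) /\
  (forall x, mem X x -> 0 <= norm X x) /\
  (forall x, mem X x -> norm X x = 0 -> x = zero X) /\
  (forall a x, mem X x -> norm X (scal X a x) = Kabs a * norm X x) /\
  (forall x y, mem X x -> mem X y -> norm X (add X x y) <= norm X x + norm X y) /\
  (forall u : nat -> car X, (forall n, mem X (u n)) ->
     (forall eps, 0 < eps -> exists N, forall m n, (N <= m)%nat -> (N <= n)%nat ->
        dist X (u m) (u n) < eps) ->
     exists x, mem X x /\
       (forall eps, 0 < eps -> exists N, forall n, (N <= n)%nat -> dist X (u n) x < eps)).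

Definition bounded_op {c} (X Y : NS c) (f : car X -> car Y) : Prop :=
  (forall x, mem X x -> mem Y (f x)) /\
  (forall x y, mem X x -> mem X y -> f (add X x y) = add Y (f x) (f y)) /\
  (forall a x, mem X x -> f (scal X a x) = scal Y a (f x)) /\
  (exists M, forall x, mem X x -> norm Y (f x) <= M * norm X x).

Definition bounded_fun {c} (X : NS c) (f : car X -> K c) : Prop :=
  (forall x y, mem X x -> mem X y -> f (add X x y) = Kadd (f x) (f y)) /\
  (forall a x, mem X x -> f (scal X a x) = Kmul a (f x)) /\
  (exists M, forall x, mem X x -> Kabs (f x) <= M * norm X x).

Definition factors {c} {W Z X Y : NS c} (S : car W -> car Z) (T : car X -> car Y) : Prop :=
  exists (U : car W -> car X) (V : car Y -> car Z),
    bounded_op W X U /\ bounded_op Y Z V /\ forall w, mem W w -> V (T (U w)) = S w.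

Definition separable_set {c} (X : NS c) (A : car X -> Prop) : Prop :=
  (forall x, ~ A x) \/
  exists s : nat -> car X, (forall n, A (s n)) /\
    forall x, A x -> forall eps, 0 < eps -> exists n, dist X (s n) x < eps.
Definition separable {c} (X : NS c) : Prop := separable_set X (mem X).

(* The range of the adjoint of T restricted to Z, { (phi o T)|_Z : phi in Y^* },
   is norm-separable in Z^*. *)
Definition adj_range_sep {c} (X Y : NS c) (T : car X -> car Y) (Z : car X -> Prop) : Prop :=
  exists phi : nat -> car Y -> K c, (forall n, bounded_fun Y (phi n)) /\
    forall psi, bounded_fun Y psi -> forall eps, 0 < eps -> exists n,
      Rsup (fun r => r = 0 \/ exists z, Z z /\ norm X z <= 1 /\
                        r = Kabs (Ksub (phi n (T z)) (psi (T z)))) < eps.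

Definition closed_subspace {c} (X : NS c) (Z : car X -> Prop) : Prop :=
  (forall z, Z z -> mem X z) /\ Z (zero X) /\
  (forall x y, Z x -> Z y -> Z (add X x y)) /\
  (forall a x, Z x -> Z (scal X a x)) /\
  (forall (u : nat -> car X) x, (forall n, Z (u n)) -> mem X x ->
     (forall eps, 0 < eps -> exists N, forall n, (N <= n)%nat -> dist X (u n) x < eps) ->
     Z x).

Definition Asplund {c} {X Y : NS c} (T : car X -> car Y) : Prop :=
  forall Z, closed_subspace X Z -> separable_set X Z -> adj_range_sep X Y T Z.

Definition OpClass (c : bool) := forall X Y : NS c, (car X -> car Y) -> Prop.

Definition universal {c} (C : OpClass c) {W Z : NS c} (S : car W -> car Z) : Prop :=
  C W Z S /\ forall X Y T, C X Y T -> factors S T.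

Definition nonAsplund c : OpClass c := fun X Y (T : car X -> car Y) =>
  is_Banach X /\ is_Banach Y /\ bounded_op X Y T /\ ~ Asplund T.

Definition sep_cod_nonsep_adj c : OpClass c := fun X Y (T : car X -> car Y) =>
  is_Banach X /\ is_Banach Y /\ bounded_op X Y T /\ separable Y /\
  ~ adj_range_sep X Y T (mem X).

Definition prefix (s t : list nat) : Prop := exists r, t = s ++ r.
Definition downward_closed (T : list nat -> Prop) : Prop :=
  forall s t, T t -> prefix s t -> T s.
Definition Omega : list nat -> Prop := fun _ => True.
Definition Dtree : list nat -> Prop := fun s => Forall (fun n => (n <= 1)%nat) s.

Definition chain (B : list nat -> Prop) : Prop :=
  forall s t, B s -> B t -> prefix s t \/ prefix t s.
Definition is_branch (T B : list nat -> Prop) : Prop :=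
  (forall s, B s -> T s) /\ chain B /\
  (~ exists l : list (list nat), forall s, B s -> In s l) /\
  (forall C, (forall s, C s -> T s) -> chain C -> (forall s, B s -> C s) ->
     forall s, C s -> B s).

Definition uncountable_boundary (T : list nat -> Prop) : Prop :=
  ~ exists f : nat -> (list nat -> Prop),
      forall B, is_branch T B -> exists n, forall s, f n s <-> B s.

Definition node (T : list nat -> Prop) := {t : list nat | T t}.
Definition branch (T : list nat -> Prop) := {B : list nat -> Prop | is_branch T B}.
Definition Tbar (T : list nat -> Prop) := (node T + branch T)%type.

Definition leq' {T} (s : list nat) (u : Tbar T) : Prop :=
  match u with inl t => prefix s (proj1_sig t) | inr B => proj1_sig B s end.

Definition subbasic {T} (p : node T * bool) (u : Tbar T) : Prop :=
  if snd p then leq' (proj1_sig (fst p)) u else ~ leq' (proj1_sig (fst p)) u.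

(* continuity w.r.t. the coarse wedge topology *)
Definition cw_continuous {c T} (f : Tbar T -> K c) : Prop :=
  forall u eps, 0 < eps -> exists L : list (node T * bool),
    (forall p, In p L -> subbasic p u) /\
    forall v, (forall p, In p L -> subbasic p v) -> Kabs (Ksub (f v) (f u)) < eps.

Definition fsum {c} (F : list (list nat)) (f : list nat -> K c) : K c :=
  fold_right (fun s acc => Kadd (f s) acc) (K0 c) F.

Definition tsum {c} (A : list nat -> Prop) (f : list nat -> K c) : K c :=
  epsilon (inhabits (K0 c)) (fun L => forall eps, 0 < eps -> exists F0,
    (forall s, In s F0 -> A s) /\
    forall F, NoDup F -> incl F0 F -> (forall s, In s F -> A s) ->
      Kabs (Ksub (fsum F f) L) < eps).

Definition ext {c T} (w : node T -> K c) (s : list nat) : K c :=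
  match excluded_middle_informative (T s) with
  | left H => w (exist _ s H)
  | right _ => K0 c
  end.

Definition l1 (c : bool) (T : list nat -> Prop) : NS c := {|
  car := node T -> K c;
  mem := fun x => exists M, forall F : list (node T), NoDup F ->
           fold_right (fun t acc => Kabs (x t) + acc) 0 F <= M;
  zero := fun _ => K0 c;
  add := fun x y t => Kadd (x t) (y t);
  opp := fun x t => Kopp (x t);
  scal := fun a x t => Kmul a (x t);
  norm := fun x => Rsup (fun r => exists F : list (node T), NoDup F /\
           r = fold_right (fun t acc => Kabs (x t) + acc) 0 F) |}.

Definition linf (c : bool) (T : list nat -> Prop) : NS c := {|
  car := node T -> K c;
  mem := fun x => exists M, forall t, Kabs (x t) <= M;
  zero := fun _ => K0 c;
  add := fun x y t => Kadd (x t) (y t);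
  opp := fun x t => Kopp (x t);
  scal := fun a x t => Kmul a (x t);
  norm := fun x => Rsup (fun r => r = 0 \/ exists t, r = Kabs (x t)) |}.

Definition Cspace (c : bool) (T : list nat -> Prop) : NS c := {|
  car := Tbar T -> K c;
  mem := fun f => cw_continuous f /\ exists M, forall u, Kabs (f u) <= M;
  zero := fun _ => K0 c;
  add := fun x y t => Kadd (x t) (y t);
  opp := fun x t => Kopp (x t);
  scal := fun a x t => Kmul a (x t);
  norm := fun f => Rsup (fun r => r = 0 \/ exists u, r = Kabs (f u)) |}.

Definition SigmaT (c : bool) (T : list nat -> Prop) : car (l1 c T) -> car (linf c T) :=
  fun w t => tsum (fun s => prefix s (proj1_sig t)) (ext w).

Definition sigmaT (c : bool) (T : list nat -> Prop) : car (l1 c T) -> car (Cspace c T) :=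
  fun x u => match u with
  | inl t => tsum (fun s => prefix s (proj1_sig t)) (ext x)
  | inr B => tsum (fun s => proj1_sig B s) (ext x)
  end.

Arguments l1 : clear implicits.
Arguments linf : clear implicits.
Arguments Cspace : clear implicits.
Arguments SigmaT : clear implicits.
Arguments sigmaT : clear implicits.

Definition universal_iii_iv (c : bool) (S : list nat -> Prop) : Prop :=
  universal (@nonAsplund c) (SigmaT c S) /\
  universal (@sep_cod_nonsep_adj c) (sigmaT c S) /\
  (forall (X Y : NS c) (T : car X -> car Y),
     @sep_cod_nonsep_adj c X Y T <-> (@nonAsplund c X Y T /\ separable Y)).

(* Main.v *)
(* A set of functionals on Y is small if countably many functionals approximate it, up to a fixed
   delta, uniformly on T(ball X). If the adjoint of T has non-separable range, some ball M of Y^*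
   is not small. Fix a sequence (d_i) in Y whose closure contains T(X); away from a small set, all
   points of M are condensation points: their neighbourhoods in M for the evaluations at finitely
   many d_i are not small.

   Code the nodes of Omega by naturals, parents first. One builds inductively phi_n in Y^* and x_n
   in X, both bounded, with phi_n(T x_m) = 1 if the node m is an initial segment of n, and 0
   otherwise. Given the earlier steps, choose psi among the condensation points close to the one
   used for the parent p of n. Since this neighbourhood is not small, psi can be taken large at T x
   for some x in the unit ball killed by the earlier functionals: otherwise finitely many
   evaluations would control psi on all of T(ball X). Correcting psi by a small combination of the
   differences phi_j - phi_(par j), which are biorthogonal to the T x_j, makes it agree exactly
   with phi_p on the earlier T x_m, and x is normalized to get x_n.

   Then e_n |-> x_n and y |-> (phi_n(y))_n factor Sigma_T through T. If (d_i) is dense in Y, the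
   neighbourhoods can be shrunk so that phi_n converges pointwise along branches, and y |-> phi(y)
   becomes a map into C(Tbar), which factors sigma_T. Conversely, if there are uncountably many
   branches, evaluation at the branches (along an ultrafilter for Sigma, whose codomain does not see
   them) gives uncountably many separated functionals. *)

From Stdlib Require Import Reals List ZArith Lra Lia Arith Cantor Permutation.
From Stdlib Require Import Classical ClassicalEpsilon FunctionalExtensionality.
From mathcomp Require filter.
Require Import Defs.
Import ListNotations.
Open Scope R_scope.

(** * Real and complex scalars *)

(** The delicate point is the order of choices at a node. The correction depends on [psi], so [x]
    seems to have to be sought for the corrected functional. But everything accumulated in the
    correction is a combination of functionals that vanish at [T x], so [psi] and its corrected
    version agree there and [x] may be found for [psi] alone. The corrected functional may cease to
    be a condensation point; hence each stage also stores its total correction [stH], and children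
    are sought near [stF - stH]. The total stays bounded since step n adds a functional of norm at
    most half of (1/2)^n. Asking only that (d_i) approximate T(X) lets one construction serve both
    hypotheses: the d_i are the images of a dense sequence of X, or a dense sequence of Y. The
    system is always built on all of Omega and then restricted to the tree. For the equality of
    classes in (iv) the factorization is read backwards: if sigma of the binary tree is V T U, then
    the closure of the range of U is a separable subspace on which the adjoint of T still has
    non-separable range. *)

Definition Kre {c} : K c -> R := if c return K c -> R then Cre else fun a => a.
Definition Kim {c} : K c -> R := if c return K c -> R then Cim else fun _ => 0.
Definition Kof {c} (x y : R) : K c :=
  if c return K c then mkCx x y else x.

Lemma Cx_eq (a b : Cx) : Cre a = Cre b -> Cim a = Cim b -> a = b.
Proof. destruct a, b; simpl; intros -> ->; reflexivity. Qed.

Lemma sqrt_le_of_sq (a b : R) : 0 <= b -> a <= b * b -> sqrt a <= b.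
Proof.
intros Hb H. rewrite <- (sqrt_square b Hb). now apply sqrt_le_1_alt.
Qed.

Lemma sqrt_ge_of_sq (a b : R) : 0 <= b -> b * b <= a -> b <= sqrt a.
Proof.
intros Hb H. rewrite <- (sqrt_square b Hb). now apply sqrt_le_1_alt.
Qed.

(** Registering this structure makes [ring] work for both scalar fields at once, without a case
    split on [c]. *)
Lemma Kring_theory {c} : ring_theory (K0 c) (K1 c) Kadd Kmul Ksub Kopp eq.
Proof.
destruct c; constructor; cbv [K K0 K1 Kadd Kmul Ksub Kopp]; intros;
  try (apply Cx_eq; simpl; ring); ring.
Qed.

Section Scalars.
Context {c : bool}.
Add Ring KRing : (@Kring_theory c).
Implicit Types a b : K c.

Lemma Kabs_pos a : 0 <= Kabs a.
Proof. destruct c; [apply sqrt_pos | apply Rabs_pos]. Qed.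

Lemma Kabs_0 : Kabs (K0 c) = 0.
Proof.
destruct c; simpl; [|apply Rabs_R0].
unfold Cabs; simpl. replace (0 * 0 + 0 * 0) with 0 by ring. apply sqrt_0.
Qed.

Lemma Kabs_1 : Kabs (K1 c) = 1.
Proof.
destruct c; simpl; [|apply Rabs_R1].
unfold Cabs; simpl. replace (1 * 1 + 0 * 0) with 1 by ring. apply sqrt_1.
Qed.

Lemma Kabs_re a : Rabs (Kre a) <= Kabs a.
Proof.
destruct c; simpl; [|lra].
apply sqrt_ge_of_sq; [apply Rabs_pos|].
rewrite <- Rabs_mult, Rabs_pos_eq; nra.
Qed.

Lemma Kabs_im a : Rabs (Kim a) <= Kabs a.
Proof.
destruct c; simpl; [|rewrite Rabs_R0; apply Rabs_pos].
apply sqrt_ge_of_sq; [apply Rabs_pos|].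
rewrite <- Rabs_mult, Rabs_pos_eq; nra.
Qed.

Lemma Kabs_le_re_im a : Kabs a <= Rabs (Kre a) + Rabs (Kim a).
Proof.
destruct c; simpl; [|rewrite Rabs_R0; unfold Kre; lra].
assert (H1 := Rabs_pos (Cre a)). assert (H2 := Rabs_pos (Cim a)).
apply sqrt_le_of_sq; [lra|].
assert (E1 : Rabs (Cre a) * Rabs (Cre a) = Cre a * Cre a)
  by (rewrite <- Rabs_mult; apply Rabs_pos_eq; nra).
assert (E2 : Rabs (Cim a) * Rabs (Cim a) = Cim a * Cim a)
  by (rewrite <- Rabs_mult; apply Rabs_pos_eq; nra).
nra.
Qed.

Lemma Kabs_mul a b : Kabs (Kmul a b) = Kabs a * Kabs b.
Proof.
destruct c; simpl; [|apply Rabs_mult].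
destruct a as [x y], b as [z w]; unfold Cabs; simpl.
rewrite <- sqrt_mult by nra. f_equal. ring.
Qed.

Lemma Kabs_opp a : Kabs (Kopp a) = Kabs a.
Proof.
destruct c; simpl; [|apply Rabs_Ropp]. unfold Cabs; simpl. f_equal. ring.
Qed.

Lemma Kabs_add a b : Kabs (Kadd a b) <= Kabs a + Kabs b.
Proof.
destruct c; simpl; [|apply Rabs_triang].
unfold Cabs. destruct a as [x y], b as [z w]; simpl.
assert (P1 := sqrt_pos (x*x+y*y)). assert (P2 := sqrt_pos (z*z+w*w)).
apply sqrt_le_of_sq; [lra|].
assert (E1 := sqrt_sqrt (x*x+y*y) ltac:(nra)).
assert (E2 := sqrt_sqrt (z*z+w*w) ltac:(nra)).
assert (x*z+y*w <= sqrt (x*x+y*y) * sqrt (z*z+w*w)).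
{ rewrite <- sqrt_mult by nra.
  apply Rle_trans with (Rabs (x*z+y*w)); [apply Rle_abs|].
  apply sqrt_ge_of_sq; [apply Rabs_pos|].
  rewrite <- Rabs_mult, Rabs_pos_eq by apply Rle_0_sqr.
  assert (H := Rle_0_sqr (x*w-y*z)). unfold Rsqr in H. nra. }
nra.
Qed.

Lemma Kabs_eq0 a : Kabs a = 0 -> a = K0 c.
Proof.
intros H. assert (H1 := Kabs_re a). assert (H2 := Kabs_im a). rewrite H in *.
assert (Kre a = 0) by (unfold Rabs in H1; destruct (Rcase_abs (Kre a)); lra).
assert (Kim a = 0) by (unfold Rabs in H2; destruct (Rcase_abs (Kim a)); lra).
destruct c; [now apply Cx_eq|assumption].
Qed.

Lemma Kabs_sub_sym a b : Kabs (Ksub a b) = Kabs (Ksub b a).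
Proof. rewrite <- Kabs_opp. f_equal. ring. Qed.

Lemma Kabs_sub_tri d a b : Kabs (Ksub a b) <= Kabs (Ksub a d) + Kabs (Ksub d b).
Proof.
replace (Ksub a b) with (Kadd (Ksub a d) (Ksub d b)) by ring. apply Kabs_add.
Qed.

Lemma Kabs_le_sub a b : Kabs a <= Kabs (Ksub a b) + Kabs b.
Proof.
replace a with (Kadd (Ksub a b) b) at 1 by ring. apply Kabs_add.
Qed.

Lemma Kabs_sub_le a b : Kabs (Ksub a b) <= Kabs a + Kabs b.
Proof. unfold Ksub. rewrite <- (Kabs_opp b). apply Kabs_add. Qed.

Lemma Kabs_sub_refl a : Kabs (Ksub a a) = 0.
Proof. replace (Ksub a a) with (K0 c) by ring. apply Kabs_0. Qed.

Lemma Ksub_eq0 a b : Ksub a b = K0 c -> a = b.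
Proof.
intros H. replace a with (Kadd (Ksub a b) b) by ring. rewrite H. ring.
Qed.

Lemma K_eq_of_close a b :
  (forall eps, 0 < eps -> Kabs (Ksub a b) <= eps) -> a = b.
Proof.
intros H. apply Ksub_eq0, Kabs_eq0. apply Rle_antisym; [|apply Kabs_pos].
apply le_epsilon. intros e He. rewrite Rplus_0_l. now apply H.
Qed.

Lemma Kabs_of_real r : Kabs (Kof r 0 : K c) = Rabs r.
Proof.
destruct c; simpl; [|reflexivity]. unfold Cabs; simpl.
replace (r*r+0*0) with (Rsqr r) by (unfold Rsqr; ring). apply sqrt_Rsqr_abs.
Qed.

Lemma K_inverse a : a <> K0 c ->
  exists b, Kmul b a = K1 c /\ Kabs b = / Kabs a.
Proof.
intros Ha. assert (Hn : 0 < Kabs a).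
{ destruct (Kabs_pos a) as [H|H]; [exact H|]. symmetry in H.
  now apply Kabs_eq0 in H. }
assert (exists b, Kmul b a = K1 c) as [b Hb].
{ destruct c; simpl in *.
  - unfold Cabs in Hn. destruct a as [x y]; simpl in *.
    assert (0 < x*x+y*y).
    { destruct (Rle_lt_dec (x*x+y*y) 0) as [H|H]; [|exact H].
      rewrite sqrt_neg_0 in Hn; lra. }
    exists (mkCx (x/(x*x+y*y)) (-y/(x*x+y*y))).
    apply Cx_eq; simpl; field; lra.
  - exists (/ a). unfold K0 in Ha. field. exact Ha. }
exists b. split; [exact Hb|].
assert (E := Kabs_mul b a). rewrite Hb, Kabs_1 in E.
apply Rmult_eq_reg_r with (Kabs a); [|lra]. rewrite <- E. field. lra.
Qed.

Lemma Kabs_of_sub a (x y : R) :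
  Kabs (Ksub a (Kof x (if c then y else 0))) <=
    Rabs (Kre a - x) + Rabs (Kim a - (if c then y else 0)).
Proof.
eapply Rle_trans; [apply Kabs_le_re_im|].
destruct c; simpl; unfold Rminus; [lra|].
rewrite Ropp_0, Rplus_0_r. unfold Ksub, Kim, Kre; simpl. lra.
Qed.

Lemma R_finite_net (M eta : R) : 0 < eta ->
  exists L : list R, forall x, Rabs x <= M -> exists y, In y L /\ Rabs (x - y) <= eta.
Proof.
(* [M] may be negative, and then no [x] qualifies; [Rmax] keeps the choice of [N] uniform. *)
intros He. destruct (INR_unbounded (2 * Rmax M 0 / eta)) as [N HN].
exists (map (fun i => INR i * eta - M) (seq 0 (S N))).
intros x Hx.
assert (HM : 0 <= M) by (eapply Rle_trans; [apply Rabs_pos | exact Hx]).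
rewrite Rmax_left in HN by lra.
assert (Hx' : - M <= x <= M) by (unfold Rabs in Hx; destruct (Rcase_abs x); lra).
assert (H1 : 2 * M < INR N * eta).
{ apply Rmult_lt_reg_r with (/ eta); [now apply Rinv_0_lt_compat|].
  replace (INR N * eta * / eta) with (INR N) by (field; lra). exact HN. }
assert (H : forall n, x + M <= INR n * eta ->
   exists i, (i <= n)%nat /\ Rabs (x - (INR i * eta - M)) <= eta).
{ induction n as [|n IH]; intros Hn.
  - exists 0%nat. split; [lia|]. simpl in *.
    rewrite Rabs_pos_eq; lra.
  - destruct (Rle_lt_dec (x + M) (INR n * eta)) as [H|H].
    + destruct (IH H) as [i [Hi Hi']]. exists i. split; [lia|exact Hi'].
    + exists n. split; [lia|]. rewrite S_INR in Hn. apply Rabs_le. lra. }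
destruct (H N) as [i [Hi Hi']]; [lra|].
exists (INR i * eta - M). split; [|exact Hi'].
apply in_map_iff. exists i. split; [reflexivity|]. apply in_seq. lia.
Qed.

Lemma K_finite_net (M eta : R) : 0 < eta ->
  exists L : list (K c), forall a, Kabs a <= M ->
    exists b, In b L /\ Kabs (Ksub a b) <= eta.
Proof.
intros He. destruct (R_finite_net M (eta/2) ltac:(lra)) as [L HL].
exists (map (fun p => Kof (fst p) (if c then snd p else 0)) (list_prod L L)).
intros a Ha.
destruct (HL (Kre a)) as [x [Hx Hx']].
{ eapply Rle_trans; [apply Kabs_re|exact Ha]. }
destruct (HL (Kim a)) as [y [Hy Hy']].
{ eapply Rle_trans; [apply Kabs_im|exact Ha]. }
exists (Kof x (if c then y else 0)). split.
- apply in_map_iff. exists (x, y). split; [reflexivity|]. now apply in_prod.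
- eapply Rle_trans; [apply Kabs_of_sub|].
  assert (Rabs (Kim a - (if c then y else 0)) <= eta / 2).
  { destruct c; [exact Hy'|]. unfold Kim. rewrite Rminus_0_r, Rabs_R0. lra. }
  lra.
Qed.

(** An enumeration of the rationals, with repetitions. *)
Definition Rq (n : nat) : R :=
  let (i, m) := Cantor.of_nat n in let (j, k) := Cantor.of_nat m in
  (INR i - INR j) / (INR k + 1).

Lemma Rq_dense (x eps : R) : 0 < eps -> exists n, Rabs (Rq n - x) < eps.
Proof.
intros He.
destruct (INR_unbounded (/ eps)) as [k Hk].
set (q := INR k + 1). assert (Hq : 0 < q) by (unfold q; assert (H := pos_INR k); lra).
assert (Hqe : / q < eps).
{ rewrite <- (Rinv_inv eps). apply Rinv_lt_contravar.
  - apply Rmult_lt_0_compat; [now apply Rinv_0_lt_compat|exact Hq].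
  - unfold q; lra. }
destruct (archimed (x * q)) as [A1 A2].
set (z := up (x * q)) in *.
assert (exists i j, IZR z = INR i - INR j) as [i [j Hz]].
{ destruct (Z.le_ge_cases 0 z) as [H|H].
  - exists (Z.to_nat z), 0%nat. rewrite INR_IZR_INZ, Z2Nat.id by exact H. simpl. lra.
  - exists 0%nat, (Z.to_nat (-z)). rewrite (INR_IZR_INZ (Z.to_nat _)), Z2Nat.id by lia.
    rewrite opp_IZR. simpl. lra. }
exists (Cantor.to_nat (i, Cantor.to_nat (j, k))).
unfold Rq. rewrite !Cantor.cancel_of_to. fold q. rewrite <- Hz.
replace (IZR z / q - x) with ((IZR z - x * q) * / q) by (field; lra).
rewrite Rabs_pos_eq.
2:{ apply Rmult_le_pos; [lra|]. left. now apply Rinv_0_lt_compat. }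
apply Rle_lt_trans with (1 * / q); [|lra].
apply Rmult_le_compat_r; [left; now apply Rinv_0_lt_compat | lra].
Qed.

(** A dense sequence of scalars that starts with zero: reading a list of indices with [nth] and
    default [O] then gives a finitely supported sequence of scalars. This form is used for the dense
    sets in [l1] and [Cspace]. *)
Definition Kq (n : nat) : K c :=
  match n with
  | O => K0 c
  | S n => let (i, j) := Cantor.of_nat n in Kof (Rq i) (if c then Rq j else 0)
  end.

Lemma Kq_dense a eps : 0 < eps -> exists n, Kabs (Ksub (Kq n) a) < eps.
Proof.
intros He.
destruct (Rq_dense (Kre a) (eps/2) ltac:(lra)) as [i Hi].
destruct (Rq_dense (Kim a) (eps/2) ltac:(lra)) as [j Hj].
exists (S (Cantor.to_nat (i, j))). unfold Kq. rewrite Cantor.cancel_of_to.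
rewrite Kabs_sub_sym. eapply Rle_lt_trans; [apply Kabs_of_sub|].
rewrite Rabs_minus_sym in Hi.
assert (Rabs (Kim a - (if c then Rq j else 0)) < eps/2).
{ destruct c; [now rewrite Rabs_minus_sym|]. unfold Kim. rewrite Rminus_0_r, Rabs_R0. lra. }
lra.
Qed.

End Scalars.

(** * Finite sums, finite nets and limits along filters *)

Lemma choice_fun {A B} (R : A -> B -> Prop) :
  (forall a, exists b, R a b) -> exists f : A -> B, forall a, R a (f a).
Proof.
intros H. exists (fun a => proj1_sig (constructive_indefinite_description _ (H a))).
intros a. apply proj2_sig.
Qed.

(** Choice where each step may inspect all earlier values. [F n] is the table of the first [n]
    values; the extensionality hypothesis says that [R n] looks at nothing else, so the tables can
    be glued along the diagonal. *)
Lemma history_choice {A} (a0 : A) (R : nat -> (nat -> A) -> A -> Prop) :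
  (forall n f f' a, (forall m, (m < n)%nat -> f m = f' m) -> R n f a -> R n f' a) ->
  (forall n f, (forall m, (m < n)%nat -> R m f (f m)) -> exists a, R n f a) ->
  exists f, forall n, R n f (f n).
Proof.
intros Hext Hex.
set (F := fix F (n : nat) : nat -> A := match n with
  | O => fun _ => a0
  | S n => fun m => if Nat.eq_dec m n then epsilon (inhabits a0) (R n (F n)) else F n m
  end).
assert (HF : forall k n m, (m < n)%nat -> F (k + n)%nat m = F n m).
{ induction k as [|k IH]; intros n m Hm; [reflexivity|].
  simpl. destruct (Nat.eq_dec m (k + n)); [lia|]. now apply IH. }
set (f := fun n => F (S n) n).
assert (Hf : forall n m, (m < n)%nat -> F n m = f m).
{ intros n m Hm. unfold f. replace n with ((n - S m) + S m)%nat by lia.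
  apply HF. lia. }
exists f. intros n. induction n as [n IH] using lt_wf_ind.
unfold f. simpl. destruct (Nat.eq_dec n n) as [_|]; [|lia].
apply Hext with (F n); [intros m Hm; now apply Hf|].
apply epsilon_spec. apply Hex. intros m Hm. rewrite Hf by exact Hm.
apply Hext with f; [|now apply IH].
intros j Hj. symmetry. apply Hf. lia.
Qed.

Lemma Rsup_lub (E : R -> Prop) :
  (exists x, E x) -> (exists m, forall x, E x -> x <= m) -> is_lub E (Rsup E).
Proof.
intros H1 [m H2]. unfold Rsup. apply epsilon_spec.
destruct (completeness E) as [s Hs]; [now exists m|exact H1|now exists s].
Qed.

Lemma Rsup_ub (E : R -> Prop) m x : (forall x, E x -> x <= m) -> E x -> x <= Rsup E.
Proof. intros Hm Hx. apply Rsup_lub; [now exists x|now exists m|exact Hx]. Qed.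

Lemma Rsup_le (E : R -> Prop) m : (exists x, E x) -> (forall x, E x -> x <= m) -> Rsup E <= m.
Proof. intros He Hm. apply Rsup_lub; [exact He|now exists m|exact Hm]. Qed.

Definition ksum {c A} (l : list A) (f : A -> K c) : K c :=
  fold_right (fun a s => Kadd (f a) s) (K0 c) l.
Definition rsum {A} (l : list A) (f : A -> R) : R :=
  fold_right (fun a s => f a + s) 0 l.

Section Sums.
Context {c : bool} {A : Type}.
Add Ring KRing : (@Kring_theory c).
Implicit Types (l : list A) (f g : A -> K c) (u v : A -> R).

Lemma ksum_app l l' f : ksum (l ++ l') f = Kadd (ksum l f) (ksum l' f).
Proof. induction l; simpl; [ring|]. rewrite IHl. ring. Qed.

Lemma rsum_app l l' u : rsum (l ++ l') u = rsum l u + rsum l' u.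
Proof. induction l; simpl; lra. Qed.

Lemma ksum_ext l f g : (forall a, In a l -> f a = g a) -> ksum l f = ksum l g.
Proof.
induction l as [|a l IH]; simpl; intros H; [reflexivity|].
rewrite (H a), IH; auto.
Qed.

Lemma ksum_0 l f : (forall a, In a l -> f a = K0 c) -> ksum l f = K0 c.
Proof.
induction l as [|a l IH]; simpl; intros H; [reflexivity|].
rewrite (H a), IH by auto. ring.
Qed.

Lemma ksum_add l f g : ksum l (fun a => Kadd (f a) (g a)) = Kadd (ksum l f) (ksum l g).
Proof. induction l; simpl; [ring|]. rewrite IHl. ring. Qed.

Lemma ksum_scal l k f : ksum l (fun a => Kmul k (f a)) = Kmul k (ksum l f).
Proof. induction l; simpl; [ring|]. rewrite IHl. ring. Qed.

Lemma Kabs_ksum l f : Kabs (ksum l f) <= rsum l (fun a => Kabs (f a)).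
Proof.
induction l; simpl; [rewrite Kabs_0; lra|].
eapply Rle_trans; [apply Kabs_add|]. lra.
Qed.

Lemma rsum_le l u v : (forall a, In a l -> u a <= v a) -> rsum l u <= rsum l v.
Proof.
induction l as [|a l IH]; simpl; intros H; [lra|].
assert (H1 := H a (or_introl eq_refl)). assert (rsum l u <= rsum l v) by auto. lra.
Qed.

Lemma rsum_ext l u v : (forall a, In a l -> u a = v a) -> rsum l u = rsum l v.
Proof.
intros H. apply Rle_antisym; apply rsum_le; intros a Ha; rewrite (H a Ha); lra.
Qed.

Lemma rsum_nonneg l u : (forall a, In a l -> 0 <= u a) -> 0 <= rsum l u.
Proof.
induction l as [|a l IH]; simpl; intros H; [lra|].
assert (H1 := H a (or_introl eq_refl)). assert (0 <= rsum l u) by auto. lra.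
Qed.

Lemma rsum_add l u v : rsum l (fun a => u a + v a) = rsum l u + rsum l v.
Proof. induction l; simpl; lra. Qed.

Lemma rsum_scal l k u : rsum l (fun a => k * u a) = k * rsum l u.
Proof. induction l; simpl; lra. Qed.

Lemma rsum_const l k : rsum l (fun _ => k) = INR (length l) * k.
Proof. induction l as [|a l IH]; [simpl; lra|]. simpl length. rewrite S_INR. simpl. lra. Qed.

Lemma rsum_ge_mem l u a : (forall a, In a l -> 0 <= u a) -> In a l -> u a <= rsum l u.
Proof.
induction l as [|b l IH]; simpl; intros H Ha; [tauto|].
assert (0 <= rsum l u) by (apply rsum_nonneg; auto).
destruct Ha as [->|Ha]; [lra|].
assert (u a <= rsum l u) by auto. assert (H2 := H b (or_introl eq_refl)). lra.
Qed.

Lemma ksum_perm l l' f : Permutation l l' -> ksum l f = ksum l' f.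
Proof. induction 1; simpl; [reflexivity|congruence|ring|congruence]. Qed.

Lemma rsum_perm l l' u : Permutation l l' -> rsum l u = rsum l' u.
Proof. induction 1; simpl; lra. Qed.

Lemma rsum_incl l l' u : (forall a, 0 <= u a) -> NoDup l -> incl l l' -> rsum l u <= rsum l' u.
Proof.
revert l'. induction l as [|a l IH]; intros l' Hu Hn Hi.
- apply rsum_nonneg. auto.
- assert (Ha : In a l') by (apply Hi; now left).
  destruct (in_split _ _ Ha) as [l1 [l2 ->]].
  assert (P : Permutation (l1 ++ a :: l2) (a :: l1 ++ l2))
    by (symmetry; apply Permutation_middle).
  rewrite (rsum_perm _ _ _ P). simpl. apply Rplus_le_compat_l.
  inversion_clear Hn as [|? ? Ha' Hl].
  apply IH; auto. intros b Hb.
  assert (Hb' : In b (l1 ++ a :: l2)) by (apply Hi; now right).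
  apply in_app_iff in Hb'. apply in_app_iff. simpl in Hb'.
  destruct Hb' as [|[->|]]; auto. contradiction.
Qed.

End Sums.

Lemma ksum_map {c A B} (l : list A) (h : A -> B) (f : B -> K c) :
  ksum (map h l) f = ksum l (fun a => f (h a)).
Proof. induction l; simpl; congruence. Qed.

Lemma rsum_map {A B} (l : list A) (h : A -> B) (f : B -> R) :
  rsum (map h l) f = rsum l (fun a => f (h a)).
Proof. induction l; simpl; congruence. Qed.

Lemma ksum_delta {c} (n j : nat) (f : nat -> K c) : (j < n)%nat ->
  (forall i, i <> j -> f i = K0 c) -> ksum (seq 0 n) f = f j.
Proof.
intros Hj Hf. assert (Ra := @Kring_theory c).
replace n with (j + S (n - S j))%nat by lia.
rewrite seq_app, ksum_app. simpl.
rewrite (ksum_0 (seq 0 j)), (ksum_0 (seq (S j) _)).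
- rewrite (Radd_0_l Ra), (Radd_comm Ra), (Radd_0_l Ra). reflexivity.
- intros i Hi. apply in_seq in Hi. apply Hf. lia.
- intros i Hi. apply in_seq in Hi. apply Hf. lia.
Qed.

(** Induction on the list of functions: [P] is cut into pieces on which [f] lies within [eta / 2] of
    one scalar of a finite net, and the remaining functions are treated on each piece. Two points of
    a piece differ by at most [eta] under [f], so the net can be taken inside [P] itself. *)
Lemma totally_bounded {c A} (fs : list (A -> K c)) (M eta : R) : 0 < eta ->
  forall P : A -> Prop, (forall f a, In f fs -> P a -> Kabs (f a) <= M) ->
  exists l : list A, (forall a, In a l -> P a) /\
    forall a, P a -> exists b, In b l /\ forall f, In f fs -> Kabs (Ksub (f a) (f b)) <= eta.
Proof.
intros He. induction fs as [|f fs IH]; intros P HP.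
- destruct (classic (exists a, P a)) as [[a Ha]|Hn].
  + exists [a]. split.
    * intros b [<-|[]]; exact Ha.
    * intros b Hb. exists a. split; [now left|]. intros f [].
  + exists []. split; [intros a []|]. intros a Ha. exfalso. eauto.
- destruct (K_finite_net (c := c) M (eta / 2) ltac:(lra)) as [L HL].
  assert (H : forall L' : list (K c), exists l : list A, (forall a, In a l -> P a) /\
    forall a, P a -> (exists k, In k L' /\ Kabs (Ksub (f a) k) <= eta / 2) ->
    exists b, In b l /\ forall f', In f' (f :: fs) -> Kabs (Ksub (f' a) (f' b)) <= eta).
  { induction L' as [|k L' IHL].
    - exists []. split; [intros a []|]. intros a _ [k [[] _]].
    - destruct IHL as [l1 [H1 H2]].
      destruct (IH (fun a => P a /\ Kabs (Ksub (f a) k) <= eta / 2)) as [l2 [H3 H4]].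
      { intros f' a Hf' [Ha _]. apply HP; [now right|exact Ha]. }
      exists (l2 ++ l1). split.
      + intros a Ha. apply in_app_iff in Ha. destruct Ha as [Ha|Ha]; [now apply H3|auto].
      + intros a Ha [k' [[<-|Hk'] Hk]].
        * destruct (H4 a (conj Ha Hk)) as [b [Hb Hb']].
          exists b. split; [apply in_app_iff; now left|].
          intros f' [<-|Hf']; [|auto].
          destruct (H3 b Hb) as [_ Hbk].
          eapply Rle_trans; [apply Kabs_sub_tri with (d := k)|].
          rewrite (Kabs_sub_sym k). lra.
        * destruct (H2 a Ha) as [b [Hb Hb']]; [now exists k'|].
          exists b. split; [apply in_app_iff; now right|exact Hb']. }
  destruct (H L) as [l [H1 H2]]. exists l. split; [exact H1|].
  intros a Ha. apply H2; [exact Ha|]. apply HL. apply HP; [now left|exact Ha].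
Qed.

(** One notion of limit for four uses: sequences, limits along a branch, ultrafilter limits, and
    unconditional sums. *)
Record proper_filter {I} (F : (I -> Prop) -> Prop) : Prop := {
  pf_true : F (fun _ => True);
  pf_mono : forall P Q : I -> Prop, (forall i, P i -> Q i) -> F P -> F Q;
  pf_and : forall P Q, F P -> F Q -> F (fun i => P i /\ Q i);
  pf_false : ~ F (fun _ => False) }.

Definition klim {I c} (F : (I -> Prop) -> Prop) (u : I -> K c) (L : K c) : Prop :=
  forall eps, 0 < eps -> F (fun i => Kabs (Ksub (u i) L) < eps).

Definition klimval {I c} (F : (I -> Prop) -> Prop) (u : I -> K c) : K c :=
  epsilon (inhabits (K0 c)) (klim F u).

Section Filters.
Context {I : Type} {c : bool} {F : (I -> Prop) -> Prop} (HF : proper_filter F).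
Add Ring KRing : (@Kring_theory c).
Implicit Types (u v : I -> K c) (L : K c).

Lemma pf_all (P : I -> Prop) : (forall i, P i) -> F P.
Proof. intros H. apply (pf_mono _ HF) with (fun _ => True); [auto|apply (pf_true _ HF)]. Qed.

Lemma pf_ex (P : I -> Prop) : F P -> exists i, P i.
Proof.
intros H. apply NNPP. intros Hn. apply (pf_false _ HF).
apply (pf_mono _ HF) with P; [|exact H]. intros i Hi. eauto.
Qed.

Lemma klim_eventually u v L : F (fun i => u i = v i) -> klim F u L -> klim F v L.
Proof.
intros H1 H2 e He. apply (pf_mono _ HF) with (2 := pf_and _ HF _ _ H1 (H2 e He)).
intros i [<- H]. exact H.
Qed.

Lemma klim_const L : klim F (fun _ => L) L.
Proof. intros e He. apply pf_all. intros _. now rewrite Kabs_sub_refl. Qed.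

Lemma klim_dist_le u L L0 r : klim F u L ->
  F (fun i => Kabs (Ksub (u i) L0) <= r) -> Kabs (Ksub L L0) <= r.
Proof.
intros H1 H2. apply le_epsilon. intros e He.
destruct (pf_ex _ (pf_and _ HF _ _ (H1 e He) H2)) as [i [Hi Hi']].
assert (H := Kabs_sub_tri (u i) L L0). rewrite (Kabs_sub_sym L (u i)) in H. lra.
Qed.

Lemma klim_abs_le u L r : klim F u L -> F (fun i => Kabs (u i) <= r) -> Kabs L <= r.
Proof.
intros H1 H2. replace L with (Ksub L (K0 c)) by ring.
apply klim_dist_le with u; [exact H1|].
apply (pf_mono _ HF) with (2 := H2). intros i Hi.
replace (Ksub (u i) (K0 c)) with (u i) by ring. exact Hi.
Qed.

Lemma klim_unique u L L' : klim F u L -> klim F u L' -> L = L'.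
Proof.
intros H1 H2. apply K_eq_of_close. intros e He. apply klim_dist_le with u; [exact H1|].
apply (pf_mono _ HF) with (2 := H2 e He). intros; lra.
Qed.

Lemma klim_add u v L L' : klim F u L -> klim F v L' ->
  klim F (fun i => Kadd (u i) (v i)) (Kadd L L').
Proof.
intros H1 H2 e He.
apply (pf_mono _ HF) with
  (2 := pf_and _ HF _ _ (H1 (e/2) ltac:(lra)) (H2 (e/2) ltac:(lra))).
intros i [A B]. replace (Ksub _ _) with (Kadd (Ksub (u i) L) (Ksub (v i) L')) by ring.
eapply Rle_lt_trans; [apply Kabs_add|]. lra.
Qed.

Lemma klim_scal a u L : klim F u L -> klim F (fun i => Kmul a (u i)) (Kmul a L).
Proof.
intros H e He. assert (Ha := Kabs_pos a).
assert (He' : 0 < e / (Kabs a + 1)) by (apply Rdiv_lt_0_compat; lra).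
apply (pf_mono _ HF) with (2 := H _ He').
intros i Hi. replace (Ksub _ _) with (Kmul a (Ksub (u i) L)) by ring.
rewrite Kabs_mul. assert (P := Kabs_pos (Ksub (u i) L)).
apply Rle_lt_trans with ((Kabs a + 1) * Kabs (Ksub (u i) L)); [nra|].
apply Rmult_lt_reg_r with (/ (Kabs a + 1)); [apply Rinv_0_lt_compat; lra|].
replace (_ * _ * / _) with (Kabs (Ksub (u i) L)) by (field; lra). exact Hi.
Qed.

Lemma Kre_sub (a b : K c) : Kre (Ksub a b) = Kre a - Kre b.
Proof. destruct c; reflexivity. Qed.

Lemma Kim_sub (a b : K c) : Kim (Ksub a b) = Kim a - Kim b.
Proof. destruct c; simpl; [reflexivity|]. unfold Kim. ring. Qed.

Lemma K_seq_complete (u : nat -> K c) :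
  (forall eps, 0 < eps -> exists N, forall m n, (N <= m)%nat -> (N <= n)%nat ->
     Kabs (Ksub (u m) (u n)) < eps) ->
  exists L, forall eps, 0 < eps -> exists N, forall n, (N <= n)%nat -> Kabs (Ksub (u n) L) < eps.
Proof.
intros H.
assert (C1 : Cauchy_crit (fun n => Kre (u n))).
{ intros e He. destruct (H e He) as [N HN]. exists N. intros n m Hn Hm.
  unfold Rdist. rewrite <- Kre_sub. eapply Rle_lt_trans; [apply Kabs_re|]. now apply HN. }
assert (C2 : Cauchy_crit (fun n => Kim (u n))).
{ intros e He. destruct (H e He) as [N HN]. exists N. intros n m Hn Hm.
  unfold Rdist. rewrite <- Kim_sub. eapply Rle_lt_trans; [apply Kabs_im|]. now apply HN. }
destruct (R_complete _ C1) as [x Hx], (R_complete _ C2) as [y Hy].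
exists (Kof x (if c then y else 0)). intros e He.
destruct (Hx (e/2) ltac:(lra)) as [N1 H1], (Hy (e/2) ltac:(lra)) as [N2 H2].
exists (N1 + N2)%nat. intros n Hn. eapply Rle_lt_trans; [apply Kabs_of_sub|].
specialize (H1 n ltac:(lia)). specialize (H2 n ltac:(lia)). unfold Rdist in *.
assert (Rabs (Kim (u n) - (if c then y else 0)) < e / 2).
{ destruct c; [exact H2|]. unfold Kim. rewrite Rminus_0_r, Rabs_R0. lra. }
lra.
Qed.

Lemma inv_INR_small (eps : R) : 0 < eps ->
  exists N, forall n, (N <= n)%nat -> / (INR n + 1) < eps.
Proof.
intros He. destruct (INR_unbounded (/ eps)) as [N HN]. exists N. intros n Hn.
apply le_INR in Hn. rewrite <- (Rinv_inv eps). apply Rinv_lt_contravar; [|lra].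
assert (0 < / eps) by now apply Rinv_0_lt_compat. nra.
Qed.

(** The Cauchy criterion for filters: centres chosen at scale 1/(n+1) form a Cauchy sequence, since
    two sets of the filter always share a point. *)
Lemma klim_exists u :
  (forall eps, 0 < eps -> exists L0, F (fun i => Kabs (Ksub (u i) L0) <= eps)) ->
  exists L, klim F u L.
Proof.
intros H.
assert (Hpos : forall n, 0 < / (INR n + 1)).
{ intros n. apply Rinv_0_lt_compat. assert (P := pos_INR n). lra. }
destruct (choice_fun (fun n L0 => F (fun i => Kabs (Ksub (u i) L0) <= / (INR n + 1))))
  as [a Ha]; [intros n; now apply H|].
destruct (K_seq_complete a) as [L HL].
{ intros e He. destruct (inv_INR_small (e/2) ltac:(lra)) as [N HN].
  exists N. intros m n Hm Hn.
  destruct (pf_ex _ (pf_and _ HF _ _ (Ha m) (Ha n))) as [i [H1 H2]].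
  assert (T := Kabs_sub_tri (u i) (a m) (a n)). rewrite (Kabs_sub_sym (a m) (u i)) in T.
  assert (A := HN m Hm). assert (B := HN n Hn). lra. }
exists L. intros e He.
destruct (HL (e/2) ltac:(lra)) as [N1 H1], (inv_INR_small (e/2) ltac:(lra)) as [N2 H2].
apply (pf_mono _ HF) with (2 := Ha (N1 + N2)%nat). intros i Hi.
specialize (H1 (N1 + N2)%nat ltac:(lia)). specialize (H2 (N1 + N2)%nat ltac:(lia)).
assert (T := Kabs_sub_tri (a (N1 + N2)%nat) (u i) L). lra.
Qed.

Lemma klimval_spec u :
  (forall eps, 0 < eps -> exists L0, F (fun i => Kabs (Ksub (u i) L0) <= eps)) ->
  klim F u (klimval F u).
Proof. intros H. unfold klimval. apply epsilon_spec. now apply klim_exists. Qed.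

Lemma klimval_eq u L : klim F u L -> klimval F u = L.
Proof.
intros H. apply klim_unique with u; [|exact H].
unfold klimval. apply epsilon_spec. now exists L.
Qed.

End Filters.

Definition at_infinity (P : nat -> Prop) : Prop := exists N, forall n, (N <= n)%nat -> P n.

Lemma at_infinity_proper : proper_filter at_infinity.
Proof.
split.
- now exists 0%nat.
- intros P Q H [N HN]. exists N. auto.
- intros P Q [N HN] [M HM]. exists (N + M)%nat. intros n Hn. split; [apply HN|apply HM]; lia.
- intros [N HN]. exact (HN N (le_n N)).
Qed.

(** * Banach spaces and bounded functionals *)

Ltac banach HX :=
  destruct HX as (?&?&?&?&?&?&?&?&?&?&?&?&?&?&?&?&?); assumption.

Section Normed.
Context {c : bool} {X : NS c} (HX : is_Banach X).
Add Ring KRing : (@Kring_theory c).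
Implicit Types x y z : car X.

Lemma mem_zero : mem X (zero X). Proof. banach HX. Qed.
Lemma mem_add : forall x y, mem X x -> mem X y -> mem X (add X x y). Proof. banach HX. Qed.
Lemma mem_opp : forall x, mem X x -> mem X (opp X x). Proof. banach HX. Qed.
Lemma mem_scal : forall a x, mem X x -> mem X (scal X a x). Proof. banach HX. Qed.
Lemma add_assoc : forall x y z, mem X x -> mem X y -> mem X z ->
  add X x (add X y z) = add X (add X x y) z. Proof. banach HX. Qed.
Lemma add_comm : forall x y, mem X x -> mem X y -> add X x y = add X y x.
Proof. banach HX. Qed.
Lemma add_zero : forall x, mem X x -> add X x (zero X) = x. Proof. banach HX. Qed.
Lemma add_opp : forall x, mem X x -> add X x (opp X x) = zero X. Proof. banach HX. Qed.
Lemma scal_mul : forall a b x, mem X x -> scal X a (scal X b x) = scal X (Kmul a b) x.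
Proof. banach HX. Qed.
Lemma scal_1 : forall x, mem X x -> scal X (K1 c) x = x. Proof. banach HX. Qed.
Lemma scal_add : forall a x y, mem X x -> mem X y ->
  scal X a (add X x y) = add X (scal X a x) (scal X a y). Proof. banach HX. Qed.
Lemma add_scal : forall a b x, mem X x ->
  scal X (Kadd a b) x = add X (scal X a x) (scal X b x). Proof. banach HX. Qed.
Lemma norm_pos : forall x, mem X x -> 0 <= norm X x. Proof. banach HX. Qed.
Lemma norm_eq0 : forall x, mem X x -> norm X x = 0 -> x = zero X. Proof. banach HX. Qed.
Lemma norm_scal : forall a x, mem X x -> norm X (scal X a x) = Kabs a * norm X x.
Proof. banach HX. Qed.
Lemma norm_add : forall x y, mem X x -> mem X y -> norm X (add X x y) <= norm X x + norm X y.
Proof. banach HX. Qed.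
Lemma complete : forall u : nat -> car X, (forall n, mem X (u n)) ->
     (forall eps, 0 < eps -> exists N, forall m n, (N <= m)%nat -> (N <= n)%nat ->
        dist X (u m) (u n) < eps) ->
     exists x, mem X x /\
       (forall eps, 0 < eps -> exists N, forall n, (N <= n)%nat -> dist X (u n) x < eps).
Proof. banach HX. Qed.

Hint Resolve mem_zero mem_add mem_opp mem_scal : core.

Lemma add_cancel x y z : mem X x -> mem X y -> mem X z -> add X x y = add X x z -> y = z.
Proof.
intros Hx Hy Hz E.
assert (F : forall w, mem X w -> add X (opp X x) (add X x w) = w).
{ intros w Hw. rewrite add_assoc by auto. rewrite (add_comm (opp X x)) by auto.
  rewrite add_opp, add_comm by auto. now apply add_zero. }
rewrite <- (F y Hy), E. now apply F.
Qed.

Lemma scal_0 x : mem X x -> scal X (K0 c) x = zero X.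
Proof.
intros Hx. apply add_cancel with (scal X (K0 c) x); auto.
rewrite <- add_scal, add_zero by auto. f_equal. ring.
Qed.

Lemma opp_scal x : mem X x -> opp X x = scal X (Kopp (K1 c)) x.
Proof.
intros Hx. apply add_cancel with x; auto. rewrite add_opp by auto.
rewrite <- (scal_1 x Hx) at 1. rewrite <- add_scal by auto.
rewrite <- (scal_0 x) by auto. f_equal. ring.
Qed.

Lemma norm_zero : norm X (zero X) = 0.
Proof. rewrite <- (scal_0 (zero X)), norm_scal, Kabs_0 by auto. ring. Qed.

Lemma norm_opp x : mem X x -> norm X (opp X x) = norm X x.
Proof. intros Hx. rewrite opp_scal, norm_scal, Kabs_opp, Kabs_1 by auto. ring. Qed.

Lemma dist_pos x y : mem X x -> mem X y -> 0 <= dist X x y.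
Proof. intros. apply norm_pos; auto. Qed.

Lemma dist_sym x y : mem X x -> mem X y -> dist X x y = dist X y x.
Proof.
intros Hx Hy. unfold dist. rewrite <- norm_opp by auto. f_equal.
rewrite (opp_scal (add X x _)) by auto.
rewrite scal_add by auto. rewrite (opp_scal y) by auto. rewrite scal_mul by auto.
rewrite (opp_scal x) by auto.
replace (Kmul _ _) with (K1 c) by ring. rewrite scal_1 by auto. apply add_comm; auto.
Qed.

Lemma sub_add_sub x y z : mem X x -> mem X y -> mem X z ->
  add X x (opp X y) = add X (add X x (opp X z)) (add X z (opp X y)).
Proof.
intros. rewrite <- add_assoc by auto. f_equal.
rewrite add_assoc by auto. rewrite (add_comm (opp X z)) by auto.
rewrite add_opp by auto. rewrite add_comm, add_zero by auto. reflexivity.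
Qed.

Lemma dist_tri z x y : mem X x -> mem X y -> mem X z -> dist X x y <= dist X x z + dist X z y.
Proof.
intros. unfold dist. rewrite (sub_add_sub x y z) by auto. apply norm_add; auto.
Qed.

Lemma norm_le_dist x y : mem X x -> mem X y -> norm X x <= norm X y + dist X x y.
Proof.
intros Hx Hy. assert (E : x = add X y (add X x (opp X y))).
{ rewrite (add_comm x) by auto. rewrite add_assoc by auto.
  rewrite add_opp by auto. rewrite add_comm, add_zero by auto. reflexivity. }
rewrite E at 1. apply norm_add; auto.
Qed.

Lemma dist_eq0 x y : mem X x -> mem X y -> dist X x y = 0 -> x = y.
Proof.
intros Hx Hy H. apply norm_eq0 in H; auto.
apply add_cancel with (opp X y); auto.
rewrite (add_comm _ x), (add_comm _ y) by auto. rewrite H. symmetry. now apply add_opp.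
Qed.

(** The ball of radius [M] of the dual. [bounded_fun] hides the constant, which the estimates and
    the notion of smallness need. *)
Definition lfun (M : R) (f : car X -> K c) : Prop :=
  (forall x y, mem X x -> mem X y -> f (add X x y) = Kadd (f x) (f y)) /\
  (forall a x, mem X x -> f (scal X a x) = Kmul a (f x)) /\
  (forall x, mem X x -> Kabs (f x) <= M * norm X x).

Lemma lfun_bounded_fun M f : lfun M f -> bounded_fun X f.
Proof. intros (H1&H2&H3). repeat split; auto. now exists M. Qed.

Lemma lfun_mono M M' f : M <= M' -> lfun M f -> lfun M' f.
Proof.
intros H (H1&H2&H3). repeat split; auto. intros x Hx.
eapply Rle_trans; [now apply H3|]. apply Rmult_le_compat_r; auto. now apply norm_pos.
Qed.

Lemma bounded_fun_lfun f : bounded_fun X f -> exists M, 0 <= M /\ lfun M f.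
Proof.
intros (H1&H2&M&H3). exists (Rmax M 0). split; [apply Rmax_r|].
apply lfun_mono with M; [apply Rmax_l|]. repeat split; auto.
Qed.

Lemma lfun_zero : lfun 0 (fun _ => K0 c).
Proof.
repeat split; intros; try ring. rewrite Kabs_0. rewrite Rmult_0_l. lra.
Qed.

Lemma lfun_add M M' f g : lfun M f -> lfun M' g -> lfun (M + M') (fun x => Kadd (f x) (g x)).
Proof.
intros (H1&H2&H3) (H4&H5&H6). repeat split.
- intros. rewrite H1, H4 by auto. ring.
- intros. rewrite H2, H5 by auto. ring.
- intros x Hx. eapply Rle_trans; [apply Kabs_add|].
  specialize (H3 x Hx). specialize (H6 x Hx). lra.
Qed.

Lemma lfun_scal M a f : lfun M f -> lfun (Kabs a * M) (fun x => Kmul a (f x)).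
Proof.
intros (H1&H2&H3). repeat split.
- intros. rewrite H1 by auto. ring.
- intros. rewrite H2 by auto. ring.
- intros x Hx. rewrite Kabs_mul, Rmult_assoc. apply Rmult_le_compat_l; auto using Kabs_pos.
Qed.

Lemma lfun_sub M M' f g : lfun M f -> lfun M' g -> lfun (M + M') (fun x => Ksub (f x) (g x)).
Proof.
intros H1 H2.
replace (fun x => Ksub (f x) (g x)) with (fun x => Kadd (f x) (Kmul (Kopp (K1 c)) (g x))).
- apply lfun_add; auto. replace M' with (Kabs (Kopp (K1 c)) * M').
  + now apply lfun_scal.
  + rewrite Kabs_opp, Kabs_1. ring.
- apply functional_extensionality. intros x. ring.
Qed.

Lemma lfun_ksum {A} (l : list A) (M : A -> R) (f : A -> car X -> K c) :
  (forall i, In i l -> lfun (M i) (f i)) -> lfun (rsum l M) (fun x => ksum l (fun i => f i x)).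
Proof.
induction l as [|i l IH]; simpl; intros H; [apply lfun_zero|].
apply lfun_add; auto.
Qed.

Lemma fun_opp M f x : lfun M f -> mem X x -> f (opp X x) = Kopp (f x).
Proof. intros (H1&H2&H3) Hx. rewrite opp_scal, H2 by auto. ring. Qed.

Lemma fun_zero M f : lfun M f -> f (zero X) = K0 c.
Proof. intros (H1&H2&H3). rewrite <- (scal_0 (zero X)), H2 by auto. ring. Qed.

Lemma fun_sub M f x y : lfun M f -> mem X x -> mem X y ->
  f (add X x (opp X y)) = Ksub (f x) (f y).
Proof.
intros H Hx Hy. rewrite (proj1 H) by auto. rewrite (fun_opp M) by auto. reflexivity.
Qed.

Lemma fun_dist M f x y : lfun M f -> mem X x -> mem X y ->
  Kabs (Ksub (f x) (f y)) <= M * dist X x y.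
Proof.
intros H Hx Hy. rewrite <- (fun_sub M) by auto. apply H. auto.
Qed.

Definition vsum {A} (l : list A) (a : A -> K c) (x : A -> car X) : car X :=
  fold_right (fun i s => add X (scal X (a i) (x i)) s) (zero X) l.

Lemma vsum_mem {A} (l : list A) a (x : A -> car X) :
  (forall i, In i l -> mem X (x i)) -> mem X (vsum l a x).
Proof. induction l as [|i l IH]; simpl; intros H; auto. Qed.
Hint Resolve vsum_mem : core.

Lemma vsum_norm {A} (l : list A) a (x : A -> car X) :
  (forall i, In i l -> mem X (x i)) ->
  norm X (vsum l a x) <= rsum l (fun i => Kabs (a i) * norm X (x i)).
Proof.
induction l as [|i l IH]; simpl; intros H; [rewrite norm_zero; lra|].
eapply Rle_trans; [apply norm_add; auto|]. rewrite norm_scal by auto.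
apply Rplus_le_compat_l. auto.
Qed.

Lemma fun_vsum {A} M f (l : list A) a (x : A -> car X) : lfun M f ->
  (forall i, In i l -> mem X (x i)) ->
  f (vsum l a x) = ksum l (fun i => Kmul (a i) (f (x i))).
Proof.
intros Hf. induction l as [|i l IH]; simpl; intros H; [apply (fun_zero M); auto|].
destruct Hf as (H1&H2&H3). rewrite H1, H2, IH by auto. reflexivity.
Qed.

Lemma vsum_app {A} (l l' : list A) a (x : A -> car X) :
  (forall i, In i (l ++ l') -> mem X (x i)) ->
  vsum (l ++ l') a x = add X (vsum l a x) (vsum l' a x).
Proof.
induction l as [|i l IH]; simpl; intros H.
- rewrite add_comm, add_zero; auto.
- assert (forall j, In j l -> mem X (x j)) by (intros; apply H; rewrite in_app_iff; auto).
  assert (forall j, In j l' -> mem X (x j)) by (intros; apply H; rewrite in_app_iff; auto).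
  rewrite IH by auto. apply add_assoc; auto.
Qed.

End Normed.

Arguments lfun {c} X M f.
Arguments vsum {c} X {A} l a x.

Lemma lfun_comp {c} (X Y : NS c) (T : car X -> car Y) MT M f :
  bounded_op X Y T -> (forall x, mem X x -> norm Y (T x) <= MT * norm X x) -> 0 <= M ->
  lfun Y M f -> lfun X (M * MT) (fun x => f (T x)).
Proof.
intros (B1&B2&B3&_) B4 HM (H1&H2&H3). repeat split.
- intros. rewrite B2, H1; auto.
- intros. rewrite B3, H2; auto.
- intros x Hx. eapply Rle_trans; [apply H3; auto|]. rewrite Rmult_assoc.
  apply Rmult_le_compat_l; auto.
Qed.

Lemma bounded_op_bound {c} (X Y : NS c) (T : car X -> car Y) :
  is_Banach X -> bounded_op X Y T ->
  exists M, 0 <= M /\ forall x, mem X x -> norm Y (T x) <= M * norm X x.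
Proof.
intros HX (_&_&_&M&HM). exists (Rmax M 0). split; [apply Rmax_r|]. intros x Hx.
eapply Rle_trans; [now apply HM|]. apply Rmult_le_compat_r; [now apply norm_pos|].
apply Rmax_l.
Qed.

Lemma op_opp {c} (X Y : NS c) (T : car X -> car Y) x :
  is_Banach X -> is_Banach Y -> bounded_op X Y T -> mem X x ->
  T (opp X x) = opp Y (T x).
Proof.
intros HX HY (B1&B2&B3&_) Hx. rewrite (opp_scal HX), (opp_scal HY), B3; auto.
Qed.

Lemma op_dist {c} (X Y : NS c) (T : car X -> car Y) M x y :
  is_Banach X -> is_Banach Y -> bounded_op X Y T ->
  (forall x, mem X x -> norm Y (T x) <= M * norm X x) -> mem X x -> mem X y ->
  dist Y (T x) (T y) <= M * dist X x y.
Proof.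
intros HX HY HT HM Hx Hy. unfold dist. rewrite <- (op_opp X Y T) by auto.
assert (mem X (opp X y)) by now apply mem_opp.
destruct HT as (B1&B2&_). rewrite <- B2 by auto. apply HM. now apply mem_add.
Qed.

(** * A tree-indexed system in an operator with non-separable adjoint *)

Section Core.
Context {c : bool} {X Y : NS c} {T : car X -> car Y}.
Context (HX : is_Banach X) (HY : is_Banach Y) (HT : bounded_op X Y T).
Add Ring KRing : (@Kring_theory c).
Notation E := (car Y -> K c).
Implicit Types (f g h phi psi : car Y -> K c) (x z : car X) (y : car Y).
Implicit Types (A B : (car Y -> K c) -> Prop).

(** * Small sets of functionals *)

Definition small (delta : R) A : Prop := exists f : nat -> E, (forall n, bounded_fun Y (f n)) /\
  forall phi, A phi -> exists n, forall x, mem X x -> norm X x <= 1 ->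
    Kabs (Ksub (phi (T x)) (f n (T x))) <= delta.

Lemma small_subset delta A B : (forall phi, A phi -> B phi) -> small delta B -> small delta A.
Proof. intros H (f & H1 & H2). exists f. split; auto. Qed.

(** With [small_subset] this says that, for a fixed [delta], the small sets form a sigma-ideal; the
    condensation argument rests on that. *)
Lemma small_union delta (A : nat -> E -> Prop) :
  (forall n, small delta (A n)) -> small delta (fun phi => exists n, A n phi).
Proof.
intros H. destruct (choice_fun _ H) as [F HF].
exists (fun n => let (i, j) := Cantor.of_nat n in F i j). split.
- intros n. destruct (Cantor.of_nat n) as [i j]. apply HF.
- intros phi [i Hi]. destruct (proj2 (HF i) phi Hi) as [j Hj].
  exists (Cantor.to_nat (i, j)). now rewrite Cantor.cancel_of_to.
Qed.

Lemma small_list delta A (l : list E) : (forall f, In f l -> bounded_fun Y f) ->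
  (forall phi, A phi -> exists f, In f l /\ forall x, mem X x -> norm X x <= 1 ->
    Kabs (Ksub (phi (T x)) (f (T x))) <= delta) -> small delta A.
Proof.
intros Hl H. exists (fun n => nth n l (fun _ => K0 c)). split.
- intros n. destruct (Nat.lt_ge_cases n (length l)) as [Hn|Hn].
  + apply Hl. now apply nth_In.
  + rewrite nth_overflow by exact Hn. apply (lfun_bounded_fun _ _ lfun_zero).
- intros phi Hphi. destruct (H phi Hphi) as (f & Hf & H').
  destruct (In_nth _ _ (fun _ => K0 c) Hf) as (n & _ & <-). now exists n.
Qed.

Lemma small_list_union delta {I} (l : list I) (A : I -> E -> Prop) :
  (forall i, In i l -> small delta (A i)) ->
  small delta (fun phi => exists i, In i l /\ A i phi).
Proof.
intros H. induction l as [|i l IH].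
- apply small_list with []; [intros f []|]. intros phi (i & [] & _).
- assert (H1 : small delta (A i)) by (apply H; now left).
  assert (H2 : small delta (fun phi => exists i, In i l /\ A i phi)).
  { apply IH. intros j Hj. apply H. now right. }
  apply small_subset with (fun phi => exists n : nat,
    (match n with O => A i | S _ => fun phi => exists i, In i l /\ A i phi end) phi).
  + intros phi (j & [<-|Hj] & Hphi); [now exists 0%nat|]. exists 1%nat. eauto.
  + apply small_union. intros [|n]; assumption.
Qed.

(** If every ball of integer radius were small at every scale 1/(k+1), the countably many centres
    together would be dense in the range of the adjoint. *)
Lemma not_small_of_not_sep : ~ adj_range_sep X Y T (mem X) ->
  exists M delta, 0 <= M /\ 0 < delta /\ ~ small delta (lfun Y M).
Proof.
intros H. apply NNPP. intros Hn. apply H.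
assert (Hpos : forall k, 0 < / (INR k + 1)).
{ intros k. apply Rinv_0_lt_compat. assert (P := pos_INR k). lra. }
assert (Hs : forall p : nat * nat, small (/ (INR (snd p) + 1)) (lfun Y (INR (fst p)))).
{ intros [m k]. apply NNPP. intros Hs. apply Hn. exists (INR m), (/ (INR k + 1)).
  repeat split; auto using pos_INR. }
destruct (choice_fun _ Hs) as [F HF].
exists (fun n => let (p, j) := Cantor.of_nat n in F (Cantor.of_nat p) j). split.
- intros n. destruct (Cantor.of_nat n) as [p j]. apply HF.
- intros psi Hpsi eps He.
  destruct (bounded_fun_lfun HY psi Hpsi) as (M & HM & HMp).
  destruct (INR_unbounded M) as [m Hm].
  destruct (inv_INR_small eps He) as [k Hk]. specialize (Hk k (le_n k)).
  destruct (proj2 (HF (m, k)) psi) as [j Hj].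
  { apply (lfun_mono HY) with M; [simpl; lra|exact HMp]. }
  exists (Cantor.to_nat (Cantor.to_nat (m, k), j)).
  rewrite !Cantor.cancel_of_to. simpl in Hj.
  eapply Rle_lt_trans; [|exact Hk]. apply Rsup_le; [exists 0; now left|].
  intros r [->|(z & Hz & Hz1 & ->)]; [left; apply Hpos|].
  rewrite Kabs_sub_sym. now apply Hj.
Qed.

Lemma uniform_bound_below (n : nat) (Q : nat -> R -> Prop) :
  (forall j r r', r <= r' -> Q j r -> Q j r') -> (forall j, (j < n)%nat -> exists r, Q j r) ->
  exists r, 0 <= r /\ forall j, (j < n)%nat -> Q j r.
Proof.
intros Hm. induction n as [|n IH]; intros H.
- exists 0. split; [lra|]. intros; lia.
- destruct IH as (r & Hr & Hr'); [auto|]. destruct (H n) as [s Hs]; [lia|].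
  exists (Rmax r s). split; [eapply Rle_trans; [exact Hr|apply Rmax_l]|].
  intros j Hj. destruct (Nat.eq_dec j n) as [->|].
  + apply Hm with s; [apply Rmax_r|exact Hs].
  + apply Hm with r; [apply Rmax_l|apply Hr'; lia].
Qed.

(* If no functional of [A] were large at a unit vector killed by the [g j], then, up to a small
   error, finitely many evaluations would determine the elements of [A] on the whole unit ball. *)
Lemma exists_large_value (M delta : R) (n : nat) (g : nat -> E) (xs : nat -> car X) A :
  0 <= M -> 0 < delta -> (forall psi, A psi -> lfun Y M psi) -> ~ small delta A ->
  (forall j, (j < n)%nat -> bounded_fun Y (g j)) ->
  (forall j, (j < n)%nat -> mem X (xs j)) ->
  (forall i j, (i < n)%nat -> (j < n)%nat ->
     g i (T (xs j)) = if Nat.eq_dec j i then K1 c else K0 c) ->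
  exists psi x, A psi /\ mem X x /\ norm X x <= 1 /\
    (forall j, (j < n)%nat -> g j (T x) = K0 c) /\ delta / 9 <= Kabs (psi (T x)).
Proof.
intros HM Hd HA Hns Hg Hxs Hbi. apply NNPP. intros Hno. apply Hns.
destruct (bounded_op_bound X Y T HX HT) as (MT & HMT & HMT').
assert (HTm : forall x, mem X x -> mem Y (T x)) by apply HT.
(* Nine parts are spent at the end: six on [v], where two functionals are each bounded by [3 * e],
   two on [w], and one on [z]. *)
set (e := delta / 9). assert (He : 0 < e) by (unfold e; lra).
destruct (uniform_bound_below n (fun j G => lfun Y G (g j))) as (G & HG & HGj).
{ intros j r r' Hr. now apply (lfun_mono HY). }
{ intros j Hj. destruct (bounded_fun_lfun HY _ (Hg j Hj)) as (r & _ & Hr). now exists r. }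
set (Xs := rsum (seq 0 n) (fun j => norm X (xs j))).
assert (HXs : 0 <= Xs).
{ apply rsum_nonneg. intros j Hj. apply in_seq in Hj. apply (norm_pos HX), Hxs. lia. }
assert (HMM : 0 <= M * MT) by now apply Rmult_le_pos.
(* Small enough for two purposes: the vector [w] below has norm at most 1, and functionals of norm
   at most [M] composed with [T] have value at most [e] on it. *)
set (eta := Rmin 1 e / ((1 + M * MT) * (1 + Xs))).
assert (Hden : 0 < (1 + M * MT) * (1 + Xs)) by (apply Rmult_lt_0_compat; lra).
assert (Hmin : 0 < Rmin 1 e) by (apply Rmin_glb_lt; lra).
assert (Heta : 0 < eta) by now apply Rdiv_lt_0_compat.
assert (Heta' : eta * ((1 + M * MT) * (1 + Xs)) = Rmin 1 e) by (unfold eta; field; lra).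
assert (Hmin1 := Rmin_l 1 e). assert (Hmin2 := Rmin_r 1 e).
assert (Heta1 : eta * Xs <= 1).
{ assert (0 <= eta * (M * MT * (1 + Xs))).
  { apply Rmult_le_pos; [lra|]. apply Rmult_le_pos; lra. }
  assert (eta * ((1 + M * MT) * (1 + Xs)) = eta * Xs + eta + eta * (M * MT * (1 + Xs))) by ring.
  lra. }
assert (Heta2 : eta * (M * MT * Xs) <= e).
{ assert (0 <= eta * (1 + Xs)) by (apply Rmult_le_pos; lra).
  assert (0 <= eta * (M * MT)) by (apply Rmult_le_pos; lra).
  assert (eta * ((1 + M * MT) * (1 + Xs)) =
    eta * (M * MT * Xs) + eta * (1 + Xs) + eta * (M * MT)) by ring.
  lra. }
(* [zs] is a finite part of the unit ball that represents every unit vector as far as the values of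
   the [g j] are concerned. *)
destruct (totally_bounded (map (fun j x => g j (T x)) (seq 0 n)) (G * MT) eta Heta
  (fun x => mem X x /\ norm X x <= 1)) as (zs & Hzs & Hzs').
{ intros f x Hf [Hx Hx1]. apply in_map_iff in Hf. destruct Hf as (j & <- & Hj).
  apply in_seq in Hj.
  assert (L := lfun_comp X Y T MT G (g j) HT HMT' HG (HGj j ltac:(lia))).
  eapply Rle_trans; [apply L, Hx|]. rewrite <- (Rmult_1_r (G * MT)) at 2.
  apply Rmult_le_compat_l; [now apply Rmult_le_pos|exact Hx1]. }
(* [l] represents [A] for evaluation at the [zs]; its members are the finitely many centres that
   would make [A] small. *)
destruct (totally_bounded (map (fun z psi => psi (T z)) zs) (M * MT) e He A)
  as (l & Hl & Hl').
{ intros f psi Hf Hpsi. apply in_map_iff in Hf. destruct Hf as (z & <- & Hz).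
  destruct (Hzs z Hz) as [Hz1 Hz2].
  assert (L := lfun_comp X Y T MT M psi HT HMT' HM (HA psi Hpsi)).
  eapply Rle_trans; [apply L, Hz1|]. rewrite <- (Rmult_1_r (M * MT)) at 2.
  apply Rmult_le_compat_l; [exact HMM|exact Hz2]. }
apply small_list with l.
{ intros f Hf. apply (lfun_bounded_fun M). auto. }
intros psi Hpsi. destruct (Hl' psi Hpsi) as (psi' & Hpsi' & Hclose).
exists psi'. split; [exact Hpsi'|]. intros x Hx Hx1.
destruct (Hzs' x (conj Hx Hx1)) as (z & Hz & Hxz).
destruct (Hzs z Hz) as [Hzm Hz1].
set (u := add X x (opp X z)).
assert (Hu : mem X u) by (apply (mem_add HX); [|apply (mem_opp HX)]; assumption).
set (a := fun j => g j (T u)).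
assert (Ha : forall j, (j < n)%nat -> Kabs (a j) <= eta).
{ intros j Hj. unfold a, u.
  assert (L := lfun_comp X Y T MT G (g j) HT HMT' HG (HGj j Hj)).
  rewrite (fun_sub HX _ _ _ _ L) by assumption.
  apply (Hxz (fun x => g j (T x))). apply in_map_iff. exists j. split; [reflexivity|].
  apply in_seq. lia. }
(* By biorthogonality, subtracting [w] from [x - z] cancels all values of the [g j], at the price of
   a vector of small norm. *)
set (w := vsum X (seq 0 n) a xs).
assert (Hxs' : forall j, In j (seq 0 n) -> mem X (xs j)).
{ intros j Hj. apply in_seq in Hj. apply Hxs. lia. }
assert (Hw : mem X w) by now apply (vsum_mem HX).
set (v := add X u (opp X w)).
assert (Hv : mem X v) by (apply (mem_add HX); [|apply (mem_opp HX)]; assumption).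
assert (Hnv : norm X v <= 3).
{ unfold v, u. eapply Rle_trans; [apply (norm_add HX); [|apply (mem_opp HX)]; assumption|].
  rewrite (norm_opp HX) by exact Hw.
  assert (norm X u <= 2).
  { unfold u. eapply Rle_trans; [apply (norm_add HX); [|apply (mem_opp HX)]; assumption|].
    rewrite (norm_opp HX) by exact Hzm. lra. }
  assert (norm X w <= eta * Xs).
  { eapply Rle_trans; [now apply (vsum_norm HX)|]. unfold Xs. rewrite <- rsum_scal.
    apply rsum_le. intros j Hj. apply Rmult_le_compat_r; [now apply (norm_pos HX), Hxs'|].
    apply in_seq in Hj. apply Ha. lia. }
  unfold u in *. lra. }
assert (Hgv : forall i, (i < n)%nat -> g i (T v) = K0 c).
{ intros i Hi. assert (L := lfun_comp X Y T MT G (g i) HT HMT' HG (HGj i Hi)).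
  unfold v. rewrite (fun_sub HX _ _ _ _ L) by assumption.
  unfold w. rewrite (fun_vsum HX _ _ _ _ _ L) by assumption.
  rewrite (ksum_ext _ _ (fun j => if Nat.eq_dec j i then a i else K0 c)).
  - rewrite (ksum_delta n i) by (try exact Hi; intros j Hj; now destruct (Nat.eq_dec j i)).
    destruct (Nat.eq_dec i i) as [_|]; [|congruence]. unfold a. ring.
  - intros j Hj. apply in_seq in Hj. rewrite Hbi by lia.
    destruct (Nat.eq_dec j i) as [->|]; ring. }
assert (Hsm : forall phi, A phi -> Kabs (phi (T v)) <= 3 * e).
(* The factor 1/3 brings [v], of norm at most 2 + 1, back to the unit ball, where the assumption
   that no large value exists applies. *)
{ intros phi Hphi. set (t := Kof (1/3) 0 : K c).
  assert (Ht : Kabs t = 1/3) by (unfold t; rewrite Kabs_of_real, Rabs_pos_eq; lra).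
  assert (Hlt : Kabs (phi (T (scal X t v))) < e).
  { apply Rnot_le_lt. intros Hle. apply Hno. exists phi, (scal X t v).
    split; [exact Hphi|]. split; [now apply (mem_scal HX)|]. split.
    - rewrite (norm_scal HX), Ht by exact Hv. lra.
    - split; [|exact Hle]. intros j Hj.
      assert (L := lfun_comp X Y T MT G (g j) HT HMT' HG (HGj j Hj)).
      rewrite (proj1 (proj2 L)) by exact Hv. rewrite (Hgv j Hj). ring. }
  assert (L := lfun_comp X Y T MT M phi HT HMT' HM (HA phi Hphi)).
  rewrite (proj1 (proj2 L)), Kabs_mul, Ht in Hlt by exact Hv. lra. }
set (D := fun x => Ksub (psi (T x)) (psi' (T x))).
assert (LD : lfun X (M * MT + M * MT) D).
{ apply lfun_sub; apply (lfun_comp X Y T MT M _ HT HMT' HM); auto. }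
assert (E1 : D x = Kadd (Kadd (D v) (D w)) (D z)).
{ unfold v. rewrite (fun_sub HX _ D u w LD) by assumption.
  unfold u. rewrite (fun_sub HX _ D x z LD) by assumption. ring. }
change (Kabs (D x) <= delta). rewrite E1.
eapply Rle_trans; [apply Kabs_add|].
assert (Kabs (D z) <= e).
{ apply (Hclose (fun psi => psi (T z))). apply in_map_iff. now exists z. }
assert (Kabs (D v) <= 6 * e).
{ unfold D. eapply Rle_trans; [apply Kabs_sub_le|].
  assert (H1 := Hsm psi Hpsi). assert (H2 := Hsm psi' (Hl _ Hpsi')). lra. }
assert (Kabs (D w) <= 2 * e).
{ unfold w. rewrite (fun_vsum HX _ D _ _ _ LD) by assumption.
  eapply Rle_trans; [apply Kabs_ksum|].
  apply Rle_trans with (eta * (M * MT + M * MT) * Xs).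
  - unfold Xs. rewrite <- rsum_scal. apply rsum_le. intros j Hj.
    rewrite Kabs_mul, Rmult_assoc.
    apply Rmult_le_compat; auto using Kabs_pos.
    + apply in_seq in Hj. apply Ha. lia.
    + apply LD. auto.
  - lra. }
assert (H3 := Kabs_add (D v) (D w)). unfold e in *. lra.
Qed.

Lemma small_or delta A B : small delta A -> small delta B ->
  small delta (fun phi => A phi \/ B phi).
Proof.
intros H1 H2.
apply small_subset with (fun phi => exists i, In i [true; false] /\ (if i then A else B) phi).
- intros phi [H|H]; [exists true|exists false]; simpl; auto.
- apply small_list_union. intros [|] _; assumption.
Qed.

(** * Condensation points of a ball of the dual *)

Context {d : nat -> car Y} (Hd : forall i, mem Y (d i)).

(** One index governs both the number of test points and the tolerance, so the neighbourhoods
    decrease with [k] and there are only countably many sizes. *)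
Definition nbhd (k : nat) phi psi : Prop :=
  forall i, (i < k)%nat -> Kabs (Ksub (phi (d i)) (psi (d i))) <= / (INR k + 1).

Definition approximable (y : car Y) : Prop :=
  mem Y y /\ forall eps, 0 < eps -> exists i, dist Y (d i) y < eps.

Lemma nbhd_mono k k' phi psi : (k <= k')%nat -> nbhd k' phi psi -> nbhd k phi psi.
Proof.
intros Hk H i Hi. eapply Rle_trans; [apply H; lia|].
apply le_INR in Hk. assert (P := pos_INR k). apply Rinv_le_contravar; lra.
Qed.

(** Functionals of norm at most [M] move by at most [eta / 4] when [y] is replaced by a nearby
    [d i]. The index must exceed [i] for [d i] to be among the test points. *)
Lemma nbhd_eval M (y : car Y) eta : 0 <= M -> approximable y -> 0 < eta ->
  exists k, forall phi psi, lfun Y M phi -> lfun Y M psi -> nbhd k phi psi ->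
    Kabs (Ksub (phi y) (psi y)) <= eta.
Proof.
intros HM [Hy Happ] He.
assert (Hq : 0 < eta / (4 * (M + 1))) by (apply Rdiv_lt_0_compat; lra).
destruct (Happ _ Hq) as [i Hi].
destruct (inv_INR_small (eta / 2) ltac:(lra)) as [N HN].
exists (N + S i)%nat. intros phi psi Hphi Hpsi Hn.
specialize (Hn i ltac:(lia)). specialize (HN (N + S i)%nat ltac:(lia)).
assert (H1 := fun_dist HY _ phi (d i) y Hphi (Hd i) Hy).
assert (H2 := fun_dist HY _ psi (d i) y Hpsi (Hd i) Hy).
assert (H3 := Kabs_sub_tri (phi (d i)) (phi y) (psi y)).
assert (H4 := Kabs_sub_tri (psi (d i)) (phi (d i)) (psi y)).
rewrite (Kabs_sub_sym (phi y) (phi (d i))) in H3.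
assert (Hdp := dist_pos HY _ _ (Hd i) Hy).
assert (H5 : (M + 1) * dist Y (d i) y <= eta / 4).
{ apply Rle_trans with ((M + 1) * (eta / (4 * (M + 1)))).
  - apply Rmult_le_compat_l; lra.
  - right. field. lra. }
assert (H6 : (M + 1) * dist Y (d i) y = M * dist Y (d i) y + dist Y (d i) y) by ring.
lra.
Qed.

Lemma nbhd_eval_finite M (n : nat) (ys : nat -> car Y) eta : 0 <= M -> 0 < eta ->
  (forall j, (j < n)%nat -> approximable (ys j)) ->
  exists k, forall phi psi, lfun Y M phi -> lfun Y M psi -> nbhd k phi psi ->
    forall j, (j < n)%nat -> Kabs (Ksub (phi (ys j)) (psi (ys j))) <= eta.
Proof.
intros HM He. induction n as [|n IH]; intros H.
- exists 0%nat. intros; lia.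
- destruct IH as [k1 H1]; [auto|].
  destruct (nbhd_eval M (ys n) eta HM (H n ltac:(lia)) He) as [k2 H2].
  exists (k1 + k2)%nat. intros phi psi Hphi Hpsi Hn j Hj.
  destruct (Nat.eq_dec j n) as [->|].
  + apply H2; auto. apply nbhd_mono with (k1 + k2)%nat; [lia|exact Hn].
  + apply H1; auto; [|lia]. apply nbhd_mono with (k1 + k2)%nat; [lia|exact Hn].
Qed.

Definition condensation (M delta : R) phi : Prop :=
  lfun Y M phi /\ forall k, ~ small delta (fun psi => lfun Y M psi /\ nbhd k phi psi).

(** For each [k], consider the functionals whose [k]-th neighbourhood is small. Only finitely many
    evaluations are involved and they are bounded on the ball, so finitely many of these small
    neighbourhoods, centred at such functionals, cover the set. The union over [k] is then small. *)
Lemma not_condensation_small M delta : 0 <= M ->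
  small delta (fun phi => lfun Y M phi /\ ~ condensation M delta phi).
Proof.
intros HM.
set (A := fun k phi => lfun Y M phi /\ small delta (fun psi => lfun Y M psi /\ nbhd k phi psi)).
apply small_subset with (fun phi => exists k, A k phi).
{ intros phi [Hphi Hn]. apply NNPP. intros Hno. apply Hn. split; [exact Hphi|].
  intros k Hk. apply Hno. exists k. split; assumption. }
apply small_union. intros k.
assert (Hk : 0 < / (INR k + 1)).
{ apply Rinv_0_lt_compat. assert (P := pos_INR k). lra. }
destruct (totally_bounded (map (fun i phi => phi (d i)) (seq 0 k))
  (rsum (seq 0 k) (fun i => M * norm Y (d i))) _ Hk (A k)) as (l & Hl & Hl').
{ intros f phi Hf [Hphi _]. apply in_map_iff in Hf. destruct Hf as (i & <- & Hi).
  eapply Rle_trans; [now apply Hphi|].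
  apply (rsum_ge_mem _ (fun i => M * norm Y (d i))); [|exact Hi].
  intros j _. apply Rmult_le_pos; [exact HM|now apply (norm_pos HY)]. }
apply small_subset with (fun phi => exists psi, In psi l /\ (lfun Y M phi /\ nbhd k psi phi)).
- intros phi Hphi. destruct (Hl' phi Hphi) as (psi & Hpsi & H). exists psi.
  split; [exact Hpsi|]. split; [apply Hphi|]. intros i Hi. rewrite Kabs_sub_sym.
  apply (H (fun phi => phi (d i))). apply in_map_iff. exists i. split; [reflexivity|].
  apply in_seq. lia.
- apply small_list_union. intros psi Hpsi. now apply Hl.
Qed.

Lemma condensation_not_small M delta : 0 <= M -> ~ small delta (lfun Y M) ->
  ~ small delta (condensation M delta).
Proof.
intros HM Hns Hs. apply Hns.
apply small_subset with (2 := small_or _ _ _ Hs (not_condensation_small M delta HM)).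
intros phi Hphi. destruct (classic (condensation M delta phi)); auto.
Qed.

Lemma condensation_nbhd M delta k phi : 0 <= M -> condensation M delta phi ->
  ~ small delta (fun psi => condensation M delta psi /\ nbhd k phi psi).
Proof.
intros HM [_ H] Hs. apply (H k).
apply small_subset with (2 := small_or _ _ _ Hs (not_condensation_small M delta HM)).
intros psi [Hpsi Hn]. destruct (classic (condensation M delta psi)); auto.
Qed.

(** * Inductive choice of the functionals and vectors *)

Lemma half_pow_le_1 n : (1/2)^n <= 1.
Proof.
apply Rle_trans with (1^n); [apply pow_incr; split; lra|]. rewrite pow1. lra.
Qed.

(** This balances the norm budget: the parent has used at most 2 - (1/2)^p, and a further (1/2)^n /
    2 keeps the total below 2 - (1/2)^n. It also serves to telescope along paths. *)
Lemma half_pow_lt p n : (p < n)%nat -> 2 * (1/2)^n <= (1/2)^p.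
Proof.
intros H. replace n with (S p + (n - S p))%nat by lia. rewrite pow_add.
assert (0 < (1/2)^p) by (apply pow_lt; lra).
assert (H1 := half_pow_le_1 (n - S p)).
simpl. nra.
Qed.

Context {par : nat -> nat} (Hpar : forall n, n <> 0%nat -> (par n < n)%nat).

Record stage := mkStage { stF : E; stH : E; stX : car X }.

(* [stF] is a condensation point [stF - stH] moved by [stH], a combination of the earlier
   differences [stF n - stF (par n)]; the move makes the evaluations at the earlier vectors
   agree exactly with those of the parent. *)
Definition good_stage (M delta : R) (n : nat) (s : nat -> stage) (a : stage) : Prop :=
  lfun Y (2 - (1/2)^n) (stH a) /\
  condensation M delta (fun y => Ksub (stF a y) (stH a y)) /\
  mem X (stX a) /\ norm X (stX a) <= 9 / delta /\
  stF a (T (stX a)) = K1 c /\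
  (forall m, (m < n)%nat -> stF (s m) (T (stX a)) = K0 c) /\
  (forall x, mem X x -> (forall m, (m < n)%nat -> stF (s m) (T x) = K0 c) ->
     stH a (T x) = K0 c) /\
  (n <> 0%nat ->
     (forall m, (m < n)%nat -> stF a (T (stX (s m))) = stF (s (par n)) (T (stX (s m)))) /\
     (forall i, (i < n)%nat -> Kabs (Ksub (stF a (d i)) (stF (s (par n)) (d i))) <= (1/2)^n)).

Lemma good_stage_ext M delta n s s' a : (forall m, (m < n)%nat -> s m = s' m) ->
  good_stage M delta n s a -> good_stage M delta n s' a.
Proof.
intros Hs (H1&H2&H3&H4&H5&H6&H7&H8). do 5 (split; [assumption|]). split; [|split].
- intros m Hm. rewrite <- Hs by exact Hm. auto.
- intros x Hx Hk. apply H7; [exact Hx|]. intros m Hm. rewrite Hs by exact Hm. auto.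
- intros Hn. destruct (H8 Hn) as [H9 H10]. assert (Hp := Hpar n Hn). split.
  + intros m Hm. rewrite <- !Hs by assumption. auto.
  + intros i Hi. rewrite <- !Hs by assumption. auto.
Qed.

Lemma good_stage_lfun M delta n s a : 0 <= M -> good_stage M delta n s a -> lfun Y (M + 2) (stF a).
Proof.
intros HM (H1&(H2&_)&_).
replace (stF a) with (fun y => Kadd (Ksub (stF a y) (stH a y)) (stH a y)).
- apply (lfun_mono HY) with (M + (2 - (1/2)^n)); [|now apply lfun_add].
  assert (0 < (1/2)^n) by (apply pow_lt; lra). lra.
- apply functional_extensionality. intros y. ring.
Qed.

(** Dividing by a value of modulus at least [delta / 9] is the origin of the bound [9 / delta] on
    the vectors. *)
Lemma exists_normalized M delta n (s : nat -> stage) phi x : 0 < delta -> lfun Y M phi -> 0 <= M ->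
  (forall m, (m < n)%nat -> bounded_fun Y (stF (s m))) ->
  mem X x -> norm X x <= 1 -> delta / 9 <= Kabs (phi (T x)) ->
  (forall m, (m < n)%nat -> stF (s m) (T x) = K0 c) ->
  exists x', mem X x' /\ norm X x' <= 9 / delta /\ phi (T x') = K1 c /\
    (forall m, (m < n)%nat -> stF (s m) (T x') = K0 c).
Proof.
intros Hd' Hphi HM Hs Hx Hx1 Hbig Hk.
destruct (K_inverse (phi (T x))) as (t & Ht & Htn).
{ intros H. rewrite H, Kabs_0 in Hbig. lra. }
assert (B3 : T (scal X t x) = scal Y t (T x)) by (apply HT; exact Hx).
assert (HTx : mem Y (T x)) by (apply HT; exact Hx).
exists (scal X t x). split; [now apply (mem_scal HX)|]. split; [|split].
- rewrite (norm_scal HX), Htn by exact Hx.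
  replace (9 / delta) with (/ (delta / 9) * 1) by (field; lra).
  apply Rmult_le_compat; [|now apply (norm_pos HX)| |exact Hx1].
  + left. apply Rinv_0_lt_compat. lra.
  + apply Rinv_le_contravar; lra.
- rewrite B3, (proj1 (proj2 Hphi)) by exact HTx. exact Ht.
- intros m Hm. rewrite B3, (proj1 (proj2 (Hs m Hm))), Hk by assumption. ring.
Qed.

Lemma good_stage_exists M delta n s : 0 <= M -> 0 < delta -> ~ small delta (lfun Y M) ->
  (forall x, mem X x -> approximable (T x)) ->
  (forall m, (m < n)%nat -> good_stage M delta m s (s m)) ->
  exists a, good_stage M delta n s a.
Proof.
intros HM Hdel Hns Happ IH.
destruct (Nat.eq_dec n 0) as [->|Hn].
(* At the root nothing has to be killed or matched: any condensation point with a large value will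
   do, with zero correction. *)
{ destruct (exists_large_value M delta 0 (fun _ _ => K0 c) (fun _ => zero X)
    (condensation M delta) HM Hdel) as (psi & x & Hpsi & Hx & Hx1 & _ & Hbig);
    try (intros; lia).
  { intros psi Hpsi. apply Hpsi. }
  { now apply condensation_not_small. }
  destruct (exists_normalized M delta 0 s psi x Hdel (proj1 Hpsi) HM) as (x' & A1 & A2 & A3 & A4);
    try assumption; try (intros; lia).
  exists (mkStage psi (fun _ => K0 c) x'). unfold good_stage; simpl.
  split; [apply (lfun_mono HY) with 0; [lra|apply lfun_zero]|]. split.
  { replace (fun y => Ksub (psi y) (K0 c)) with psi; [exact Hpsi|].
    apply functional_extensionality. intros y. ring. }
  repeat split; auto; try (intros; lia). }
set (p := par n). assert (Hp : (p < n)%nat) by now apply Hpar.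
set (F := fun m => stF (s m)). set (xs := fun m => stX (s m)).
set (q := (1/2)^n). assert (Hq : 0 < q) by (apply pow_lt; lra).
assert (HF : forall m, (m < n)%nat -> lfun Y (M + 2) (F m)).
{ intros m Hm. now apply (good_stage_lfun M delta m s), IH. }
(* In row [j] the earlier functional agrees with its parent before column [j], and both vanish after
   it, so the difference sees only [xs j]. The root has no parent, hence [F O] itself stands in its
   place. *)
set (g := fun j => if Nat.eq_dec j 0 then F O else fun y => Ksub (F j y) (F (par j) y)).
set (G := (M + 2) + (M + 2)).
assert (Hg : forall j, (j < n)%nat -> lfun Y G (g j)).
{ intros j Hj. unfold g, G. destruct (Nat.eq_dec j 0) as [->|Hj0].
  - apply (lfun_mono HY) with (M + 2); [lra|auto].
  - assert (Hj1 := Hpar j Hj0). apply lfun_sub; apply HF; lia. }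
assert (Hxs : forall j, (j < n)%nat -> mem X (xs j)) by (intros j Hj; now apply IH).
assert (Hup : forall i j, (i < j)%nat -> (j < n)%nat -> F i (T (xs j)) = K0 c).
{ intros i j Hij Hj. destruct (IH j Hj) as (_&_&_&_&_&H6&_). now apply H6. }
assert (Hbi : forall i j, (i < n)%nat -> (j < n)%nat ->
   g i (T (xs j)) = if Nat.eq_dec j i then K1 c else K0 c).
{ intros i j Hi Hj. unfold g.
  destruct (IH i Hi) as (_&_&_&_&Hone&_&_&Hanc).
  destruct (Nat.eq_dec j i) as [->|Hji].
  - destruct (Nat.eq_dec i 0) as [->|Hi0]; [exact Hone|].
    assert (Hi1 := Hpar i Hi0). rewrite (Hup (par i) i) by lia.
    unfold F, xs. rewrite Hone. ring.
  - destruct (Nat.eq_dec i 0) as [->|Hi0]; [apply Hup; lia|].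
    assert (Hi1 := Hpar i Hi0).
    destruct (Nat.lt_ge_cases j i) as [Hlt|Hge].
    + destruct (Hanc Hi0) as [Hanc1 _]. unfold F, xs. rewrite (Hanc1 j Hlt). ring.
    + rewrite (Hup i j), (Hup (par i) j) by lia. ring. }
(* The [g j] and the [F j] have the same common kernel: [F j] is recovered by adding up differences
   along the ancestors of [j]. *)
assert (Hkill : forall x, (forall j, (j < n)%nat -> g j (T x) = K0 c) ->
   forall j, (j < n)%nat -> F j (T x) = K0 c).
{ intros x H j. induction j as [j IHj] using lt_wf_ind. intros Hj.
  specialize (H j Hj). unfold g in H. destruct (Nat.eq_dec j 0) as [->|Hj0]; [exact H|].
  assert (Hj1 := Hpar j Hj0). rewrite (IHj (par j)) in H by lia. rewrite <- H. ring. }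
assert (Hkill' : forall x, (forall j, (j < n)%nat -> F j (T x) = K0 c) ->
   forall j, (j < n)%nat -> g j (T x) = K0 c).
{ intros x H j Hj. unfold g. destruct (Nat.eq_dec j 0) as [->|Hj0]; [now apply H|].
  assert (Hj1 := Hpar j Hj0). rewrite !H by lia. ring. }
destruct (IH p Hp) as (HHp & Hcond & _ & _ & _ & _ & HHk & _).
set (hp := stH (s p)) in *. set (psip := fun y => Ksub (stF (s p) y) (hp y)) in *.
set (Dn := rsum (seq 0 n) (fun i => norm Y (d i))).
assert (HDn : 0 <= Dn).
{ apply rsum_nonneg. intros i _. now apply (norm_pos HY). }
assert (HG : 0 <= G) by (unfold G; lra).
assert (HnG : 0 <= INR n * G) by (apply Rmult_le_pos; [apply pos_INR|exact HG]).
assert (Hden : 0 < 1 + INR n * G * (1 + Dn)).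
{ assert (0 <= INR n * G * (1 + Dn)) by (apply Rmult_le_pos; lra). lra. }
(* [tau] will bound the coefficients of the new correction. The factor [1 + Dn] makes both its norm
   and its values at the [d i] with [i < n] at most [q / 2]. *)
set (tau := (q / 2) / (1 + INR n * G * (1 + Dn))).
assert (Htau : 0 < tau) by (apply Rdiv_lt_0_compat; lra).
assert (Htau' : tau * (INR n * G) * (1 + Dn) <= q / 2).
{ assert (tau * (1 + INR n * G * (1 + Dn)) = q / 2) by (unfold tau; field; lra).
  assert (tau * (1 + INR n * G * (1 + Dn)) = tau + tau * (INR n * G) * (1 + Dn)) by ring.
  lra. }
assert (HtG : 0 <= tau * (INR n * G)) by (apply Rmult_le_pos; lra).
destruct (nbhd_eval_finite M n (fun j => T (xs j)) tau HM Htau) as [k1 Hk1].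
{ intros j Hj. apply Happ. now apply Hxs. }
destruct (nbhd_eval_finite M n d (q / 2) HM ltac:(lra)) as [k2 Hk2].
{ intros j Hj. split; [apply Hd|]. intros e He. exists j.
  unfold dist. rewrite (add_opp HY), (norm_zero HY) by apply Hd. exact He. }
(* The centre is [psip], the parent's functional with its correction removed. The index [k1 + k2]
   secures both the small coefficients and the closeness at the [d i]. *)
destruct (exists_large_value M delta n g xs
  (fun psi => condensation M delta psi /\ nbhd (k1 + k2) psip psi) HM Hdel)
  as (psi & x & [Hpsi Hnb] & Hx & Hx1 & Hgx & Hbig); try assumption.
{ intros psi [Hpsi _]. apply Hpsi. }
{ now apply condensation_nbhd. }
{ intros j Hj. apply (lfun_bounded_fun G). auto. }
assert (Hn1 := Hk1 psip psi (proj1 Hcond) (proj1 Hpsi)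
  (nbhd_mono k1 (k1 + k2) _ _ ltac:(lia) Hnb)).
assert (Hn2 := Hk2 psip psi (proj1 Hcond) (proj1 Hpsi)
  (nbhd_mono k2 (k1 + k2) _ _ ltac:(lia) Hnb)).
(* The defect of [psi] at the earlier vectors; by biorthogonality [k] takes exactly these values
   there. *)
set (cf := fun j => Ksub (psip (T (xs j))) (psi (T (xs j)))).
set (k := fun y => ksum (seq 0 n) (fun j => Kmul (cf j) (g j y))).
set (h := fun y => Kadd (hp y) (k y)).
assert (Hk : lfun Y (tau * (INR n * G)) k).
{ apply (lfun_mono HY) with (rsum (seq 0 n) (fun j => Kabs (cf j) * G)).
  - replace (tau * (INR n * G)) with (rsum (seq 0 n) (fun j => tau * G)).
    + apply rsum_le. intros j Hj. apply in_seq in Hj. apply Rmult_le_compat_r; [exact HG|].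
      apply Hn1. lia.
    + rewrite rsum_const, length_seq. ring.
  - apply (lfun_ksum (seq 0 n) (fun j => Kabs (cf j) * G) (fun j y => Kmul (cf j) (g j y))).
    intros j Hj. apply in_seq in Hj. apply lfun_scal. apply Hg. lia. }
assert (HkG : tau * (INR n * G) <= q / 2).
{ assert (0 <= tau * (INR n * G) * Dn) by now apply Rmult_le_pos.
  assert (tau * (INR n * G) * (1 + Dn) = tau * (INR n * G) + tau * (INR n * G) * Dn) by ring.
  lra. }
assert (Hh : lfun Y (2 - q) h).
{ apply (lfun_mono HY) with (2 - (1/2)^p + tau * (INR n * G)).
  - assert (A := half_pow_lt p n Hp). fold q in A. lra.
  - now apply lfun_add. }
assert (Hhkill : forall x, mem X x -> (forall m, (m < n)%nat -> F m (T x) = K0 c) ->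
   h (T x) = K0 c).
{ intros z Hz Hzk. unfold h. rewrite HHk; [|exact Hz|intros m Hm; apply Hzk; lia].
  unfold k. rewrite ksum_0; [ring|]. intros j Hj. apply in_seq in Hj.
  rewrite (Hkill' z Hzk) by lia. ring. }
set (phi := fun y => Kadd (psi y) (h y)).
assert (Hphi : lfun Y (M + (2 - q)) phi) by (apply lfun_add; [apply Hpsi|exact Hh]).
assert (Hq2 : q <= 1).
{ apply half_pow_le_1. }
destruct (exists_normalized (M + (2 - q)) delta n s phi x) as (x' & A1 & A2 & A3 & A4);
  try assumption; try lra.
{ intros m Hm. apply (lfun_bounded_fun (M + 2)). now apply HF. }
{ unfold phi. rewrite Hhkill; [|exact Hx|now apply Hkill].
  replace (Kadd (psi (T x)) (K0 c)) with (psi (T x)) by ring. exact Hbig. }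
{ now apply Hkill. }
exists (mkStage phi h x'). unfold good_stage; simpl.
split; [exact Hh|]. split.
{ replace (fun y => Ksub (phi y) (h y)) with psi; [exact Hpsi|].
  apply functional_extensionality. intros y. unfold phi. ring. }
do 4 (split; [assumption|]). split; [exact Hhkill|].
intros _. split.
- intros m Hm. fold p. change (phi (T (xs m)) = F p (T (xs m))).
  unfold phi, h. assert (Ek : k (T (xs m)) = cf m).
  { unfold k. rewrite (ksum_ext _ _ (fun j => if Nat.eq_dec j m then cf m else K0 c)).
    - rewrite (ksum_delta n m) by (try exact Hm; intros j Hj; now destruct (Nat.eq_dec j m)).
      destruct (Nat.eq_dec m m) as [_|]; [reflexivity|congruence].
    - intros j Hj. apply in_seq in Hj. rewrite Hbi by lia.
      destruct (Nat.eq_dec m j) as [->|Hmj].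
      + destruct (Nat.eq_dec j j); [ring|congruence].
      + destruct (Nat.eq_dec j m); [congruence|ring]. }
  rewrite Ek. unfold cf, psip, F. ring.
- intros i Hi. fold p.
  (* The parent's correction is inherited and cancels, which leaves the new correction and the
     distance from [psip] to [psi], each at most [q / 2]. *)
  replace (Ksub (phi (d i)) (stF (s p) (d i)))
    with (Ksub (k (d i)) (Ksub (psip (d i)) (psi (d i)))) by (unfold phi, h, psip; ring).
  eapply Rle_trans; [apply Kabs_sub_le|].
  specialize (Hn2 i Hi).
  assert (Kabs (k (d i)) <= q / 2).
  { eapply Rle_trans; [apply Hk, Hd|].
    apply Rle_trans with (tau * (INR n * G) * (1 + Dn)); [|exact Htau'].
    apply Rmult_le_compat_l; [exact HtG|].
    assert (norm Y (d i) <= Dn); [|lra].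
    apply (rsum_ge_mem _ (fun i => norm Y (d i))).
    - intros j _. now apply (norm_pos HY).
    - apply in_seq. lia. }
  fold q. lra.
Qed.

(** The tree enters only through the parent map. The three conditions on the values are the
    recursive form of the initial-segment matrix, decoded in [tree_system_eval]. *)
Theorem tree_system : ~ adj_range_sep X Y T (mem X) ->
  (forall x, mem X x -> approximable (T x)) ->
  exists (phi : nat -> E) (xs : nat -> car X) (M C : R), 0 <= M /\ 0 <= C /\
    (forall n, lfun Y M (phi n)) /\
    (forall n, mem X (xs n) /\ norm X (xs n) <= C) /\
    (forall n, phi n (T (xs n)) = K1 c) /\
    (forall m n, (m < n)%nat -> phi m (T (xs n)) = K0 c) /\
    (forall m n, (m < n)%nat -> phi n (T (xs m)) = phi (par n) (T (xs m))) /\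
    (forall i n, (i < n)%nat -> Kabs (Ksub (phi n (d i)) (phi (par n) (d i))) <= (1/2)^n).
Proof.
intros Hsep Happ. destruct (not_small_of_not_sep Hsep) as (M & delta & HM & Hdel & Hns).
destruct (history_choice (mkStage (fun _ => K0 c) (fun _ => K0 c) (zero X))
  (good_stage M delta)) as [s Hs].
{ intros n f f' a. apply good_stage_ext. }
{ intros n s Hs. now apply good_stage_exists. }
exists (fun n => stF (s n)), (fun n => stX (s n)), (M + 2), (9 / delta).
split; [lra|]. split; [left; apply Rdiv_lt_0_compat; lra|].
split; [intros n; now apply (good_stage_lfun M delta n s)|].
split; [intros n; split; apply Hs|]. split; [intros n; apply Hs|].
split; [intros m n Hm; now apply (Hs n)|].
split; intros m n Hm; apply (Hs n); lia.
Qed.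

End Core.

(** * Sequences of naturals, branches and the coarse wedge topology *)

Lemma prefix_refl s : prefix s s.
Proof. exists []. now rewrite app_nil_r. Qed.

Lemma prefix_trans s t u : prefix s t -> prefix t u -> prefix s u.
Proof. intros [r ->] [r' ->]. exists (r ++ r'). now rewrite app_assoc. Qed.

Lemma prefix_nil s : prefix s [] -> s = [].
Proof. intros [r H]. symmetry in H. now apply app_eq_nil in H. Qed.

Lemma prefix_snoc s t a : prefix s (t ++ [a]) <-> s = t ++ [a] \/ prefix s t.
Proof.
split.
- intros [r H]. destruct r as [|b r] using rev_ind.
  + left. now rewrite app_nil_r in H.
  + right. rewrite app_assoc in H. apply app_inj_tail in H. now exists r.
- intros [->|[r ->]]; [apply prefix_refl|]. exists (r ++ [a]). now rewrite app_assoc.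
Qed.

Lemma prefix_linear s t u : prefix s u -> prefix t u -> prefix s t \/ prefix t s.
Proof.
revert s t. induction u as [|a u IH] using rev_ind; intros s t Hs Ht.
- left. apply prefix_nil in Hs. subst. now exists t.
- apply prefix_snoc in Hs, Ht. destruct Hs as [->|Hs].
  + right. apply prefix_snoc. tauto.
  + destruct Ht as [->|Ht]; [left; apply prefix_snoc; tauto|]. auto.
Qed.

Lemma prefix_same_length s t : prefix s t -> length s = length t -> s = t.
Proof.
intros [r ->] H. rewrite length_app in H. destruct r; [now rewrite app_nil_r|simpl in H; lia].
Qed.

(** The code pairs the code of the parent with the last entry, so that [par] is a projection and
    codes increase along initial segments. The list is reversed to put the last entry at the
    head. *)
Fixpoint rcode (l : list nat) : nat :=
  match l with [] => O | a :: r => S (Cantor.to_nat (rcode r, a)) end.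
Definition code (s : list nat) : nat := rcode (rev s).
Definition dec (n : nat) : list nat := epsilon (inhabits []) (fun s => code s = n).
Definition par (n : nat) : nat := match n with O => O | S k => fst (Cantor.of_nat k) end.

Lemma code_snoc s a : code (s ++ [a]) = S (Cantor.to_nat (code s, a)).
Proof. unfold code. now rewrite rev_app_distr. Qed.

Lemma rcode_inj l l' : rcode l = rcode l' -> l = l'.
Proof.
revert l'. induction l as [|a l IH]; intros [|b l'] H; [reflexivity|discriminate|discriminate|].
cbn [rcode] in H. apply eq_add_S, Cantor.to_nat_inj in H. injection H as H ->.
f_equal. auto.
Qed.

Lemma code_inj s t : code s = code t -> s = t.
Proof.
intros H. apply rcode_inj in H. rewrite <- (rev_involutive s), H. apply rev_involutive.
Qed.

Lemma par_lt n : n <> O -> (par n < n)%nat.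
Proof.
intros H. destruct n as [|k]; [congruence|]. simpl.
destruct (Cantor.of_nat k) as [p a] eqn:E. simpl.
assert (H1 := Cantor.to_nat_non_decreasing p a). rewrite <- E, Cantor.cancel_to_of in H1. lia.
Qed.

Lemma code_surj n : exists s, code s = n.
Proof.
induction n as [n IH] using lt_wf_ind. destruct n as [|k]; [now exists []|].
destruct (IH (par (S k)) (par_lt (S k) ltac:(lia))) as [s Hs].
exists (s ++ [snd (Cantor.of_nat k)]). rewrite code_snoc, Hs. f_equal. cbn [par].
rewrite <- surjective_pairing. apply Cantor.cancel_to_of.
Qed.

Lemma code_dec n : code (dec n) = n.
Proof. unfold dec. apply epsilon_spec. apply code_surj. Qed.

Lemma dec_code s : dec (code s) = s.
Proof. apply code_inj. apply code_dec. Qed.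

Lemma dec_inj m n : dec m = dec n -> m = n.
Proof. intros H. rewrite <- (code_dec m), H. apply code_dec. Qed.

Lemma dec_0 : dec 0 = [].
Proof. apply code_inj. rewrite code_dec. reflexivity. Qed.

Lemma dec_par n : n <> O -> exists a, dec n = dec (par n) ++ [a].
Proof.
intros Hn. destruct n as [|k]; [congruence|]. exists (snd (Cantor.of_nat k)).
apply code_inj. rewrite code_snoc, !code_dec. cbn [par]. f_equal.
rewrite <- surjective_pairing. symmetry. apply Cantor.cancel_to_of.
Qed.

Lemma prefix_dec m n : n <> O -> (prefix (dec m) (dec n) <-> m = n \/ prefix (dec m) (dec (par n))).
Proof.
intros Hn. destruct (dec_par n Hn) as [a Ha]. rewrite Ha, prefix_snoc, <- Ha.
split; (intros [H|H]; [left|now right]); [now apply dec_inj|now rewrite H].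
Qed.

Lemma prefix_dec_le m n : prefix (dec m) (dec n) -> (m <= n)%nat.
Proof.
induction n as [n IH] using lt_wf_ind. intros H. destruct (Nat.eq_dec n 0) as [->|Hn].
- rewrite dec_0 in H. apply prefix_nil in H. rewrite <- dec_0 in H. apply dec_inj in H. lia.
- apply prefix_dec in H; [|exact Hn]. destruct H as [->|H]; [lia|].
  assert (Hp := par_lt n Hn). assert (m <= par n)%nat by auto. lia.
Qed.

Lemma prefix_code_le s t : prefix s t -> (code s <= code t)%nat.
Proof. intros H. apply prefix_dec_le. now rewrite !dec_code. Qed.

Definition ind {c} (P : Prop) : K c := if excluded_middle_informative P then K1 c else K0 c.

Lemma ind_ext {c} (P Q : Prop) : (P <-> Q) -> @ind c P = ind Q.
Proof.
intros H. unfold ind.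
destruct (excluded_middle_informative P), (excluded_middle_informative Q); tauto.
Qed.

Lemma Kabs_ind {c} (P : Prop) : Kabs (@ind c P) <= 1.
Proof.
unfold ind. destruct (excluded_middle_informative P); [rewrite Kabs_1|rewrite Kabs_0]; lra.
Qed.

(** Induction on the row: before the diagonal a row copies its parent's row, and a proper initial
    segment of [n] is an initial segment of its parent; after the diagonal no initial segment can
    occur, by [prefix_dec_le]. *)
Lemma tree_system_eval {c} (A : nat -> nat -> K c) :
  (forall n, A n n = K1 c) -> (forall m n, (m < n)%nat -> A m n = K0 c) ->
  (forall m n, (m < n)%nat -> A n m = A (par n) m) ->
  forall n m, A n m = ind (prefix (dec m) (dec n)).
Proof.
intros H1 H2 H3 n. induction n as [n IH] using lt_wf_ind. intros m.
destruct (lt_eq_lt_dec m n) as [[H| ->]|H].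
- rewrite H3 by exact H. assert (Hn : n <> O) by lia.
  rewrite IH by now apply par_lt. apply ind_ext. rewrite (prefix_dec m n Hn).
  split; [auto|]. intros [?|?]; [lia|assumption].
- rewrite H1. unfold ind. destruct (excluded_middle_informative _) as [|N]; [reflexivity|].
  exfalso. apply N, prefix_refl.
- rewrite H2 by exact H. unfold ind.
  destruct (excluded_middle_informative _) as [P|]; [|reflexivity].
  apply prefix_dec_le in P. lia.
Qed.

(* 0 if no index below [N] satisfies [Q]. *)
Fixpoint largest_below (Q : nat -> Prop) (N : nat) : nat :=
  match N with
  | O => O
  | S k => if excluded_middle_informative (Q k) then k else largest_below Q k
  end.

Lemma largest_below_ext Q Q' N : (forall i, (i < N)%nat -> (Q i <-> Q' i)) ->
  largest_below Q N = largest_below Q' N.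
Proof.
induction N as [|N IH]; intros H; [reflexivity|]. simpl.
assert (HN := H N (Nat.lt_succ_diag_r N)).
rewrite IH by auto.
destruct (excluded_middle_informative (Q N)), (excluded_middle_informative (Q' N)); tauto.
Qed.

Lemma largest_below_eq (Q : nat -> Prop) N n : (n < N)%nat -> Q n ->
  (forall i, (i < N)%nat -> Q i -> (i <= n)%nat) -> largest_below Q N = n.
Proof.
induction N as [|N IH]; intros Hn HQ H; [lia|]. simpl.
destruct (excluded_middle_informative (Q N)) as [HN|HN].
- assert (N <= n)%nat by auto. lia.
- apply IH; auto. destruct (Nat.eq_dec n N) as [->|]; [contradiction|lia].
Qed.

Lemma largest_below_spec (Q : nat -> Prop) N i : (i < N)%nat -> Q i ->
  Q (largest_below Q N) /\ (largest_below Q N < N)%nat /\ (i <= largest_below Q N)%nat.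
Proof.
induction N as [|N IH]; intros Hi HQ; [lia|]. simpl.
destruct (excluded_middle_informative (Q N)) as [HN|HN].
- split; [exact HN|lia].
- destruct (Nat.eq_dec i N) as [->|]; [contradiction|].
  destruct IH as (A&B&C); [lia|exact HQ|]. repeat split; [exact A|lia|exact C].
Qed.

Definition below (n i : nat) : Prop := prefix (dec i) (dec n).

(** Since codes increase along initial segments, [largest_below (below n) N] is the longest initial
    segment of [n] with code below [N]. The condition is a uniform continuity on the nodes, which
    permits extension to the branches. *)
Definition oscillation_vanishes {c} (a : nat -> K c) : Prop :=
  forall eps, 0 < eps -> exists N, forall n,
    Kabs (Ksub (a n) (a (largest_below (below n) N))) <= eps.

Lemma below_oscillation {c} (a : nat -> K c) (i N : nat) : (i < N)%nat ->
  (forall n, (i < n)%nat -> Kabs (Ksub (a n) (a (par n))) <= (1/2)^n) ->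
  forall n, Kabs (Ksub (a n) (a (largest_below (below n) N))) <= 2 * (1/2)^N.
Proof.
intros Hi Ha.
assert (Hpow : forall n, 0 < (1/2)^n) by (intros; apply pow_lt; lra).
assert (Hlt : forall n, (n < N)%nat -> largest_below (below n) N = n).
{ intros n Hn. apply largest_below_eq; [exact Hn|apply prefix_refl|].
  intros j _ Hj. now apply prefix_dec_le. }
(* Telescoping back to the last ancestor below [N]. The subtracted (1/2)^n is room that absorbs the
   next step of the path. *)
assert (H : forall n, (N <= n)%nat ->
  Kabs (Ksub (a n) (a (largest_below (below n) N))) <= 2 * (1/2)^N - (1/2)^n).
{ intros n. induction n as [n IH] using lt_wf_ind. intros Hn.
  assert (Hn0 : n <> O) by lia. assert (Hp := par_lt n Hn0).
  rewrite (largest_below_ext (below n) (below (par n)) N).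
  2:{ intros j Hj. unfold below. rewrite prefix_dec by exact Hn0.
      split; [|auto]. intros [?|?]; [lia|assumption]. }
  eapply Rle_trans; [apply Kabs_sub_tri with (d := a (par n))|].
  assert (H1 := Ha n ltac:(lia)).
  destruct (Nat.lt_ge_cases (par n) N) as [Hlt'|Hge].
  - rewrite (Hlt (par n) Hlt'), Kabs_sub_refl.
    destruct (Nat.eq_dec n N) as [->|]; [lra|].
    assert (H2 := half_pow_lt N n ltac:(lia)). assert (H3 := Hpow n). lra.
  - specialize (IH (par n) Hp Hge). assert (H2 := half_pow_lt (par n) n Hp).
    assert (H3 := Hpow n). lra. }
intros n. assert (H1 := Hpow N). assert (H2 := Hpow n).
destruct (Nat.lt_ge_cases n N) as [Hn|Hn].
- rewrite (Hlt n Hn), Kabs_sub_refl. lra.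
- specialize (H n Hn). lra.
Qed.

Lemma half_pow_small (eps : R) : 0 < eps -> exists N, forall n, (N <= n)%nat -> 2 * (1/2)^n <= eps.
Proof.
intros He. destruct (pow_lt_1_zero (1/2) ltac:(rewrite Rabs_pos_eq; lra) (eps/2) ltac:(lra))
  as [N HN].
exists N. intros n Hn. specialize (HN n Hn).
assert (0 < (1/2)^n) by (apply pow_lt; lra). rewrite Rabs_pos_eq in HN; lra.
Qed.

(** The estimate holds at each [d i] once [N] exceeds [i]; a common norm bound carries it over to
    [y]. *)
Lemma system_oscillation {c} {Y : NS c} (HY : is_Banach Y) (d : nat -> car Y) M
  (phi : nat -> car Y -> K c) y : (forall i, mem Y (d i)) -> 0 <= M ->
  (forall n, lfun Y M (phi n)) ->
  (forall i n, (i < n)%nat -> Kabs (Ksub (phi n (d i)) (phi (par n) (d i))) <= (1/2)^n) ->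
  @approximable c Y d y -> oscillation_vanishes (fun n => phi n y).
Proof.
intros Hd HM Hphi Hdi [Hy Happ] eps He.
destruct (Happ (eps / (4 * (M + 1)))) as [i Hi]; [apply Rdiv_lt_0_compat; lra|].
assert (Hdp := dist_pos HY _ _ (Hd i) Hy).
assert (Hclose : forall n, Kabs (Ksub (phi n (d i)) (phi n y)) <= eps / 4).
{ intros n. eapply Rle_trans; [now apply (fun_dist HY M)|].
  apply Rle_trans with ((M + 1) * (eps / (4 * (M + 1)))).
  - apply Rmult_le_compat; lra.
  - right. field. lra. }
destruct (half_pow_small (eps / 4) ltac:(lra)) as [N0 HN0].
exists (N0 + S i)%nat. intros n.
assert (H := below_oscillation (fun n => phi n (d i)) i (N0 + S i) ltac:(lia)
  (fun n => Hdi i n) n). cbv beta in H.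
specialize (HN0 (N0 + S i)%nat ltac:(lia)).
set (r := largest_below (below n) (N0 + S i)) in *.
assert (H1 := Kabs_sub_tri (phi n (d i)) (phi n y) (phi r y)).
assert (H2 := Kabs_sub_tri (phi r (d i)) (phi n (d i)) (phi r y)).
rewrite (Kabs_sub_sym (phi n y) (phi n (d i))) in H1.
assert (H3 := Hclose n). assert (H4 := Hclose r). lra.
Qed.

(** * Branches and continuous extension to the boundary *)

Definition infinite_chain (B : list nat -> Prop) : Prop :=
  chain B /\ ~ exists l : list (list nat), forall s, B s -> In s l.

Lemma infinite_chain_long B : infinite_chain B -> forall n, exists s, B s /\ (n <= length s)%nat.
Proof.
intros [Hc Hinf] n. apply NNPP. intros Hn. apply Hinf.
assert (Hlen : forall s, B s -> (length s < n)%nat).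
{ intros s Hs. apply Nat.nle_gt. intros H. apply Hn. now exists s. }
clear Hn. exists (map (fun k => epsilon (inhabits []) (fun s => B s /\ length s = k)) (seq 0 n)).
intros s Hs. apply in_map_iff. exists (length s). split.
- destruct (epsilon_spec (inhabits []) (fun t => B t /\ length t = length s)) as [H1 H2];
    [now exists s|].
  destruct (Hc _ _ H1 Hs) as [H|H]; [now apply prefix_same_length|].
  symmetry. now apply prefix_same_length.
- apply in_seq. specialize (Hlen s Hs). lia.
Qed.

(** Maximality: any node comparable with all of [B] is an initial segment of a longer member, hence
    already in [B]. *)
Lemma infinite_chain_branch Tr B : (forall s, B s -> Tr s) -> infinite_chain B ->
  (forall s t, B t -> prefix s t -> B s) -> is_branch Tr B.
Proof.
intros HT Hi Hd. split; [exact HT|]. split; [apply Hi|]. split; [apply Hi|].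
intros C HC Hch HBC s Hs.
destruct (infinite_chain_long B Hi (S (length s))) as (t & Ht & Hl).
destruct (Hch s t Hs (HBC t Ht)) as [H|H]; [now apply Hd with t|].
destruct H as [r ->]. rewrite length_app in Hl. lia.
Qed.

Section Tree.
Context {Tr : list nat -> Prop} (HTr : downward_closed Tr).

(** Adding [s] to the branch leaves it a chain in [Tr], so maximality forces [s] into it. *)
Lemma branch_downward B : is_branch Tr B -> forall s t, B t -> prefix s t -> B s.
Proof.
intros (H1&H2&H3&H4) s t Ht Hst.
apply (H4 (fun u => B u \/ u = s)); [| | |now right].
- intros u [Hu| ->]; [auto|]. apply HTr with t; auto.
- intros u v [Hu| ->] [Hv| ->]; auto.
  + destruct (H2 u t Hu Ht) as [H|H]; [now apply prefix_linear with t|].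
    right. now apply prefix_trans with t.
  + destruct (H2 v t Hv Ht) as [H|H]; [now apply prefix_linear with t|].
    left. now apply prefix_trans with t.
  + left. apply prefix_refl.
- auto.
Qed.

Lemma branch_infinite B : is_branch Tr B -> infinite_chain B.
Proof. intros (H1&H2&H3&H4). split; assumption. Qed.

(** The filter of tails of a branch, along which values at the nodes converge to the value at the
    boundary point. *)
Definition branch_filter (B : list nat -> Prop) (P : list nat -> Prop) : Prop :=
  exists s0, B s0 /\ forall s, B s -> prefix s0 s -> P s.

Lemma branch_filter_proper B : is_branch Tr B -> proper_filter (branch_filter B).
Proof.
intros HB. destruct (infinite_chain_long B (branch_infinite B HB) 0) as (s0 & Hs0 & _).
split.
- exists s0. auto.
- intros P Q H (s & Hs & HP). exists s. auto.
- intros P Q (s & Hs & HP) (t & Ht & HQ). destruct HB as (_&Hc&_).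
  destruct (Hc s t Hs Ht) as [H|H].
  + exists t. split; [exact Ht|]. intros u Hu Htu. split; [|auto].
    apply HP; [exact Hu|]. now apply prefix_trans with t.
  + exists s. split; [exact Hs|]. intros u Hu Htu. split; [auto|].
    apply HQ; [exact Hu|]. now apply prefix_trans with s.
- intros (s & Hs & H). exact (H s Hs (prefix_refl s)).
Qed.

Lemma branch_filter_member B s : is_branch Tr B -> branch_filter B (fun t => B s <-> prefix s t).
Proof.
intros HB. destruct (classic (B s)) as [Hs|Hs].
- exists s. split; [exact Hs|]. intros t Ht Hst. tauto.
- destruct (infinite_chain_long B (branch_infinite B HB) 0) as (s0 & Hs0 & _).
  exists s0. split; [exact Hs0|]. intros t Ht _. split; [tauto|].
  intros H. now apply (branch_downward B HB) with t.
Qed.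

Lemma branch_filter_members B N : is_branch Tr B ->
  branch_filter B (fun t => forall i, (i < N)%nat -> (B (dec i) <-> prefix (dec i) t)).
Proof.
intros HB. assert (HF := branch_filter_proper B HB). induction N as [|N IH].
- apply (pf_all HF). intros t i Hi. lia.
- apply (pf_mono _ HF) with (2 := pf_and _ HF _ _ IH (branch_filter_member B (dec N) HB)).
  intros t [H1 H2] i Hi. destruct (Nat.eq_dec i N) as [->|]; [exact H2|apply H1; lia].
Qed.

Lemma leq'_tree (s : list nat) (u : Tbar Tr) : leq' s u -> Tr s.
Proof.
destruct u as [[t Ht]|[B HB]]; simpl; intros H.
- now apply HTr with t.
- destruct HB as [HB _]. auto.
Qed.

(** Lists outside [Tr] impose no condition, by [leq'_tree]. Agreement replaces the topology:
    agreement estimates give continuity directly, and continuity gives such estimates by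
    compactness. *)
Definition agree (N : nat) (u v : Tbar Tr) : Prop :=
  forall i, (i < N)%nat -> (leq' (dec i) u <-> leq' (dec i) v).

Definition last_node (N : nat) (u : Tbar Tr) : nat := largest_below (fun i => leq' (dec i) u) N.

Lemma last_node_agree N u v : agree N u v -> last_node N u = last_node N v.
Proof. apply largest_below_ext. Qed.

Section Extension.
Context {c : bool} (a : nat -> K c) (Ha : oscillation_vanishes a).

Definition extend (u : Tbar Tr) : K c :=
  match u with
  | inl t => a (code (proj1_sig t))
  | inr B => klimval (branch_filter (proj1_sig B)) (fun s => a (code s))
  end.

Lemma branch_near_top B eps N : is_branch Tr B ->
  (forall n, Kabs (Ksub (a n) (a (largest_below (below n) N))) <= eps) ->
  branch_filter B (fun s =>
    Kabs (Ksub (a (code s)) (a (largest_below (fun i => B (dec i)) N))) <= eps).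
Proof.
intros HB HN.
apply (pf_mono _ (branch_filter_proper B HB)) with (2 := branch_filter_members B N HB).
intros s Hs. rewrite (largest_below_ext _ (below (code s)) N); [apply HN|].
intros i Hi. unfold below. rewrite dec_code. now apply Hs.
Qed.

Lemma extend_lim (B : branch Tr) :
  klim (branch_filter (proj1_sig B)) (fun s => a (code s)) (extend (inr B)).
Proof.
destruct B as [B HB]. simpl. apply (klimval_spec (branch_filter_proper B HB)).
intros eps He. destruct (Ha eps He) as [N HN].
exists (a (largest_below (fun i => B (dec i)) N)). now apply branch_near_top.
Qed.

(** The same [N] serves nodes and branches, as the estimate on nodes passes to limits along a
    branch. Continuity of the extension follows, because [last_node] depends only on agreement up to
    [N]. *)
Lemma extend_near_last_node eps : 0 < eps ->
  exists N, forall u, Kabs (Ksub (extend u) (a (last_node N u))) <= eps.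
Proof.
intros He. destruct (Ha eps He) as [N HN]. exists N. intros [t|B].
- simpl. unfold last_node. rewrite (largest_below_ext _ (below (code (proj1_sig t))) N);
    [apply HN|].
  intros i Hi. unfold below. now rewrite dec_code.
- apply (klim_dist_le (branch_filter_proper _ (proj2_sig B))) with (1 := extend_lim B).
  apply branch_near_top; [apply (proj2_sig B)|exact HN].
Qed.

End Extension.

Definition node_tests (u : Tbar Tr) (N : nat) : list (node Tr * bool) :=
  flat_map (fun i => match excluded_middle_informative (Tr (dec i)) with
    | left H => [(exist _ (dec i) H,
        if excluded_middle_informative (leq' (dec i) u) then true else false)]
    | right _ => []
    end) (seq 0 N).

Lemma cw_continuous_of_agree {c} (f : Tbar Tr -> K c) :
  (forall eps, 0 < eps -> exists N, forall u v, agree N u v -> Kabs (Ksub (f u) (f v)) <= eps) ->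
  cw_continuous f.
Proof.
intros H u eps He. destruct (H (eps/2) ltac:(lra)) as [N HN].
exists (node_tests u N). split.
- intros p Hp. apply in_flat_map in Hp. destruct Hp as (i & Hi & Hp).
  destruct (excluded_middle_informative (Tr (dec i))) as [Hd|Hd]; [|destruct Hp].
  destruct Hp as [<-|[]]. unfold subbasic; simpl.
  destruct (excluded_middle_informative (leq' (dec i) u)); assumption.
- intros v Hv. apply Rle_lt_trans with (eps/2); [|lra]. apply HN. intros i Hi.
  destruct (excluded_middle_informative (Tr (dec i))) as [Hd|Hd] eqn:E.
  + assert (Hin := Hv (exist _ (dec i) Hd,
      if excluded_middle_informative (leq' (dec i) u) then true else false)).
    unfold subbasic in Hin. simpl in Hin.
    assert (Hin' : In (exist _ (dec i) Hd,
      if excluded_middle_informative (leq' (dec i) u) then true else false) (node_tests u N)).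
    { apply in_flat_map. exists i. split; [apply in_seq; lia|]. rewrite E. now left. }
    specialize (Hin Hin').
    destruct (excluded_middle_informative (leq' (dec i) u)); tauto.
  + split; intros Hl; exfalso; apply Hd; now apply leq'_tree in Hl.
Qed.

Lemma extend_continuous {c} (a : nat -> K c) : oscillation_vanishes a -> cw_continuous (extend a).
Proof.
intros Ha. apply cw_continuous_of_agree. intros eps He.
destruct (extend_near_last_node a Ha (eps/2) ltac:(lra)) as [N HN]. exists N. intros u v Huv.
assert (H := Kabs_sub_tri (a (last_node N u)) (extend a u) (extend a v)).
assert (H1 := HN u). assert (H2 := HN v). rewrite <- (last_node_agree N u v Huv) in H2.
rewrite (Kabs_sub_sym (a (last_node N u)) (extend a v)) in H. lra.
Qed.

End Tree.

(** * The spaces of the statement are Banach *)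

(** [linf] and [Cspace] are both convertible to instances of this, so completeness is proved once,
    for any [m] closed under uniform limits. *)
Definition sup_space (c : bool) (I : Type) (m : (I -> K c) -> Prop) : NS c := {|
  car := I -> K c;
  mem := m;
  zero := fun _ => K0 c;
  add := fun x y t => Kadd (x t) (y t);
  opp := fun x t => Kopp (x t);
  scal := fun a x t => Kmul a (x t);
  norm := fun f => Rsup (fun r => r = 0 \/ exists u, r = Kabs (f u)) |}.

Section SupSpace.
Context {c : bool} {I : Type} {m : (I -> K c) -> Prop}.
Add Ring KRing : (@Kring_theory c).
Notation S := (sup_space c I m).

Lemma sup_norm_ge f M i : (forall i, Kabs (f i) <= M) -> Kabs (f i) <= norm S f.
Proof.
intros H. apply Rsup_ub with (Rmax M 0); [|right; now exists i].
intros r [->|[j ->]]; [apply Rmax_r|]. eapply Rle_trans; [apply H|apply Rmax_l].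
Qed.

Lemma sup_norm_le f M : 0 <= M -> (forall i, Kabs (f i) <= M) -> norm S f <= M.
Proof.
intros HM H. apply Rsup_le; [exists 0; now left|]. intros r [->|[j ->]]; auto.
Qed.

Lemma sup_norm_pos f M : (forall i, Kabs (f i) <= M) -> 0 <= norm S f.
Proof.
intros H. apply Rsup_ub with (Rmax M 0); [|now left].
intros r [->|[j ->]]; [apply Rmax_r|]. eapply Rle_trans; [apply H|apply Rmax_l].
Qed.

Context (m0 : m (fun _ => K0 c)) (madd : forall f g, m f -> m g -> m (fun i => Kadd (f i) (g i)))
  (mscal : forall a f, m f -> m (fun i => Kmul a (f i)))
  (mbound : forall f, m f -> exists M, forall i, Kabs (f i) <= M)
  (mlim : forall (u : nat -> I -> K c) f, (forall n, m (u n)) ->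
     (forall eps, 0 < eps -> exists N, forall n, (N <= n)%nat ->
        forall i, Kabs (Ksub (u n i) (f i)) <= eps) -> m f).

Lemma mopp f : m f -> m (fun i => Kopp (f i)).
Proof.
intros H. replace (fun i => Kopp (f i)) with (fun i => Kmul (Kopp (K1 c)) (f i)); [auto|].
apply functional_extensionality. intros i. ring.
Qed.

Lemma sup_space_Banach : is_Banach S.
Proof.
assert (ext : forall f g : I -> K c, (forall i, f i = g i) -> f = g)
  by (intros; now apply functional_extensionality).
unfold is_Banach. simpl car. simpl mem.
split; [exact m0|]. split; [exact madd|]. split; [exact mopp|]. split; [exact mscal|].
split; [intros; apply ext; intros; simpl; ring|].
split; [intros; apply ext; intros; simpl; ring|].
split; [intros; apply ext; intros; simpl; ring|].
split; [intros; apply ext; intros; simpl; ring|].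
split; [intros; apply ext; intros; simpl; ring|].
split; [intros; apply ext; intros; simpl; ring|].
split; [intros; apply ext; intros; simpl; ring|].
split; [intros; apply ext; intros; simpl; ring|].
split; [intros f Hf; destruct (mbound f Hf) as [M HM]; now apply sup_norm_pos with M|].
split.
{ intros f Hf H. destruct (mbound f Hf) as [M HM]. apply ext. intros i. simpl.
  apply Kabs_eq0. apply Rle_antisym; [|apply Kabs_pos]. rewrite <- H.
  now apply sup_norm_ge with M. }
split.
{ intros a f Hf. destruct (mbound f Hf) as [M HM].
  assert (Ha := Kabs_pos a). assert (Hp := sup_norm_pos f M HM).
  apply Rle_antisym.
  - apply sup_norm_le; [now apply Rmult_le_pos|]. intros i.
    change (Kabs (Kmul a (f i)) <= Kabs a * norm S f). rewrite Kabs_mul.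
    apply Rmult_le_compat_l; [exact Ha|]. now apply sup_norm_ge with M.
  - destruct (Req_dec (Kabs a) 0) as [E|E].
    { rewrite E, Rmult_0_l. apply sup_norm_pos with 0. intros i.
      change (Kabs (Kmul a (f i)) <= 0). rewrite Kabs_mul, E. lra. }
    assert (Ha' : 0 < Kabs a) by lra.
    apply Rmult_le_reg_l with (/ Kabs a); [now apply Rinv_0_lt_compat|].
    replace (/ Kabs a * (Kabs a * norm S f)) with (norm S f) by (field; lra).
    assert (HM' : forall i, Kabs (Kmul a (f i)) <= Kabs a * M).
    { intros i. rewrite Kabs_mul. now apply Rmult_le_compat_l. }
    assert (Hp' := sup_norm_pos _ _ HM').
    apply sup_norm_le.
    + apply Rmult_le_pos; [left; now apply Rinv_0_lt_compat|exact Hp'].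
    + intros i. apply Rmult_le_reg_l with (Kabs a); [exact Ha'|].
      rewrite <- Kabs_mul. rewrite <- Rmult_assoc, Rinv_r, Rmult_1_l by lra.
      apply (sup_norm_ge (fun i => Kmul a (f i)) _ i HM'). }
split.
{ intros f g Hf Hg. destruct (mbound f Hf) as [M HM], (mbound g Hg) as [M' HM'].
  assert (H1 := sup_norm_pos f M HM). assert (H2 := sup_norm_pos g M' HM').
  apply sup_norm_le; [lra|]. intros i. eapply Rle_trans; [apply Kabs_add|].
  assert (H3 := sup_norm_ge f M i HM). assert (H4 := sup_norm_ge g M' i HM'). lra. }
intros u Hu HC.
assert (Hptw : forall k l i, Kabs (Ksub (u k i) (u l i)) <= dist S (u k) (u l)).
{ intros k l i. destruct (mbound _ (madd _ _ (Hu k) (mopp _ (Hu l)))) as [M HM].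
  exact (sup_norm_ge (fun i => Kadd (u k i) (Kopp (u l i))) M i HM). }
destruct (choice_fun (fun i L => forall eps, 0 < eps -> exists N, forall n, (N <= n)%nat ->
  Kabs (Ksub (u n i) L) < eps)) as [f Hf].
{ intros i. apply K_seq_complete. intros e He. destruct (HC e He) as [N HN].
  exists N. intros k l Hk Hl. eapply Rle_lt_trans; [apply Hptw|]. auto. }
assert (Hunif : forall eps, 0 < eps -> exists N, forall n, (N <= n)%nat ->
   forall i, Kabs (Ksub (u n i) (f i)) <= eps).
{ intros e He. destruct (HC e He) as [N HN]. exists N. intros n Hn i.
  apply le_epsilon. intros e' He'. destruct (Hf i e' He') as [N' HN'].
  eapply Rle_trans; [apply Kabs_sub_tri with (d := u (N + N')%nat i)|].
  assert (H1 := HN' (N + N')%nat ltac:(lia)).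
  assert (H2 := HN n (N + N')%nat Hn ltac:(lia)).
  assert (H3 := Hptw n (N + N')%nat i). lra. }
exists f. split; [now apply mlim with u|].
intros e He. destruct (Hunif (e/2) ltac:(lra)) as [N HN]. exists N. intros n Hn.
apply Rle_lt_trans with (e/2); [|lra]. apply sup_norm_le; [lra|]. intros i. now apply HN.
Qed.

End SupSpace.

Lemma linf_Banach c Tr : is_Banach (linf c Tr).
Proof.
apply (@sup_space_Banach c (node Tr) (fun x => exists M, forall t, Kabs (x t) <= M)).
- exists 0. intros. rewrite Kabs_0. lra.
- intros f g [M HM] [M' HM']. exists (M + M'). intros t.
  eapply Rle_trans; [apply Kabs_add|]. specialize (HM t). specialize (HM' t). lra.
- intros a f [M HM]. exists (Kabs a * M). intros t. rewrite Kabs_mul.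
  apply Rmult_le_compat_l; [apply Kabs_pos|apply HM].
- auto.
- intros u f Hu Hlim. destruct (Hlim 1 ltac:(lra)) as [N HN].
  destruct (Hu N) as [M HM]. exists (1 + M). intros t.
  assert (H := Kabs_le_sub (f t) (u N t)). rewrite Kabs_sub_sym in H.
  specialize (HN N (le_n N) t). specialize (HM t). lra.
Qed.

Section CSpace.
Context {c : bool} {Tr : list nat -> Prop}.
Add Ring KRing : (@Kring_theory c).

Lemma cw_continuous_const (a : K c) : cw_continuous (fun _ : Tbar Tr => a).
Proof.
intros u e He. exists []. split; [intros p []|]. intros v _. now rewrite Kabs_sub_refl.
Qed.

Lemma cw_continuous_add (f g : Tbar Tr -> K c) : cw_continuous f -> cw_continuous g ->
  cw_continuous (fun u => Kadd (f u) (g u)).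
Proof.
intros Hf Hg u e He.
destruct (Hf u (e/2) ltac:(lra)) as (L1 & H1 & H2), (Hg u (e/2) ltac:(lra)) as (L2 & H3 & H4).
exists (L1 ++ L2). split.
- intros p Hp. apply in_app_iff in Hp. destruct Hp; auto.
- intros v Hv.
  assert (A := H2 v (fun p Hp => Hv p (proj2 (in_app_iff _ _ _) (or_introl Hp)))).
  assert (B := H4 v (fun p Hp => Hv p (proj2 (in_app_iff _ _ _) (or_intror Hp)))).
  replace (Ksub _ _) with (Kadd (Ksub (f v) (f u)) (Ksub (g v) (g u))) by ring.
  eapply Rle_lt_trans; [apply Kabs_add|]. lra.
Qed.

Lemma cw_continuous_scal a (f : Tbar Tr -> K c) : cw_continuous f ->
  cw_continuous (fun u => Kmul a (f u)).
Proof.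
intros Hf u e He. assert (Ha := Kabs_pos a).
destruct (Hf u (e / (Kabs a + 1)) ltac:(apply Rdiv_lt_0_compat; lra)) as (L & H1 & H2).
exists L. split; [exact H1|]. intros v Hv. specialize (H2 v Hv).
replace (Ksub _ _) with (Kmul a (Ksub (f v) (f u))) by ring. rewrite Kabs_mul.
assert (P := Kabs_pos (Ksub (f v) (f u))).
apply Rle_lt_trans with ((Kabs a + 1) * Kabs (Ksub (f v) (f u))); [nra|].
replace e with ((Kabs a + 1) * (e / (Kabs a + 1))) by (field; lra).
apply Rmult_lt_compat_l; lra.
Qed.

Lemma cw_continuous_uniform_limit (u : nat -> Tbar Tr -> K c) f :
  (forall n, cw_continuous (u n)) ->
  (forall eps, 0 < eps -> exists N, forall n, (N <= n)%nat ->
     forall t, Kabs (Ksub (u n t) (f t)) <= eps) -> cw_continuous f.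
Proof.
intros Hu Hlim t e He. destruct (Hlim (e/4) ltac:(lra)) as [N HN].
destruct (Hu N t (e/2) ltac:(lra)) as (L & H1 & H2). exists L. split; [exact H1|].
intros v Hv. specialize (H2 v Hv).
assert (A := HN N (le_n N) v). assert (B := HN N (le_n N) t).
rewrite Kabs_sub_sym in A.
assert (H3 := Kabs_sub_tri (u N v) (f v) (f t)).
assert (H4 := Kabs_sub_tri (u N t) (u N v) (f t)). lra.
Qed.

Lemma Cspace_Banach : is_Banach (Cspace c Tr).
Proof.
apply (@sup_space_Banach c (Tbar Tr)
  (fun f => cw_continuous f /\ exists M, forall u, Kabs (f u) <= M)).
- split; [apply cw_continuous_const|]. exists 0. intros. rewrite Kabs_0. lra.
- intros f g [Hf [M HM]] [Hg [M' HM']]. split; [now apply cw_continuous_add|].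
  exists (M + M'). intros t.
  eapply Rle_trans; [apply Kabs_add|]. specialize (HM t). specialize (HM' t). lra.
- intros a f [Hf [M HM]]. split; [now apply cw_continuous_scal|].
  exists (Kabs a * M). intros t. rewrite Kabs_mul.
  apply Rmult_le_compat_l; [apply Kabs_pos|apply HM].
- now intros f [_ H].
- intros u f Hu Hlim. split; [apply cw_continuous_uniform_limit with u; auto; apply Hu|].
  destruct (Hlim 1 ltac:(lra)) as [N HN].
  destruct (Hu N) as [_ [M HM]]. exists (1 + M). intros t.
  assert (H := Kabs_le_sub (f t) (u N t)). rewrite Kabs_sub_sym in H.
  specialize (HN N (le_n N) t). specialize (HM t). lra.
Qed.

End CSpace.

Section L1.
Context {c : bool} {Tr : list nat -> Prop}.
Add Ring KRing : (@Kring_theory c).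
Implicit Types (w : node Tr -> K c).

Lemma l1_norm_le w M :
  (forall F : list (node Tr), NoDup F -> rsum F (fun t => Kabs (w t)) <= M) ->
  norm (l1 c Tr) w <= M.
Proof.
intros H. apply Rsup_le.
- exists 0, []. split; [constructor|reflexivity].
- intros r (F & HF & ->). now apply H.
Qed.

Lemma l1_mem w M :
  (forall F : list (node Tr), NoDup F -> rsum F (fun t => Kabs (w t)) <= M) ->
  mem (l1 c Tr) w.
Proof. intros H. exists M. exact H. Qed.

Lemma l1_sum_le w (F : list (node Tr)) : mem (l1 c Tr) w -> NoDup F ->
  rsum F (fun t => Kabs (w t)) <= norm (l1 c Tr) w.
Proof.
intros [M HM] HF. apply Rsup_ub with M; [|now exists F]. intros r (F' & HF' & ->). now apply HM.
Qed.

Lemma l1_norm_pos w : mem (l1 c Tr) w -> 0 <= norm (l1 c Tr) w.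
Proof. intros H. apply (l1_sum_le w []); [exact H|constructor]. Qed.

Lemma l1_norm_pt w t : mem (l1 c Tr) w -> Kabs (w t) <= norm (l1 c Tr) w.
Proof.
intros H. assert (A := l1_sum_le w [t] H (NoDup_cons t (@in_nil _ t) (NoDup_nil _))).
change (Kabs (w t) + 0 <= norm (l1 c Tr) w) in A. lra.
Qed.

Lemma l1_add_sum w w' (F : list (node Tr)) : mem (l1 c Tr) w -> mem (l1 c Tr) w' -> NoDup F ->
  rsum F (fun t => Kabs (Kadd (w t) (w' t))) <= norm (l1 c Tr) w + norm (l1 c Tr) w'.
Proof.
intros Hw Hw' HF.
apply Rle_trans with (rsum F (fun t => Kabs (w t) + Kabs (w' t))).
- apply rsum_le. intros; apply Kabs_add.
- rewrite rsum_add. assert (A := l1_sum_le w F Hw HF). assert (B := l1_sum_le w' F Hw' HF). lra.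
Qed.

Lemma l1_opp_mem w : mem (l1 c Tr) w -> mem (l1 c Tr) (opp (l1 c Tr) w).
Proof.
intros [M HM]. exists M. intros F HF. eapply Rle_trans; [|apply (HM F HF)]. right.
apply (rsum_ext F). intros; apply Kabs_opp.
Qed.

Lemma l1_Banach : is_Banach (l1 c Tr).
Proof.
assert (ext : forall f g : node Tr -> K c, (forall i, f i = g i) -> f = g)
  by (intros; now apply functional_extensionality).
unfold is_Banach.
split.
{ apply l1_mem with 0. intros F _. simpl. rewrite rsum_const, Kabs_0. lra. }
split.
{ intros x y Hx Hy. apply l1_mem with (norm (l1 c Tr) x + norm (l1 c Tr) y).
  intros F HF. now apply l1_add_sum. }
split; [exact l1_opp_mem|].
split.
{ intros a x Hx. apply l1_mem with (Kabs a * norm (l1 c Tr) x). intros F HF. simpl.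
  rewrite (rsum_ext _ _ (fun t => Kabs a * Kabs (x t))) by (intros; apply Kabs_mul).
  rewrite rsum_scal. apply Rmult_le_compat_l; [apply Kabs_pos|]. now apply l1_sum_le. }
split; [intros; apply ext; intros; simpl; ring|].
split; [intros; apply ext; intros; simpl; ring|].
split; [intros; apply ext; intros; simpl; ring|].
split; [intros; apply ext; intros; simpl; ring|].
split; [intros; apply ext; intros; simpl; ring|].
split; [intros; apply ext; intros; simpl; ring|].
split; [intros; apply ext; intros; simpl; ring|].
split; [intros; apply ext; intros; simpl; ring|].
split; [exact l1_norm_pos|].
split.
{ intros x Hx H. apply ext. intros t. apply Kabs_eq0.
  apply Rle_antisym; [|apply Kabs_pos]. rewrite <- H. now apply l1_norm_pt. }
split.
{ intros a x Hx.
  assert (Hsum : forall F : list (node Tr), rsum F (fun t => Kabs (Kmul a (x t))) =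
    Kabs a * rsum F (fun t => Kabs (x t))).
  { intros F. rewrite <- rsum_scal. apply rsum_ext. intros; apply Kabs_mul. }
  assert (Ha := Kabs_pos a).
  assert (Hax : mem (l1 c Tr) (scal (l1 c Tr) a x)).
  { apply l1_mem with (Kabs a * norm (l1 c Tr) x). intros F HF. simpl. rewrite Hsum.
    apply Rmult_le_compat_l; [exact Ha|]. now apply l1_sum_le. }
  apply Rle_antisym.
  - apply l1_norm_le. intros F HF. simpl. rewrite Hsum.
    apply Rmult_le_compat_l; [exact Ha|]. now apply l1_sum_le.
  - destruct (Req_dec (Kabs a) 0) as [E|E].
    { rewrite E, Rmult_0_l. now apply l1_norm_pos. }
    assert (Ha' : 0 < Kabs a) by lra.
    apply Rmult_le_reg_l with (/ Kabs a); [now apply Rinv_0_lt_compat|].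
    replace (/ Kabs a * (Kabs a * norm (l1 c Tr) x)) with (norm (l1 c Tr) x) by (field; lra).
    apply l1_norm_le. intros F HF. apply Rmult_le_reg_l with (Kabs a); [exact Ha'|].
    rewrite <- Hsum, <- Rmult_assoc, Rinv_r, Rmult_1_l by lra.
    apply (l1_sum_le _ F Hax HF). }
split.
{ intros x y Hx Hy. apply l1_norm_le. intros F HF. now apply l1_add_sum. }
intros u Hu HC.
assert (Hsub : forall k l, mem (l1 c Tr) (add (l1 c Tr) (u k) (opp (l1 c Tr) (u l)))).
{ intros k l. apply l1_mem with (norm (l1 c Tr) (u k) + norm (l1 c Tr) (opp (l1 c Tr) (u l))).
  intros F HF. apply l1_add_sum; auto. now apply l1_opp_mem. }
destruct (choice_fun (fun t L => forall eps, 0 < eps -> exists N, forall n, (N <= n)%nat ->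
  Kabs (Ksub (u n t) L) < eps)) as [f Hf].
{ intros t. apply K_seq_complete. intros e He. destruct (HC e He) as [N HN].
  exists N. intros k l Hk Hl. eapply Rle_lt_trans; [|apply (HN k l Hk Hl)].
  apply (l1_norm_pt _ t (Hsub k l)). }
(* On a finite set the pointwise limit is approached in the l1 sense arbitrarily late, which carries
   the Cauchy estimate over to the limit. *)
assert (Hfin : forall (F : list (node Tr)) e N, 0 < e ->
  exists k, (N <= k)%nat /\ rsum F (fun t => Kabs (Ksub (u k t) (f t))) <= e).
{ assert (Hfin' : forall (F : list (node Tr)) e, 0 < e ->
    exists N, forall k, (N <= k)%nat -> rsum F (fun t => Kabs (Ksub (u k t) (f t))) <= e).
  { induction F as [|t F IH]; intros e He; [exists 0%nat; intros; simpl; lra|].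
    destruct (IH (e/2) ltac:(lra)) as [N1 H1], (Hf t (e/2) ltac:(lra)) as [N2 H2].
    exists (N1 + N2)%nat. intros k Hk. simpl.
    specialize (H1 k ltac:(lia)). specialize (H2 k ltac:(lia)). lra. }
  intros F e N He. destruct (Hfin' F e He) as [N' HN']. exists (N + N')%nat.
  split; [lia|]. apply HN'. lia. }
assert (Hdist : forall e, 0 < e -> exists N, forall n, (N <= n)%nat -> forall F, NoDup F ->
   rsum F (fun t => Kabs (Ksub (u n t) (f t))) <= e).
{ intros e He. destruct (HC e He) as [N HN]. exists N. intros n Hn F HF.
  apply le_epsilon. intros e' He'. destruct (Hfin F e' N He') as (k & Hk & Hk').
  apply Rle_trans with (rsum F (fun t => Kabs (Ksub (u n t) (u k t)) + Kabs (Ksub (u k t) (f t)))).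
  { apply rsum_le. intros; apply Kabs_sub_tri. }
  rewrite rsum_add. apply Rplus_le_compat; [|exact Hk'].
  left. eapply Rle_lt_trans; [|apply (HN n k Hn Hk)].
  apply (l1_sum_le _ F (Hsub n k) HF). }
exists f. split.
- destruct (Hdist 1 ltac:(lra)) as [N HN]. specialize (HN N (le_n N)).
  apply l1_mem with (1 + norm (l1 c Tr) (u N)). intros F HF.
  apply Rle_trans with (rsum F (fun t => Kabs (Ksub (u N t) (f t)) + Kabs (u N t))).
  { apply rsum_le. intros t _. rewrite Kabs_sub_sym. apply Kabs_le_sub. }
  rewrite rsum_add. apply Rplus_le_compat; [now apply HN|now apply l1_sum_le].
- intros e He. destruct (Hdist (e/2) ltac:(lra)) as [N HN]. exists N. intros n Hn.
  apply Rle_lt_trans with (e/2); [|lra]. apply l1_norm_le. intros F HF. now apply HN.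
Qed.

Lemma ext_node w (t : node Tr) : ext w (proj1_sig t) = w t.
Proof.
unfold ext. destruct t as [s H]. simpl. destruct (excluded_middle_informative (Tr s)) as [H'|H'].
- do 2 f_equal. apply proof_irrelevance.
- contradiction.
Qed.

Lemma ext_out w s : ~ Tr s -> ext w s = K0 c.
Proof. intros H. unfold ext. destruct (excluded_middle_informative (Tr s)); tauto. Qed.

Lemma l1_ext_nodes w (F : list (list nat)) : NoDup F ->
  exists F' : list (node Tr), NoDup F' /\ (forall t, In t F' -> In (proj1_sig t) F) /\
    rsum F (fun s => Kabs (ext w s)) = rsum F' (fun t => Kabs (w t)).
Proof.
induction F as [|s F IH]; intros HF.
- exists []. split; [constructor|]. split; [intros t []|reflexivity].
- inversion_clear HF as [|? ? Hs HF']. destruct (IH HF') as (F' & H1 & H2 & H3).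
  destruct (classic (Tr s)) as [Hd|Hd].
  + exists (exist _ s Hd :: F'). split; [|split].
    * constructor; [|exact H1]. intros H. apply Hs. apply (H2 _ H).
    * intros t [<-|Ht]; [now left|right; auto].
    * simpl. rewrite H3. f_equal. f_equal. apply (ext_node w (exist _ s Hd)).
  + exists F'. split; [exact H1|]. split; [intros t Ht; right; auto|].
    simpl. rewrite ext_out, Kabs_0, H3 by exact Hd. ring.
Qed.

Lemma l1_ext_sum_le w (F : list (list nat)) : mem (l1 c Tr) w -> NoDup F ->
  rsum F (fun s => Kabs (ext w s)) <= norm (l1 c Tr) w.
Proof.
intros Hw HF. destruct (l1_ext_nodes w F HF) as (F' & H1 & _ & ->). now apply l1_sum_le.
Qed.

Lemma NoDup_nodes (F : list (node Tr)) : NoDup F -> NoDup (map (fun t : node Tr => proj1_sig t) F).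
Proof.
intros HF. apply NoDup_map_NoDup_ForallPairs; [|exact HF].
intros [s Hs] [t Ht] _ _ H. simpl in H. subst t. f_equal. apply proof_irrelevance.
Qed.

(** Some finite set attains the norm up to [eps]; a set disjoint from it cannot carry more than
    [eps]. *)
Lemma l1_tail w eps : mem (l1 c Tr) w -> 0 < eps ->
  exists N, forall F : list (list nat), NoDup F -> (forall s, In s F -> (N <= code s)%nat) ->
    rsum F (fun s => Kabs (ext w s)) <= eps.
Proof.
intros Hw He.
assert (exists F0 : list (node Tr), NoDup F0 /\
  norm (l1 c Tr) w - eps <= rsum F0 (fun t => Kabs (w t))) as (F0 & HF0 & Hsum).
{ apply NNPP. intros Hn. assert (norm (l1 c Tr) w <= norm (l1 c Tr) w - eps); [|lra].
  apply l1_norm_le. intros F HF. apply Rnot_lt_le. intros H. apply Hn. exists F.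
  split; [exact HF|lra]. }
set (L := map (fun t : node Tr => proj1_sig t) F0).
assert (HL : NoDup L) by now apply NoDup_nodes.
assert (HsumL : rsum L (fun s => Kabs (ext w s)) = rsum F0 (fun t => Kabs (w t))).
{ unfold L. rewrite rsum_map. apply rsum_ext. intros t _. now rewrite ext_node. }
exists (S (list_max (map code L))). intros F HF Hcode.
assert (H : NoDup (L ++ F)).
{ apply NoDup_app; auto. intros s Hs HsF. specialize (Hcode s HsF).
  assert (A := proj1 (list_max_le (map code L) _) (le_n _)).
  rewrite Forall_forall in A. specialize (A (code s) (in_map code L s Hs)). lia. }
assert (A := l1_ext_sum_le w _ Hw H). rewrite rsum_app in A. lra.
Qed.

Lemma l1_separable : separable (l1 c Tr).
Proof.
(* The finitely supported vectors with values among the [Kq]: the list coded by [n] gives their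
   indices, and the default [O] gives the scalar zero. *)
right. exists (fun n t => Kq (nth (code (proj1_sig t)) (dec n) O)).
assert (Hfinsum : forall (g : list nat -> R) N (F : list (node Tr)), NoDup F ->
  (forall s, 0 <= g s) -> (forall s, (N <= code s)%nat -> g s = 0) ->
  rsum F (fun t => g (proj1_sig t)) <= rsum (seq 0 N) (fun i => g (dec i))).
{ intros g N F HF Hpos Hout.
  eapply Rle_trans; [right; symmetry; apply (rsum_map F (fun t : node Tr => proj1_sig t) g)|].
  rewrite <- (rsum_map (seq 0 N) dec g).
  enough (H : forall L, NoDup L -> rsum L g <= rsum (map dec (seq 0 N)) g)
    by (apply H, NoDup_nodes, HF).
  intros L HL.
  apply Rle_trans with (rsum (filter (fun s => Nat.ltb (code s) N) L) g).
  - clear HL. induction L as [|s L IH]; simpl; [lra|].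
    destruct (Nat.ltb_spec (code s) N); simpl; [lra|]. rewrite Hout by assumption. lra.
  - apply rsum_incl; [exact Hpos|now apply NoDup_filter|].
    intros s Hs. apply filter_In in Hs. destruct Hs as [_ Hs]. apply Nat.ltb_lt in Hs.
    apply in_map_iff. exists (code s). split; [apply dec_code|]. apply in_seq. lia. }
split.
- intros n. set (N := length (dec n)).
  set (g := fun s => Kabs (Kq (c := c) (nth (code s) (dec n) O))).
  apply l1_mem with (rsum (seq 0 N) (fun i => g (dec i))).
  intros F HF. apply (Hfinsum g N F HF).
  + intros s. apply Kabs_pos.
  + intros s Hs. unfold g. rewrite nth_overflow by exact Hs. apply Kabs_0.
- intros w Hw e He. destruct (l1_tail w (e/4) Hw ltac:(lra)) as [N HN].
  assert (HN1 : 0 < INR N + 1) by (assert (P := pos_INR N); lra).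
  destruct (choice_fun (fun i k => Kabs (Ksub (Kq k) (ext w (dec i))) < e / 4 / (INR N + 1)))
    as [q Hq].
  { intros i. apply Kq_dense. apply Rdiv_lt_0_compat; lra. }
  exists (code (map q (seq 0 N))). rewrite dec_code.
  set (l := map q (seq 0 N)).
  assert (Hl : forall i, (i < N)%nat -> nth i l O = q i).
  { intros i Hi. unfold l. rewrite nth_indep with (d' := q O)
      by (rewrite length_map, length_seq; exact Hi).
    rewrite map_nth, seq_nth by exact Hi. reflexivity. }
  apply Rle_lt_trans with (e/2); [|lra].
  apply l1_norm_le. intros F HF. simpl.
  set (g := fun s => if Nat.ltb (code s) N then e / 4 / (INR N + 1) else 0).
  set (L := filter (fun s => negb (Nat.ltb (code s) N)) (map (fun t : node Tr => proj1_sig t) F)).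
  apply Rle_trans with (rsum F (fun t => g (proj1_sig t)) + rsum L (fun s => Kabs (ext w s))).
  + unfold L. clear HF. induction F as [|t F IH]; simpl; [lra|].
    change (Kadd (Kq (nth (code (proj1_sig t)) l O)) (Kopp (w t)))
      with (Ksub (Kq (nth (code (proj1_sig t)) l O)) (w t)).
    unfold g at 1. destruct (Nat.ltb_spec (code (proj1_sig t)) N) as [H|H]; simpl.
    * rewrite Hl by exact H. assert (A := Hq (code (proj1_sig t))).
      rewrite dec_code, ext_node in A. lra.
    * rewrite nth_overflow by (unfold l; rewrite length_map, length_seq; exact H).
      rewrite ext_node. assert (A := Kabs_sub_le (Kq O) (w t)).
      change (@Kq c O) with (K0 c) in *. rewrite Kabs_0 in A. lra.
  + assert (A : rsum L (fun s => Kabs (ext w s)) <= e / 4).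
    { apply HN.
      - unfold L. now apply NoDup_filter, NoDup_nodes.
      - intros s Hs. apply filter_In in Hs. destruct Hs as [_ Hs].
        destruct (Nat.ltb_spec (code s) N); [discriminate|assumption]. }
    assert (B : rsum F (fun t => g (proj1_sig t)) <= e / 4).
    { eapply Rle_trans; [apply (Hfinsum g N F HF)|].
      - intros s. unfold g. destruct (Nat.ltb (code s) N); [|lra].
        left. apply Rdiv_lt_0_compat; lra.
      - intros s Hs. unfold g. destruct (Nat.ltb_spec (code s) N); [lia|reflexivity].
      - apply Rle_trans with (rsum (seq 0 N) (fun _ => e / 4 / (INR N + 1))).
        + apply rsum_le. intros i Hi. unfold g. destruct (Nat.ltb _ _); [lra|].
          left. apply Rdiv_lt_0_compat; lra.
        + rewrite rsum_const, length_seq.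
          replace (e/4) with ((INR N + 1) * (e / 4 / (INR N + 1))) at 2 by (field; lra).
          apply Rmult_le_compat_r; [left; apply Rdiv_lt_0_compat|]; lra. }
    lra.
Qed.

End L1.

(** * Operators out of l1 *)

Definition xlim {c} (X : NS c) (u : nat -> car X) (x : car X) : Prop :=
  forall eps, 0 < eps -> exists N, forall n, (N <= n)%nat -> dist X (u n) x < eps.

Section Limits.
Context {c : bool} {X : NS c} (HX : is_Banach X).
Add Ring KRing : (@Kring_theory c).
Hint Resolve mem_zero mem_add mem_opp mem_scal vsum_mem : core.
Implicit Types (u v : nat -> car X) (x y : car X).

Lemma add_add x y z w : mem X x -> mem X y -> mem X z -> mem X w ->
  add X (add X x y) (add X z w) = add X (add X x z) (add X y w).
Proof.
intros. rewrite <- !(add_assoc HX) by auto. f_equal.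
rewrite !(add_assoc HX) by auto. f_equal. now apply (add_comm HX).
Qed.

Lemma dist_add x y z w : mem X x -> mem X y -> mem X z -> mem X w ->
  dist X (add X x y) (add X z w) <= dist X x z + dist X y w.
Proof.
intros. unfold dist. rewrite (opp_scal HX (add X z w)), (scal_add HX) by auto.
rewrite <- !(opp_scal HX) by auto. rewrite add_add by auto. apply (norm_add HX); auto.
Qed.

Lemma dist_add_l x y : mem X x -> mem X y -> dist X (add X x y) x = norm X y.
Proof.
intros Hx Hy. unfold dist. f_equal. rewrite (add_comm HX x), <- (add_assoc HX) by auto.
rewrite (add_opp HX), (add_zero HX) by auto. reflexivity.
Qed.

Lemma dist_scal a x y : mem X x -> mem X y ->
  dist X (scal X a x) (scal X a y) = Kabs a * dist X x y.
Proof.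
intros Hx Hy. unfold dist. rewrite <- (norm_scal HX), (scal_add HX) by auto.
do 2 f_equal. rewrite !(opp_scal HX), !(scal_mul HX) by auto. f_equal. ring.
Qed.

Lemma xlim_unique u x y : (forall n, mem X (u n)) -> mem X x -> mem X y ->
  xlim X u x -> xlim X u y -> x = y.
Proof.
intros Hu Hx Hy H1 H2. apply (dist_eq0 HX); auto. apply Rle_antisym; [|apply (dist_pos HX); auto].
apply le_epsilon. intros e He.
destruct (H1 (e/2) ltac:(lra)) as [N1 A1], (H2 (e/2) ltac:(lra)) as [N2 A2].
specialize (A1 (N1 + N2)%nat ltac:(lia)). specialize (A2 (N1 + N2)%nat ltac:(lia)).
assert (T := dist_tri HX (u (N1 + N2)%nat) x y Hx Hy (Hu _)).
rewrite (dist_sym HX x (u (N1 + N2)%nat)) in T by auto. lra.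
Qed.

Lemma xlim_add u v x y : (forall n, mem X (u n)) -> (forall n, mem X (v n)) ->
  mem X x -> mem X y -> xlim X u x -> xlim X v y -> xlim X (fun n => add X (u n) (v n)) (add X x y).
Proof.
intros Hu Hv Hx Hy H1 H2 e He.
destruct (H1 (e/2) ltac:(lra)) as [N1 A1], (H2 (e/2) ltac:(lra)) as [N2 A2].
exists (N1 + N2)%nat. intros n Hn. specialize (A1 n ltac:(lia)). specialize (A2 n ltac:(lia)).
assert (T := dist_add (u n) (v n) x y (Hu n) (Hv n) Hx Hy). lra.
Qed.

Lemma xlim_scal a u x : (forall n, mem X (u n)) -> mem X x -> xlim X u x ->
  xlim X (fun n => scal X a (u n)) (scal X a x).
Proof.
intros Hu Hx H e He. assert (Ha := Kabs_pos a).
destruct (H (e / (Kabs a + 1)) ltac:(apply Rdiv_lt_0_compat; lra)) as [N HN].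
exists N. intros n Hn. specialize (HN n Hn). rewrite dist_scal by auto.
assert (P := dist_pos HX _ _ (Hu n) Hx).
apply Rle_lt_trans with ((Kabs a + 1) * dist X (u n) x); [nra|].
replace e with ((Kabs a + 1) * (e / (Kabs a + 1))) by (field; lra).
apply Rmult_lt_compat_l; lra.
Qed.

Lemma xlim_norm_le u x M : (forall n, mem X (u n)) -> mem X x -> xlim X u x ->
  (forall n, norm X (u n) <= M) -> norm X x <= M.
Proof.
intros Hu Hx H HM. apply le_epsilon. intros e He. destruct (H e He) as [N HN].
specialize (HN N (le_n N)). rewrite (dist_sym HX) in HN by auto.
assert (T := norm_le_dist HX x (u N) Hx (Hu N)). specialize (HM N). lra.
Qed.

Lemma xlim_fun M f u x : lfun X M f -> (forall n, mem X (u n)) -> mem X x -> xlim X u x ->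
  klim at_infinity (fun n => f (u n)) (f x).
Proof.
intros Hf Hu Hx H e He.
destruct (H (e / (Rabs M + 1))) as [N HN].
{ apply Rdiv_lt_0_compat; [exact He|]. assert (P := Rabs_pos M). lra. }
exists N. intros n Hn. specialize (HN n Hn).
assert (P := Rabs_pos M). assert (P' := dist_pos HX _ _ (Hu n) Hx).
eapply Rle_lt_trans; [now apply (fun_dist HX M)|].
apply Rle_lt_trans with ((Rabs M + 1) * dist X (u n) x).
- apply Rmult_le_compat_r; [exact P'|]. assert (Q := Rle_abs M). lra.
- replace e with ((Rabs M + 1) * (e / (Rabs M + 1))) by (field; lra).
  apply Rmult_lt_compat_l; lra.
Qed.

Lemma vsum_add_coef {A} (l : list A) a b (x : A -> car X) : (forall i, In i l -> mem X (x i)) ->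
  vsum X l (fun i => Kadd (a i) (b i)) x = add X (vsum X l a x) (vsum X l b x).
Proof.
induction l as [|i l IH]; simpl; intros H; [symmetry; apply (add_zero HX); auto|].
rewrite IH, (add_scal HX), add_add by auto. reflexivity.
Qed.

Lemma vsum_scal_coef {A} (l : list A) k a (x : A -> car X) : (forall i, In i l -> mem X (x i)) ->
  vsum X l (fun i => Kmul k (a i)) x = scal X k (vsum X l a x).
Proof.
induction l as [|i l IH]; simpl; intros H.
- rewrite <- (scal_0 HX (zero X)), (scal_mul HX) by auto. f_equal. ring.
- rewrite IH, (scal_add HX), (scal_mul HX) by auto. reflexivity.
Qed.

End Limits.

(** The finite subsets of [A] directed by inclusion: [tsum] unfolds to the limit along this
    filter. *)
Definition sum_filter (A : list nat -> Prop) (P : list (list nat) -> Prop) : Prop :=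
  exists F0, (forall s, In s F0 -> A s) /\
    forall F, NoDup F -> incl F0 F -> (forall s, In s F -> A s) -> P F.

Lemma sum_filter_proper A : proper_filter (sum_filter A).
Proof.
split.
- exists []. split; [intros s []|auto].
- intros P Q H (F0 & H1 & H2). exists F0. auto.
- intros P Q (F0 & H1 & H2) (F1 & H3 & H4). exists (F0 ++ F1). split.
  + intros s Hs. apply in_app_iff in Hs. destruct Hs; auto.
  + intros F HF Hi HA. apply incl_app_inv in Hi. destruct Hi. split; auto.
- intros (F0 & H1 & H2). apply (H2 (nodup (list_eq_dec Nat.eq_dec) F0)).
  + apply NoDup_nodup.
  + intros s Hs. now apply nodup_In.
  + intros s Hs. apply nodup_In in Hs. auto.
Qed.

Section TreeSums.
Context {c : bool} {Tr : list nat -> Prop}.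
Add Ring KRing : (@Kring_theory c).
Notation l1T := (l1 c Tr).
Implicit Types (w : node Tr -> K c) (A : list nat -> Prop).

Definition coef w (i : nat) : K c := ext w (dec i).

Lemma ext_add w w' s : ext (add l1T w w') s = Kadd (ext w s) (ext w' s).
Proof. unfold ext. destruct (excluded_middle_informative (Tr s)); simpl; ring. Qed.

Lemma ext_scal a w s : ext (scal l1T a w) s = Kmul a (ext w s).
Proof. unfold ext. destruct (excluded_middle_informative (Tr s)); simpl; ring. Qed.

Lemma NoDup_map_dec m k : NoDup (map dec (seq m k)).
Proof.
apply NoDup_map_NoDup_ForallPairs; [|apply seq_NoDup]. intros i j _ _ H. now apply dec_inj.
Qed.

Lemma coef_sum_le w m k : mem l1T w -> rsum (seq m k) (fun i => Kabs (coef w i)) <= norm l1T w.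
Proof.
intros Hw. unfold coef. rewrite <- (rsum_map (seq m k) dec (fun s => Kabs (ext w s))).
apply l1_ext_sum_le; [exact Hw|apply NoDup_map_dec].
Qed.

Lemma coef_tail w eps : mem l1T w -> 0 < eps ->
  exists N, forall m k, (N <= m)%nat -> rsum (seq m k) (fun i => Kabs (coef w i)) <= eps.
Proof.
intros Hw He. destruct (l1_tail w eps Hw He) as [N HN]. exists N. intros m k Hm.
unfold coef. rewrite <- (rsum_map (seq m k) dec (fun s => Kabs (ext w s))).
apply HN; [apply NoDup_map_dec|]. intros s Hs. apply in_map_iff in Hs.
destruct Hs as (i & <- & Hi). apply in_seq in Hi. rewrite code_dec. lia.
Qed.

Definition psum w A (n : nat) : K c :=
  ksum (seq 0 n) (fun i => Kmul (coef w i) (ind (A (dec i)))).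

Lemma Kabs_mul_ind (a : K c) (P : Prop) : Kabs (Kmul a (ind P)) <= Kabs a.
Proof.
rewrite Kabs_mul. assert (H := Kabs_pos a). assert (H1 := @Kabs_ind c P).
assert (Kabs a * Kabs (@ind c P) <= Kabs a * 1) by now apply Rmult_le_compat_l. lra.
Qed.

Lemma psum_le w A n : mem l1T w -> Kabs (psum w A n) <= norm l1T w.
Proof.
intros Hw. unfold psum. eapply Rle_trans; [apply Kabs_ksum|].
eapply Rle_trans; [|apply (coef_sum_le w 0 n Hw)].
apply rsum_le. intros; apply Kabs_mul_ind.
Qed.

Lemma ksum_filter {B} (l : list B) (p : B -> bool) (f : B -> K c) :
  ksum (filter p l) f = ksum l (fun a => if p a then f a else K0 c).
Proof.
induction l as [|a l IH]; simpl; [reflexivity|].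
destruct (p a); simpl; rewrite IH; [reflexivity|ring].
Qed.

Lemma ksum_partition {B} (l : list B) (p : B -> bool) (f : B -> K c) :
  ksum l f = Kadd (ksum (filter p l) f) (ksum (filter (fun a => negb (p a)) l) f).
Proof.
induction l as [|a l IH]; simpl; [ring|]. destruct (p a); simpl; rewrite IH; ring.
Qed.

(** Reduces the unconditional sum to partial sums in the order of codes. A finite set containing all
    members of [A] with code below [N] splits into exactly these and a rest controlled by
    [l1_tail]. *)
Lemma tsum_klim w A : mem l1T w -> klim at_infinity (psum w A) (tsum A (ext w)).
Proof.
intros Hw. destruct (klim_exists at_infinity_proper (psum w A)) as [L HL].
{ intros e He. destruct (coef_tail w e Hw He) as [N HN]. exists (psum w A N), N.
  intros n Hn. unfold psum. replace n with (N + (n - N))%nat at 1 by lia.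
  rewrite seq_app, ksum_app.
  match goal with |- Kabs (Ksub (Kadd ?x ?y) ?x) <= _ =>
    replace (Ksub (Kadd x y) x) with y by ring end.
  eapply Rle_trans; [apply Kabs_ksum|]. eapply Rle_trans; [|apply (HN N (n - N)%nat (le_n N))].
  apply rsum_le. intros; apply Kabs_mul_ind. }
replace (tsum A (ext w)) with L; [exact HL|]. symmetry.
apply (klimval_eq (sum_filter_proper A) (fun F => fsum F (ext w))).
intros e He. destruct (HL (e/2) ltac:(lra)) as [N1 H1].
destruct (l1_tail w (e/4) Hw ltac:(lra)) as [N2 H2].
set (N := (N1 + N2)%nat).
set (pA := fun s => if excluded_middle_informative (A s) then true else false).
exists (filter pA (map dec (seq 0 N))). split.
- intros s Hs. apply filter_In in Hs. destruct Hs as [_ Hs]. unfold pA in Hs.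
  destruct (excluded_middle_informative (A s)); [assumption|discriminate].
- intros F HF Hincl HA. change (fsum F (ext w)) with (ksum F (ext w)).
  rewrite (ksum_partition F (fun s => Nat.ltb (code s) N)).
  assert (E : ksum (filter (fun s => Nat.ltb (code s) N) F) (ext w) = psum w A N).
  { rewrite (ksum_perm _ (filter pA (map dec (seq 0 N)))).
    - rewrite ksum_filter, ksum_map. unfold psum. apply ksum_ext. intros i _.
      unfold pA, ind, coef. destruct (excluded_middle_informative (A (dec i))); ring.
    - apply NoDup_Permutation; [now apply NoDup_filter|apply NoDup_filter, NoDup_map_dec|].
      intros s. rewrite filter_In, Nat.ltb_lt. split.
      + intros [Hs Hc]. apply filter_In. split.
        * apply in_map_iff. exists (code s). split; [apply dec_code|apply in_seq; lia].
        * unfold pA. destruct (excluded_middle_informative (A s)) as [|n]; [reflexivity|].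
          exfalso. auto.
      + intros Hs. split; [now apply Hincl|]. apply filter_In in Hs. destruct Hs as [Hs _].
        apply in_map_iff in Hs. destruct Hs as (i & <- & Hi). apply in_seq in Hi.
        rewrite code_dec. lia. }
  rewrite E. set (R := filter (fun s => negb (Nat.ltb (code s) N)) F).
  assert (HR : Kabs (ksum R (ext w)) <= e / 4).
  { eapply Rle_trans; [apply Kabs_ksum|]. apply H2; [now apply NoDup_filter|].
    intros s Hs. apply filter_In in Hs. destruct Hs as [_ Hs].
    destruct (Nat.ltb_spec (code s) N); [discriminate|unfold N in *; lia]. }
  specialize (H1 N ltac:(unfold N; lia)).
  replace (Ksub _ L) with (Kadd (ksum R (ext w)) (Ksub (psum w A N) L)) by ring.
  eapply Rle_lt_trans; [apply Kabs_add|]. lra.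
Qed.

Lemma tsum_lfun A : lfun l1T 1 (fun w => tsum A (ext w)).
Proof.
assert (HB := @l1_Banach c Tr). split; [|split].
- intros w w' Hw Hw'.
  apply (klim_unique at_infinity_proper (psum (add l1T w w') A)).
  + apply tsum_klim. now apply (mem_add HB).
  + apply (klim_eventually at_infinity_proper (fun n => Kadd (psum w A n) (psum w' A n))).
    * apply (pf_all at_infinity_proper). intros n. unfold psum. rewrite <- ksum_add.
      apply ksum_ext. intros i _. unfold coef. rewrite ext_add. ring.
    * apply (klim_add at_infinity_proper); now apply tsum_klim.
- intros a w Hw.
  apply (klim_unique at_infinity_proper (psum (scal l1T a w) A)).
  + apply tsum_klim. now apply (mem_scal HB).
  + apply (klim_eventually at_infinity_proper (fun n => Kmul a (psum w A n))).
    * apply (pf_all at_infinity_proper). intros n. unfold psum. rewrite <- ksum_scal.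
      apply ksum_ext. intros i _. unfold coef. rewrite ext_scal. ring.
    * apply (klim_scal at_infinity_proper); now apply tsum_klim.
- intros w Hw. rewrite Rmult_1_l.
  apply (klim_abs_le at_infinity_proper) with (1 := tsum_klim w A Hw).
  apply (pf_all at_infinity_proper). intros n. now apply psum_le.
Qed.

(** Only a small tail of [w] sees nodes with code at least [N]. Applied to the sets [leq' s u], this
    is the continuity of [sigmaT w]. *)
Lemma tsum_agree w eps : mem l1T w -> 0 < eps -> exists N, forall A A',
  (forall i, (i < N)%nat -> (A (dec i) <-> A' (dec i))) ->
  Kabs (Ksub (tsum A (ext w)) (tsum A' (ext w))) <= eps.
Proof.
intros Hw He. destruct (coef_tail w (eps/2) Hw ltac:(lra)) as [N HN]. exists N.
intros A A' HA.
assert (H := klim_add at_infinity_proper _ _ _ _ (tsum_klim w A Hw)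
  (klim_scal at_infinity_proper (Kopp (K1 c)) _ _ (tsum_klim w A' Hw))).
replace (Ksub _ _) with (Kadd (tsum A (ext w)) (Kmul (Kopp (K1 c)) (tsum A' (ext w)))) by ring.
apply (klim_abs_le at_infinity_proper) with (1 := H).
exists N. intros n Hn. unfold psum.
replace n with (N + (n - N))%nat by lia. rewrite seq_app, !ksum_app.
rewrite (ksum_ext (seq 0 N) (fun i => Kmul (coef w i) (ind (A' (dec i))))
  (fun i => Kmul (coef w i) (ind (A (dec i))))).
2:{ intros i Hi. apply in_seq in Hi. f_equal. apply ind_ext. symmetry. apply HA. lia. }
match goal with |- Kabs (Kadd (Kadd ?x ?y) (Kmul _ (Kadd ?x ?z))) <= _ =>
  replace (Kadd (Kadd x y) (Kmul (Kopp (K1 c)) (Kadd x z))) with (Ksub y z) by ring end.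
eapply Rle_trans; [apply Kabs_sub_le|].
assert (B := HN N (n - N)%nat (le_n N)).
apply Rle_trans with (eps/2 + eps/2); [|lra].
apply Rplus_le_compat; (eapply Rle_trans; [apply Kabs_ksum|]);
  (eapply Rle_trans; [|exact B]); apply rsum_le; intros; apply Kabs_mul_ind.
Qed.

Lemma SigmaT_bounded : bounded_op l1T (linf c Tr) (SigmaT c Tr).
Proof.
assert (L := fun t : node Tr => tsum_lfun (fun s => prefix s (proj1_sig t))).
split; [|split; [|split]].
- intros w Hw. exists (norm l1T w). intros t. rewrite <- (Rmult_1_l (norm l1T w)).
  now apply (L t).
- intros w w' Hw Hw'. apply functional_extensionality. intros t. now apply (L t).
- intros a w Hw. apply functional_extensionality. intros t. now apply (L t).
- exists 1. intros w Hw. apply (@sup_norm_le c (node Tr)).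
  + rewrite Rmult_1_l. now apply l1_norm_pos.
  + intros t. now apply (L t).
Qed.

Lemma sigmaT_eq w (u : Tbar Tr) : sigmaT c Tr w u = tsum (fun s => leq' s u) (ext w).
Proof. destruct u; reflexivity. Qed.

Lemma sigmaT_bounded (HTr : downward_closed Tr) : bounded_op l1T (Cspace c Tr) (sigmaT c Tr).
Proof.
assert (L := fun u : Tbar Tr => tsum_lfun (fun s => leq' s u)).
split; [|split; [|split]].
- intros w Hw. split.
  + apply (cw_continuous_of_agree HTr). intros e He. destruct (tsum_agree w e Hw He) as [N HN].
    exists N. intros u v Huv. rewrite !sigmaT_eq. now apply HN.
  + exists (norm l1T w). intros u. rewrite <- (Rmult_1_l (norm l1T w)), sigmaT_eq.
    now apply (L u).
- intros w w' Hw Hw'. apply functional_extensionality. intros u. simpl add.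
  rewrite !sigmaT_eq. now apply (L u).
- intros a w Hw. apply functional_extensionality. intros u. simpl scal.
  rewrite !sigmaT_eq. now apply (L u).
- exists 1. intros w Hw. apply (@sup_norm_le c (Tbar Tr)).
  + rewrite Rmult_1_l. now apply l1_norm_pos.
  + intros u. rewrite sigmaT_eq. now apply (L u).
Qed.

Section Synthesis.
Context {X : NS c} (HX : is_Banach X) (xs : nat -> car X) (C : R) (HC : 0 <= C)
  (Hxs : forall n, mem X (xs n)) (HxC : forall n, norm X (xs n) <= C).

Definition partial w (n : nat) : car X := vsum X (seq 0 n) (coef w) xs.

(** The operator sending the unit vector at [dec n] to [xs n]. Coefficients at lists outside [Tr]
    are zero, so a system indexed by all of Omega serves every tree. *)
Definition synthesis w : car X :=
  epsilon (inhabits (zero X)) (fun x => mem X x /\ xlim X (partial w) x).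

Lemma partial_mem w n : mem X (partial w n).
Proof. apply (vsum_mem HX). auto. Qed.

Lemma segment_norm w m k :
  norm X (vsum X (seq m k) (coef w) xs) <= C * rsum (seq m k) (fun i => Kabs (coef w i)).
Proof.
eapply Rle_trans; [apply (vsum_norm HX); auto|]. rewrite <- rsum_scal.
apply rsum_le. intros i _. rewrite Rmult_comm. apply Rmult_le_compat_r; [apply Kabs_pos|apply HxC].
Qed.

Lemma synthesis_spec w : mem l1T w -> mem X (synthesis w) /\ xlim X (partial w) (synthesis w).
Proof.
intros Hw. unfold synthesis. apply epsilon_spec. apply (complete HX); [apply partial_mem|].
intros e He. destruct (coef_tail w (e / (2 * (C + 1))) Hw) as [N HN].
{ apply Rdiv_lt_0_compat; lra. }
assert (H : forall n, (N <= n)%nat -> dist X (partial w n) (partial w N) < e / 2).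
{ intros n Hn. unfold partial. replace n with (N + (n - N))%nat by lia.
  rewrite seq_app, (vsum_app HX) by auto.
  rewrite (dist_add_l HX) by (apply (vsum_mem HX); auto).
  eapply Rle_lt_trans; [apply segment_norm|].
  assert (B := HN N (n - N)%nat (le_n N)).
  assert (P : 0 < e / (2 * (C + 1))) by (apply Rdiv_lt_0_compat; lra).
  apply Rle_lt_trans with (C * (e / (2 * (C + 1)))); [now apply Rmult_le_compat_l|].
  apply Rlt_le_trans with ((C + 1) * (e / (2 * (C + 1)))); [|right; field; lra].
  apply Rmult_lt_compat_r; lra. }
exists N. intros m n Hm Hn.
eapply Rle_lt_trans; [apply (dist_tri HX (partial w N)); apply partial_mem|].
rewrite (dist_sym HX (partial w N) (partial w n)) by apply partial_mem.
assert (A := H m Hm). assert (B := H n Hn). lra.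
Qed.

Lemma synthesis_bounded : bounded_op l1T X synthesis.
Proof.
assert (HB := @l1_Banach c Tr). split; [|split; [|split]].
- intros w Hw. now apply synthesis_spec.
- intros w w' Hw Hw'.
  destruct (synthesis_spec w Hw) as [A1 A2], (synthesis_spec w' Hw') as [B1 B2].
  destruct (synthesis_spec (add l1T w w')) as [D1 D2]; [now apply (mem_add HB)|].
  apply (xlim_unique HX (partial (add l1T w w'))); auto using partial_mem.
  { now apply (mem_add HX). }
  replace (partial (add l1T w w')) with (fun n => add X (partial w n) (partial w' n)).
  + apply (xlim_add HX); auto using partial_mem.
  + apply functional_extensionality. intros n. unfold partial.
    rewrite <- (vsum_add_coef HX) by auto. f_equal. apply functional_extensionality. intros i.
    unfold coef. now rewrite ext_add.
- intros a w Hw. destruct (synthesis_spec w Hw) as [A1 A2].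
  destruct (synthesis_spec (scal l1T a w)) as [D1 D2]; [now apply (mem_scal HB)|].
  apply (xlim_unique HX (partial (scal l1T a w))); auto using partial_mem.
  { now apply (mem_scal HX). }
  replace (partial (scal l1T a w)) with (fun n => scal X a (partial w n)).
  + apply (xlim_scal HX); auto using partial_mem.
  + apply functional_extensionality. intros n. unfold partial.
    rewrite <- (vsum_scal_coef HX) by auto. f_equal. apply functional_extensionality. intros i.
    unfold coef. now rewrite ext_scal.
- exists C. intros w Hw. destruct (synthesis_spec w Hw) as [A1 A2].
  apply (xlim_norm_le HX (partial w)); auto using partial_mem.
  intros n. eapply Rle_trans; [apply segment_norm|].
  apply Rmult_le_compat_l; [exact HC|]. now apply coef_sum_le.
Qed.

Lemma synthesis_fun M f A w : lfun X M f -> (forall i, f (xs i) = ind (A (dec i))) ->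
  mem l1T w -> f (synthesis w) = tsum A (ext w).
Proof.
intros Hf HA Hw. destruct (synthesis_spec w Hw) as [H1 H2].
apply (klim_unique at_infinity_proper (psum w A)); [|now apply tsum_klim].
apply (klim_eventually at_infinity_proper (fun n => f (partial w n))).
- apply (pf_all at_infinity_proper). intros n. unfold partial, psum.
  rewrite (fun_vsum HX M) by auto. apply ksum_ext. intros i _. now rewrite HA.
- apply (xlim_fun HX M); auto using partial_mem.
Qed.

End Synthesis.
End TreeSums.

(** * Factorization *)

Section Factorization.
Context {c : bool} {X Y : NS c} {T : car X -> car Y}.
Context (HX : is_Banach X) (HY : is_Banach Y) (HT : bounded_op X Y T).
Context (Hns : ~ adj_range_sep X Y T (mem X)).
Context {d : nat -> car Y} (Hd : forall i, mem Y (d i)).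
Context {Tr : list nat -> Prop}.

Lemma coded_tree_system : (forall x, mem X x -> @approximable c Y d (T x)) ->
  exists (phi : nat -> car Y -> K c) (xs : nat -> car X) (M C : R), 0 <= M /\ 0 <= C /\
    (forall n, lfun Y M (phi n)) /\ (forall n, mem X (xs n)) /\ (forall n, norm X (xs n) <= C) /\
    (forall n m, phi n (T (xs m)) = ind (prefix (dec m) (dec n))) /\
    (forall i n, (i < n)%nat -> Kabs (Ksub (phi n (d i)) (phi (par n) (d i))) <= (1/2)^n).
Proof.
intros Happ.
destruct (tree_system HX HY HT Hd par_lt Hns Happ)
  as (phi & xs & M & C & HM & HC & H1 & H2 & H3 & H4 & H5 & H6).
exists phi, xs, M, C. do 3 (split; [assumption|]).
split; [intros n; apply H2|]. split; [intros n; apply H2|]. split; [|exact H6].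
apply (tree_system_eval (fun n m => phi n (T (xs m)))); assumption.
Qed.

Lemma lfun_op M f : 0 <= M -> lfun Y M f -> exists M', lfun X M' (fun x => f (T x)).
Proof.
intros HM Hf. destruct (bounded_op_bound X Y T HX HT) as (MT & HMT & HMT').
exists (M * MT). now apply (lfun_comp X Y).
Qed.

Lemma SigmaT_factors : (forall x, mem X x -> @approximable c Y d (T x)) ->
  factors (SigmaT c Tr) T.
Proof.
intros Happ.
destruct (coded_tree_system Happ) as (phi & xs & M & C & HM & HC & H1 & H2 & H3 & H4 & H5).
exists (synthesis xs), (fun y t => phi (code (proj1_sig t)) y).
split; [now apply (synthesis_bounded HX xs C)|]. split.
- split; [|split; [|split]].
  + intros y Hy. exists (M * norm Y y). intros t. now apply H1.
  + intros x y Hx Hy. apply functional_extensionality. intros t. now apply H1.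
  + intros a y Hy. apply functional_extensionality. intros t. now apply H1.
  + exists M. intros y Hy. apply (@sup_norm_le c (node Tr)).
    * apply Rmult_le_pos; [exact HM|now apply (norm_pos HY)].
    * intros t. now apply H1.
- intros w Hw. apply functional_extensionality. intros t.
  destruct (lfun_op M (phi (code (proj1_sig t))) HM (H1 _)) as [M' HM'].
  apply (synthesis_fun HX xs C HC H2 H3 M' (fun x => phi (code (proj1_sig t)) (T x))); auto.
  intros i. rewrite H4, dec_code. reflexivity.
Qed.

Lemma extend_lfun (HTr : downward_closed Tr) M (phi : nat -> car Y -> K c) (u : Tbar Tr) :
  (forall n, lfun Y M (phi n)) ->
  (forall y, mem Y y -> oscillation_vanishes (fun n => phi n y)) ->
  lfun Y M (fun y => extend (fun n => phi n y) u).
Proof.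
intros Hphi Hosc. destruct u as [t|B]; [apply (Hphi (code (proj1_sig t)))|].
assert (HF := branch_filter_proper _ (proj2_sig B)).
assert (L := fun y (Hy : mem Y y) => extend_lim HTr _ (Hosc y Hy) B).
split; [|split].
- intros x y Hx Hy. apply (klim_unique HF) with (1 := L _ (mem_add HY _ _ Hx Hy)).
  apply (klim_eventually HF) with (2 := klim_add HF _ _ _ _ (L x Hx) (L y Hy)).
  apply (pf_all HF). intros s. symmetry. now apply Hphi.
- intros a x Hx. apply (klim_unique HF) with (1 := L _ (mem_scal HY a _ Hx)).
  apply (klim_eventually HF) with (2 := klim_scal HF a _ _ (L x Hx)).
  apply (pf_all HF). intros s. symmetry. now apply Hphi.
- intros x Hx. apply (klim_abs_le HF) with (1 := L x Hx).
  apply (pf_all HF). intros s. now apply Hphi.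
Qed.

(** Along a branch, whether [dec m] is an initial segment is eventually constant, and its eventual
    truth value is membership in the branch. *)
Lemma extend_ind (HTr : downward_closed Tr) (m : nat) (u : Tbar Tr) :
  extend (fun n => @ind c (prefix (dec m) (dec n))) u = ind (leq' (dec m) u).
Proof.
destruct u as [t|B]; simpl; [now rewrite dec_code|].
assert (HF := branch_filter_proper _ (proj2_sig B)).
apply (klimval_eq HF).
apply (klim_eventually HF) with (2 := klim_const HF (ind (proj1_sig B (dec m)))).
apply (pf_mono _ HF) with (2 := branch_filter_member HTr _ (dec m) (proj2_sig B)).
intros s Hs. rewrite dec_code. now apply ind_ext.
Qed.

Lemma sigmaT_factors : downward_closed Tr -> (forall y, mem Y y -> @approximable c Y d y) ->
  factors (sigmaT c Tr) T.
Proof.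
intros HTr Happ.
assert (HTm : forall x, mem X x -> mem Y (T x)) by apply HT.
destruct (coded_tree_system) as (phi & xs & M & C & HM & HC & H1 & H2 & H3 & H4 & H5).
{ intros x Hx. auto. }
assert (Hosc : forall y, mem Y y -> oscillation_vanishes (fun n => phi n y)).
{ intros y Hy. apply (system_oscillation HY d M phi y); auto. }
assert (L := fun u : Tbar Tr => extend_lfun HTr M phi u H1 Hosc).
exists (synthesis xs), (fun y u => extend (fun n => phi n y) u).
split; [now apply (synthesis_bounded HX xs C)|]. split.
- split; [|split; [|split]].
  + intros y Hy. split; [now apply (extend_continuous HTr), Hosc|].
    exists (M * norm Y y). intros u. now apply L.
  + intros x y Hx Hy. apply functional_extensionality. intros u. now apply (L u).
  + intros a y Hy. apply functional_extensionality. intros u. now apply (L u).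
  + exists M. intros y Hy. apply (@sup_norm_le c (Tbar Tr)).
    * apply Rmult_le_pos; [exact HM|now apply (norm_pos HY)].
    * intros u. now apply (L u).
- intros w Hw. apply functional_extensionality. intros u. rewrite sigmaT_eq.
  destruct (lfun_op M (fun y => extend (fun n => phi n y) u) HM (L u)) as [M' HM'].
  apply (synthesis_fun HX xs C HC H2 H3 M' (fun x => extend (fun n => phi n (T x)) u)
    (fun s => leq' s u)); auto.
  intros i. rewrite <- (extend_ind HTr). f_equal. apply functional_extensionality.
  intros n. apply H4.
Qed.

End Factorization.

Lemma separable_seq {c} (X : NS c) (A : car X -> Prop) : separable_set X A -> (exists x, A x) ->
  exists s : nat -> car X, (forall n, A (s n)) /\
    forall x, A x -> forall eps, 0 < eps -> exists n, dist X (s n) x < eps.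
Proof. intros [H|H] [x Hx]; [exfalso; now apply (H x)|exact H]. Qed.

Lemma SigmaT_factors_sep_domain {c} (X Y : NS c) (T : car X -> car Y) Tr :
  is_Banach X -> is_Banach Y -> bounded_op X Y T -> ~ adj_range_sep X Y T (mem X) ->
  separable X -> factors (SigmaT c Tr) T.
Proof.
intros HX HY HT Hns Hsep.
destruct (separable_seq X (mem X) Hsep (ex_intro _ _ (mem_zero HX))) as (s & Hs & Hdense).
assert (HTm : forall x, mem X x -> mem Y (T x)) by apply HT.
(* The images of a dense sequence of [X] approximate [T x] for every [x], although they may be far
   from dense in [Y]. *)
apply (SigmaT_factors HX HY HT Hns (d := fun i => T (s i))); [auto|].
intros x Hx. split; [auto|]. intros e He.
destruct (bounded_op_bound X Y T HX HT) as (M & HM & HM').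
destruct (Hdense x Hx (e / (M + 1))) as [i Hi]; [apply Rdiv_lt_0_compat; lra|].
exists i. eapply Rle_lt_trans; [apply (op_dist X Y T M); auto|].
assert (P := dist_pos HX _ _ (Hs i) Hx).
apply Rle_lt_trans with ((M + 1) * dist X (s i) x); [nra|].
replace e with ((M + 1) * (e / (M + 1))) by (field; lra). apply Rmult_lt_compat_l; lra.
Qed.

Lemma factors_sep_codomain {c} (X Y : NS c) (T : car X -> car Y) Tr :
  is_Banach X -> is_Banach Y -> bounded_op X Y T -> ~ adj_range_sep X Y T (mem X) ->
  downward_closed Tr -> separable Y -> factors (sigmaT c Tr) T /\ factors (SigmaT c Tr) T.
Proof.
intros HX HY HT Hns HTr Hsep.
destruct (separable_seq Y (mem Y) Hsep (ex_intro _ _ (mem_zero HY))) as (s & Hs & Hdense).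
assert (Happ : forall y, mem Y y -> approximable (d := s) y) by (intros y Hy; split; auto).
split.
- now apply (sigmaT_factors HX HY HT Hns Hs).
- apply (SigmaT_factors HX HY HT Hns Hs). intros x Hx. apply Happ. now apply HT.
Qed.

(** Carrier and operations stay the same, so the restriction of [T] is [T] itself, and separability
    of its adjoint's range is [adj_range_sep X Y T Z] up to conversion. *)
Definition subspace {c} (X : NS c) (Z : car X -> Prop) : NS c := {|
  car := car X; mem := Z; zero := zero X; add := add X; opp := opp X;
  scal := scal X; norm := norm X |}.

Lemma subspace_Banach {c} (X : NS c) (Z : car X -> Prop) :
  is_Banach X -> closed_subspace X Z -> is_Banach (subspace X Z).
Proof.
intros HX (HZ & Z0 & Zadd & Zscal & Zlim). unfold is_Banach; simpl.
split; [exact Z0|]. split; [exact Zadd|].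
split; [intros x Hx; rewrite (opp_scal HX) by auto; auto|]. split; [exact Zscal|].
split; [intros; apply (add_assoc HX); auto|]. split; [intros; apply (add_comm HX); auto|].
split; [intros; apply (add_zero HX); auto|]. split; [intros; apply (add_opp HX); auto|].
split; [intros; apply (scal_mul HX); auto|]. split; [intros; apply (scal_1 HX); auto|].
split; [intros; apply (scal_add HX); auto|]. split; [intros; apply (add_scal HX); auto|].
split; [intros; apply (norm_pos HX); auto|]. split; [intros; apply (norm_eq0 HX); auto|].
split; [intros; apply (norm_scal HX); auto|]. split; [intros; apply (norm_add HX); auto|].
intros u Hu HC. destruct (complete HX u) as (x & Hx & Hlim); [auto|exact HC|].
exists x. split; [|exact Hlim]. now apply Zlim with u.
Qed.

Lemma SigmaT_factors_nonAsplund {c} (X Y : NS c) (T : car X -> car Y) Tr :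
  nonAsplund X Y T -> factors (SigmaT c Tr) T.
Proof.
intros (HX & HY & HT & Hna). apply not_all_ex_not in Hna. destruct Hna as [Z HZ].
apply imply_to_and in HZ. destruct HZ as [HZc HZ].
apply imply_to_and in HZ. destruct HZ as [HZs HZn].
assert (HZm : forall z, Z z -> mem X z) by apply HZc.
assert (HTZ : bounded_op (subspace X Z) Y T).
{ destruct HT as (B1 & B2 & B3 & M & B4). split; [|split; [|split]]; simpl; auto.
  exists M. auto. }
destruct (SigmaT_factors_sep_domain (subspace X Z) Y T Tr) as (U & V & HU & HV & HVTU);
  try assumption.
{ now apply subspace_Banach. }
exists U, V. split; [|split; assumption].
destruct HU as (B1 & B2 & B3 & B4). split; [intros w Hw; now apply HZm, B1|].
split; [exact B2|]. split; assumption.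
Qed.

(* Distinct branches are separated by the functionals [psi], so a countable norm-dense subset of
   the adjoint's range would enumerate the branches. *)
Lemma not_sep_of_branches {c} (X Y : NS c) (T : car X -> car Y) (Z : car X -> Prop)
  (S : list nat -> Prop) (psi : (list nat -> Prop) -> car Y -> K c) (r : R) :
  is_Banach X -> is_Banach Y -> bounded_op X Y T -> (forall z, Z z -> mem X z) -> 0 < r ->
  uncountable_boundary S -> (forall B, is_branch S B -> bounded_fun Y (psi B)) ->
  (forall B B' s, is_branch S B -> is_branch S B' -> B s -> ~ B' s ->
     exists z, Z z /\ norm X z <= 1 /\ r <= Kabs (Ksub (psi B (T z)) (psi B' (T z)))) ->
  ~ adj_range_sep X Y T Z.
Proof.
intros HX HY HT HZ Hr Hunc Hpsi Hsep (phi & Hphi & Hdense). apply Hunc.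
destruct (bounded_op_bound X Y T HX HT) as (MT & HMT & HMT').
assert (Hclose : forall B, is_branch S B -> exists n, forall z, Z z -> norm X z <= 1 ->
  Kabs (Ksub (phi n (T z)) (psi B (T z))) < r / 2).
{ intros B HB. destruct (Hdense (psi B) (Hpsi B HB) (r/2) ltac:(lra)) as [n Hn].
  exists n. intros z Hz Hz1. eapply Rle_lt_trans; [|exact Hn].
  destruct (bounded_fun_lfun HY _ (Hphi n)) as (M1 & HM1 & L1).
  destruct (bounded_fun_lfun HY _ (Hpsi B HB)) as (M2 & HM2 & L2).
  assert (L := lfun_comp X Y T MT _ _ HT HMT' (Rplus_le_le_0_compat _ _ HM1 HM2)
    (lfun_sub _ _ _ _ L1 L2)).
  assert (HM : 0 <= (M1 + M2) * MT) by (apply Rmult_le_pos; lra).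
  apply Rsup_ub with ((M1 + M2) * MT); [|right; exists z; auto].
  intros t [->|(z' & Hz' & Hz1' & ->)]; [exact HM|].
  eapply Rle_trans; [apply L; auto|]. rewrite <- (Rmult_1_r ((M1 + M2) * MT)) at 2.
  now apply Rmult_le_compat_l. }
(* Index [n] names some branch whose functional lies within [r / 2] of [phi n]. Two such branches
   would be closer than [r], hence coincide. *)
exists (fun n => epsilon (inhabits (fun _ => True)) (fun B => is_branch S B /\
  forall z, Z z -> norm X z <= 1 -> Kabs (Ksub (phi n (T z)) (psi B (T z))) < r / 2)).
intros B HB. destruct (Hclose B HB) as [n Hn]. exists n.
match goal with |- context [epsilon ?i ?Q] =>
  assert (HE : Q (epsilon i Q)) by (apply epsilon_spec; now exists B);
  set (B' := epsilon i Q) in * end.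
destruct HE as [HB' Hn'].
assert (Hno : forall A A' s, is_branch S A -> is_branch S A' ->
  (forall z, Z z -> norm X z <= 1 -> Kabs (Ksub (phi n (T z)) (psi A (T z))) < r / 2) ->
  (forall z, Z z -> norm X z <= 1 -> Kabs (Ksub (phi n (T z)) (psi A' (T z))) < r / 2) ->
  A s -> A' s).
{ intros A A' s HA HA' H1 H2 Hs. apply NNPP. intros Hs'.
  destruct (Hsep A A' s HA HA' Hs Hs') as (z & Hz & Hz1 & Hz2).
  specialize (H1 z Hz Hz1). specialize (H2 z Hz Hz1).
  assert (H3 := Kabs_sub_tri (phi n (T z)) (psi A (T z)) (psi A' (T z))).
  rewrite (Kabs_sub_sym (psi A (T z)) (phi n (T z))) in H3. lra. }
intros s. split; apply Hno; auto.
Qed.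

(** * Universality *)

Section Compactness.
Context {c : bool} {Tr : list nat -> Prop} (HTr : downward_closed Tr).
Implicit Types (u v : Tbar Tr) (f : Tbar Tr -> K c).

Lemma leq'_prefix s t u : leq' t u -> prefix s t -> leq' s u.
Proof.
destruct u as [r|B]; simpl; intros H Hst.
- now apply prefix_trans with t.
- now apply (branch_downward HTr _ (proj2_sig B)) with t.
Qed.

Lemma leq'_linear s t u : leq' s u -> leq' t u -> prefix s t \/ prefix t s.
Proof.
destruct u as [r|B]; simpl; intros Hs Ht.
- now apply prefix_linear with (proj1_sig r).
- now apply (proj2_sig B).
Qed.

Lemma leq'_nil u : leq' [] u.
Proof.
destruct u as [r|B]; simpl; [now exists (proj1_sig r)|].
destruct (infinite_chain_long _ (branch_infinite _ (proj2_sig B)) 0) as (s & Hs & _).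
apply (branch_downward HTr _ (proj2_sig B)) with s; [exact Hs|now exists s].
Qed.

(** The points of [Tbar] are the downward closed chains containing the root: a finite one is given
    by its member of largest code, which is its longest, and an infinite one is a branch. *)
Lemma Tbar_point (P : list nat -> Prop) : P [] -> (forall s, P s -> Tr s) ->
  chain P -> (forall s t, P t -> prefix s t -> P s) -> exists u, forall s, leq' s u <-> P s.
Proof.
intros H0 HP Hc Hd.
destruct (classic (exists l : list (list nat), forall s, P s -> In s l)) as [[l Hl]|Hinf].
- set (N := S (list_max (map code l))).
  assert (HN : forall s, P s -> (code s < N)%nat).
  { intros s Hs. apply Nat.lt_succ_r.
    assert (A := proj1 (list_max_le (map code l) _) (le_n _)).
    rewrite Forall_forall in A. apply A. apply in_map. auto. }
  destruct (largest_below_spec (fun i => P (dec i)) N (code [])) as (A & _ & _);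
    [auto|now rewrite dec_code|].
  set (t := dec (largest_below (fun i => P (dec i)) N)) in *.
  exists (inl (exist _ t (HP t A))). intros s. simpl. split; [now apply Hd|].
  intros Hs. destruct (Hc s t Hs A) as [H|H]; [exact H|].
  destruct (largest_below_spec (fun i => P (dec i)) N (code s)) as (_ & _ & Hle);
    [auto|now rewrite dec_code|].
  assert (Hge := prefix_code_le _ _ H). unfold t in Hge. rewrite code_dec in Hge.
  replace s with t; [apply prefix_refl|]. apply code_inj. unfold t. rewrite code_dec. lia.
- assert (HB : is_branch Tr P).
  { apply infinite_chain_branch; [exact HP|split; assumption|exact Hd]. }
  exists (inr (exist _ P HB)). intros s. simpl. tauto.
Qed.

Section Cells.
Context (f : Tbar Tr -> K c) (eps : R).

(** Failure on [A] of uniform continuity with respect to agreement. *)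
Definition oscillating (A : Tbar Tr -> Prop) : Prop :=
  forall N, exists u v, A u /\ A v /\ agree N u v /\ eps <= Kabs (Ksub (f u) (f v)).

(** Compactness by bisection: at step [n] the half above [dec n] is kept if [f] still oscillates
    there, and the other half otherwise. *)
Fixpoint cell (n : nat) : Tbar Tr -> Prop :=
  match n with
  | O => fun _ => True
  | S n => fun u => cell n u /\
      (leq' (dec n) u <-> oscillating (fun v => cell n v /\ leq' (dec n) v))
  end.

Lemma cell_oscillating : oscillating (fun _ => True) -> forall n, oscillating (cell n).
Proof.
intros H0. induction n as [|n IH]; [exact H0|].
destruct (classic (oscillating (fun v => cell n v /\ leq' (dec n) v))) as [Ho|Ho].
- intros N. destruct (Ho N) as (u & v & [Hu Hu'] & [Hv Hv'] & H). exists u, v.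
  split; [simpl; tauto|]. split; [simpl; tauto|exact H].
- intros N. apply NNPP. intros Hno. apply Ho. intros N'.
  (* Agreement beyond [n] puts both points in the same half, so one of the two halves must
     oscillate. *)
  destruct (IH (N + N' + S n)%nat) as (u & v & Hu & Hv & Hag & Hfar).
  assert (Hn := Hag n ltac:(lia)).
  assert (Hag1 : agree N u v) by (intros i Hi; apply Hag; lia).
  assert (Hag2 : agree N' u v) by (intros i Hi; apply Hag; lia).
  exists u, v. destruct (classic (leq' (dec n) u)) as [Hl|Hl]; [tauto|].
  exfalso. apply Hno. exists u, v. simpl. tauto.
Qed.

Lemma cell_le m n u : (m <= n)%nat -> cell n u -> cell m u.
Proof.
intros H. induction H as [|n H IH]; [auto|]. intros [Hu _]. auto.
Qed.

Lemma cell_leq' n u s : cell n u -> (code s < n)%nat ->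
  (leq' s u <-> oscillating (fun v => cell (code s) v /\ leq' s v)).
Proof.
intros Hu Hs. destruct (cell_le (S (code s)) n u Hs Hu) as [_ H].
now rewrite dec_code in H.
Qed.

End Cells.

(** Uniform continuity from compactness. If it failed, the nested oscillating cells would determine
    a set [P] of nodes; every point of a late cell agrees with [P] on small codes, so [P] is a point
    of [Tbar], and continuity there contradicts the oscillation on a late cell. *)
Lemma cw_continuous_agree f eps : cw_continuous f -> 0 < eps ->
  exists N, forall u v, agree N u v -> Kabs (Ksub (f u) (f v)) < eps.
Proof.
intros Hf He. apply NNPP. intros Hn.
assert (H0 : oscillating f eps (fun _ => True)).
{ intros N. apply NNPP. intros Hno. apply Hn. exists N. intros u v Huv.
  apply Rnot_le_lt. intros Hle. apply Hno. exists u, v. auto. }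
assert (Hcell := cell_oscillating f eps H0).
assert (Hne : forall n, exists u, cell f eps n u).
{ intros n. destruct (Hcell n 0%nat) as (u & _ & Hu & _). now exists u. }
set (P := fun s => oscillating f eps (fun v => cell f eps (code s) v /\ leq' s v)).
assert (HP : forall n u s, cell f eps n u -> (code s < n)%nat -> (leq' s u <-> P s))
  by (intros n u s; apply cell_leq').
destruct (Tbar_point P) as [x Hx].
- destruct (Hne (S (code []))) as [u Hu]. apply (HP _ u [] Hu); [lia|apply leq'_nil].
- intros s Hs. destruct (Hs 0%nat) as (u & _ & [_ Hu] & _). now apply (leq'_tree HTr) with u.
- intros s t Hs Ht. destruct (Hne (S (code s + code t))) as [u Hu].
  apply (HP _ u s Hu) in Hs; [|lia]. apply (HP _ u t Hu) in Ht; [|lia].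
  now apply leq'_linear with u.
- intros s t Ht Hst. destruct (Hne (S (code s + code t))) as [u Hu].
  apply (HP _ u s Hu); [lia|]. apply (HP _ u t Hu) in Ht; [|lia]. now apply leq'_prefix with t.
- destruct (Hf x (eps/2) ltac:(lra)) as (L & HL & Hclose).
  set (N := S (list_max (map (fun p : node Tr * bool => code (proj1_sig (fst p))) L))).
  assert (HN : forall u, cell f eps N u -> Kabs (Ksub (f u) (f x)) < eps / 2).
  { intros u Hu. apply Hclose. intros p Hp. specialize (HL p Hp).
    assert (Hlt : (code (proj1_sig (fst p)) < N)%nat).
    { apply Nat.lt_succ_r.
      assert (A := proj1
        (list_max_le (map (fun p : node Tr * bool => code (proj1_sig (fst p))) L) _) (le_n _)).
      rewrite Forall_forall in A. apply A.
      now apply (in_map (fun p : node Tr * bool => code (proj1_sig (fst p)))). }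
    assert (E := HP N u _ Hu Hlt). rewrite <- Hx in E.
    unfold subbasic in *. destruct (snd p); tauto. }
  destruct (Hcell N 0%nat) as (u & v & Hu & Hv & _ & Hfar).
  assert (A := HN u Hu). assert (B := HN v Hv).
  assert (T := Kabs_sub_tri (f x) (f u) (f v)). rewrite (Kabs_sub_sym (f x) (f v)) in T. lra.
Qed.

Lemma last_node_leq' N u j : (j < N)%nat ->
  (leq' (dec j) u <-> prefix (dec j) (dec (last_node N u))).
Proof.
intros Hj. destruct (largest_below_spec (fun i => leq' (dec i) u) N 0%nat) as (A & _ & _);
  [lia|rewrite dec_0; apply leq'_nil|]. fold (last_node N u) in A.
split; intros H; [|now apply leq'_prefix with (dec (last_node N u))].
destruct (leq'_linear _ _ u H A) as [Hp|Hp]; [exact Hp|].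
destruct (largest_below_spec (fun i => leq' (dec i) u) N j Hj H) as (_ & _ & Hle).
fold (last_node N u) in Hle. apply prefix_dec_le in Hp.
replace (last_node N u) with j by lia. apply prefix_refl.
Qed.

Lemma agree_topbar N u v : last_node N u = last_node N v -> agree N u v.
Proof. intros H j Hj. rewrite !(last_node_leq' N) by exact Hj. now rewrite H. Qed.

Lemma last_node_le N u : (last_node N u <= N)%nat.
Proof.
unfold last_node. induction N as [|N IH]; simpl; [lia|].
destruct (excluded_middle_informative _); lia.
Qed.

Lemma Cspace_separable : separable (Cspace c Tr).
Proof.
right.
(* Functions of [last_node N u] with values among the [Kq]; the index codes [N] together with the
   list of values. *)
exists (fun n u => Kq (nth (last_node (fst (Cantor.of_nat n)) u) (dec (snd (Cantor.of_nat n))) O)).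
split.
- intros n. destruct (Cantor.of_nat n) as [N a]. simpl fst; simpl snd. split.
  + apply (cw_continuous_of_agree HTr). intros e He. exists N. intros u v Huv.
    rewrite (last_node_agree N u v Huv), Kabs_sub_refl. lra.
  + exists (rsum (dec a) (fun k => Kabs (@Kq c k))). intros u.
    destruct (Nat.lt_ge_cases (last_node N u) (length (dec a))) as [H|H].
    * apply (rsum_ge_mem (dec a) (fun k => Kabs (@Kq c k))); [intros; apply Kabs_pos|].
      now apply nth_In.
    * rewrite nth_overflow by exact H. change (@Kq c O) with (K0 c). rewrite Kabs_0.
      apply rsum_nonneg. intros; apply Kabs_pos.
- intros f [Hf _] e He.
  destruct (cw_continuous_agree f (e/4) Hf ltac:(lra)) as [N HN].
  destruct (choice_fun (fun i k => forall u, last_node N u = i ->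
    Kabs (Ksub (@Kq c k) (f u)) < e / 2)) as [q Hq'].
  { intros i. destruct (classic (exists u, last_node N u = i)) as [[u0 Hu0]|Hno].
    - destruct (Kq_dense (f u0) (e/4) ltac:(lra)) as [k Hk]. exists k. intros u Hu.
      assert (A := HN u0 u (agree_topbar N u0 u ltac:(congruence))).
      assert (T := Kabs_sub_tri (f u0) (Kq k) (f u)). lra.
    - exists 0%nat. intros u Hu. exfalso. apply Hno. now exists u. }
  (* [S N] entries rather than [N]: for [N = 0] the last node is 0 and still needs an entry. *)
  set (l := map q (seq 0 (S N))).
  assert (Hq : forall u, Kabs (Ksub (@Kq c (nth (last_node N u) l O)) (f u)) < e / 2).
  { intros u. assert (Hle := last_node_le N u). unfold l.
    rewrite nth_indep with (d' := q O) by (rewrite length_map, length_seq; lia).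
    rewrite map_nth, seq_nth by lia. now apply Hq'. }
  exists (Cantor.to_nat (N, code l)).
  apply Rle_lt_trans with (e/2); [|lra]. apply (@sup_norm_le c (Tbar Tr)); [lra|].
  intros u. left. cbv beta. rewrite Cantor.cancel_of_to. simpl fst; simpl snd. rewrite dec_code.
  change (Kabs (Ksub (Kq (nth (last_node N u) l O)) (f u)) < e / 2). apply Hq.
Qed.

End Compactness.

Lemma nonprincipal_ultrafilter : exists U : (nat -> Prop) -> Prop, proper_filter U /\
  (forall P, U P \/ U (fun n => ~ P n)) /\ (forall P, at_infinity P -> U P).
Proof.
assert (HF := at_infinity_proper).
destruct (@filter.ultraFilterLemma nat at_infinity) as (U & HU & Hsub).
{ split; [apply (pf_false _ HF)|]. split.
  - apply (pf_true _ HF).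
  - exact (pf_and _ HF).
  - exact (pf_mono _ HF). }
exists U. split; [|split; [|exact Hsub]].
- destruct HU as [[H0 [H1 H2 H3]] _]. split; [exact H1|exact H3|exact H2|exact H0].
- intros P. exact (filter.in_ultra_setVsetC P HU).
Qed.

(** A finite net covers all values; if no ball around a net point were hit on a set of the
    ultrafilter, the finitely many complements would intersect in a set on which no value is
    covered. *)
Lemma ultrafilter_klim {c} (U : (nat -> Prop) -> Prop) (u : nat -> K c) M : proper_filter U ->
  (forall P, U P \/ U (fun n => ~ P n)) -> (forall n, Kabs (u n) <= M) ->
  klim U u (klimval U u).
Proof.
intros HU Hultra HM. apply (klimval_spec HU). intros e He.
destruct (K_finite_net (c := c) M e He) as [L HL]. apply NNPP. intros Hno.
assert (H : forall L' : list (K c), U (fun n => ~ exists b, In b L' /\ Kabs (Ksub (u n) b) <= e)).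
{ induction L' as [|b L' IH].
  - apply (pf_all HU). intros n (b & [] & _).
  - destruct (Hultra (fun n => Kabs (Ksub (u n) b) <= e)) as [H|H]; [exfalso; eauto|].
    apply (pf_mono _ HU) with (2 := pf_and _ HU _ _ IH H). intros n [H1 H2] (b' & [<-|Hb'] & Hb'').
    + auto.
    + apply H1. now exists b'. }
destruct (pf_ex HU _ (H L)) as [n Hn]. apply Hn. apply HL, HM.
Qed.

(** * Non-separable adjoint ranges of sigma and Sigma *)

Section Nonseparability.
Context {c : bool} {S : list nat -> Prop} (HS : downward_closed S) (HSu : uncountable_boundary S).
Add Ring KRing : (@Kring_theory c).

Definition unit_vector (s : list nat) : node S -> K c := fun t => ind (proj1_sig t = s).

Lemma unit_vector_sum s (F : list (node S)) : NoDup F ->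
  rsum F (fun t => Kabs (unit_vector s t)) <= 1.
Proof.
intros HF. apply NoDup_nodes in HF.
assert (H : forall L : list (list nat), NoDup L -> rsum L (fun t => Kabs (@ind c (t = s))) <= 1).
{ induction L as [|t L IH]; intros HL; simpl; [lra|]. inversion_clear HL as [|? ? Ht HL'].
  specialize (IH HL'). destruct (list_eq_dec Nat.eq_dec t s) as [->|Hts].
  - rewrite (rsum_ext L _ (fun _ => 0)); [rewrite rsum_const|].
    + assert (A := @Kabs_ind c (s = s)). lra.
    + intros t Ht'. unfold ind. destruct (excluded_middle_informative (t = s)) as [->|];
        [contradiction|apply Kabs_0].
  - unfold ind at 1. destruct (excluded_middle_informative (t = s)); [contradiction|].
    rewrite Kabs_0. lra. }
specialize (H _ HF). rewrite rsum_map in H. exact H.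
Qed.

Lemma unit_vector_mem s : mem (l1 c S) (unit_vector s).
Proof. apply l1_mem with 1. apply unit_vector_sum. Qed.

Lemma unit_vector_norm s : norm (l1 c S) (unit_vector s) <= 1.
Proof. apply l1_norm_le. apply unit_vector_sum. Qed.

Lemma tsum_unit_vector s A : S s -> tsum A (ext (unit_vector s)) = ind (A s).
Proof.
intros Hs. apply (klim_unique at_infinity_proper (psum (unit_vector s) A)).
- apply tsum_klim, unit_vector_mem.
- apply (klim_eventually at_infinity_proper (fun _ => ind (A s))).
  + exists (Datatypes.S (code s)). intros n Hn. unfold psum.
    rewrite (ksum_delta n (code s)); [|lia|].
    2:{ intros i Hi. unfold coef, ext. destruct (excluded_middle_informative (S (dec i))); [|ring].
        unfold unit_vector, ind; simpl. destruct (excluded_middle_informative (dec i = s)); [|ring].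
        exfalso. apply Hi. subst s. symmetry. apply code_dec. }
    unfold coef. rewrite dec_code.
    assert (Ee := ext_node (unit_vector s) (exist _ s Hs)). simpl in Ee. rewrite Ee.
    unfold unit_vector; simpl. unfold ind at 2.
    destruct (excluded_middle_informative (s = s)); [ring|congruence].
  + apply (klim_const at_infinity_proper).
Qed.

Definition branch_eval (B : list nat -> Prop) (f : car (Cspace c S)) : K c :=
  match excluded_middle_informative (is_branch S B) with
  | left H => f (inr (exist _ B H))
  | right _ => K0 c
  end.

Lemma branch_eval_lfun B : lfun (Cspace c S) 1 (branch_eval B).
Proof.
unfold branch_eval. destruct (excluded_middle_informative (is_branch S B)) as [H|H].
- split; [reflexivity|]. split; [reflexivity|]. intros f [_ [M HM]]. rewrite Rmult_1_l.
  apply (@sup_norm_ge c (Tbar S) (mem (Cspace c S)) f M _ HM).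
- split; [intros; ring|]. split; [intros; ring|]. intros f [_ [M HM]]. rewrite Kabs_0, Rmult_1_l.
  apply (@sup_norm_pos c (Tbar S) (mem (Cspace c S)) f M HM).
Qed.

(** Stated for an arbitrary factorization and a set [Z] containing the range of [U]. The identity
    factorization treats sigma itself, and the closure of the range of [U] gives non-Asplund
    operators. Scaling unit vectors by 1/(C+1) puts their images under [U] in the unit ball, which
    determines the separation constant. *)
Lemma sigmaT_factor_not_sep (X Y : NS c) (T : car X -> car Y) (Z : car X -> Prop) U V :
  is_Banach X -> is_Banach Y -> bounded_op X Y T -> (forall z, Z z -> mem X z) ->
  bounded_op (l1 c S) X U -> bounded_op Y (Cspace c S) V ->
  (forall w, mem (l1 c S) w -> V (T (U w)) = sigmaT c S w) ->
  (forall w, mem (l1 c S) w -> Z (U w)) -> ~ adj_range_sep X Y T Z.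
Proof.
intros HX HY HT HZ HU HV HVTU HUZ.
assert (HB := @l1_Banach c S).
destruct (bounded_op_bound _ _ U HB HU) as (C & HC & HC').
destruct (bounded_op_bound _ _ V HY HV) as (C' & HC1 & HC1').
assert (Hr : 0 < / (C + 1)) by (apply Rinv_0_lt_compat; lra).
set (a := Kof (/ (C + 1)) 0 : K c).
assert (Ha : Kabs a = / (C + 1)) by (unfold a; rewrite Kabs_of_real, Rabs_pos_eq; lra).
apply (not_sep_of_branches X Y T Z S (fun B y => branch_eval B (V y)) (/ (C + 1))); auto.
- intros B HBr. apply (lfun_bounded_fun (1 * C')).
  apply (lfun_comp Y (Cspace c S) V C' 1); auto; [lra|apply branch_eval_lfun].
- intros B B' s HBr HBr' Hs Hs'. assert (HSs : S s) by now apply HBr.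
  set (w := scal (l1 c S) a (unit_vector s)).
  assert (Hw : mem (l1 c S) w) by apply (mem_scal HB), unit_vector_mem.
  exists (U w). split; [auto|]. split.
  + eapply Rle_trans; [now apply HC'|]. unfold w.
    rewrite (norm_scal HB), Ha by apply unit_vector_mem.
    assert (N1 := unit_vector_norm s). assert (N0 := norm_pos HB _ (unit_vector_mem s)).
    apply Rle_trans with (C * (/ (C + 1) * 1)).
    * apply Rmult_le_compat_l; [exact HC|]. apply Rmult_le_compat_l; lra.
    * apply Rmult_le_reg_r with (C + 1); [lra|]. field_simplify; lra.
  + rewrite HVTU by exact Hw.
    assert (E : forall A, is_branch S A -> branch_eval A (sigmaT c S w) = Kmul a (ind (A s))).
    { intros A HA. unfold branch_eval. destruct (excluded_middle_informative _); [|contradiction].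
      simpl. unfold w. rewrite (proj1 (proj2 (tsum_lfun A))) by apply unit_vector_mem.
      now rewrite tsum_unit_vector. }
    rewrite !E by assumption. unfold ind.
    destruct (excluded_middle_informative (B s)); [|contradiction].
    destruct (excluded_middle_informative (B' s)); [contradiction|].
    replace (Ksub _ _) with a by ring. lra.
Qed.

Lemma sigmaT_not_sep :
  ~ adj_range_sep (l1 c S) (Cspace c S) (sigmaT c S) (mem (l1 c S)).
Proof.
assert (Hid : forall X : NS c, is_Banach X -> bounded_op X X (fun x => x)).
{ intros X HX. split; [auto|]. split; [auto|]. split; [auto|]. exists 1. intros; lra. }
assert (HB := @l1_Banach c S). assert (HB' := @Cspace_Banach c S).
apply (sigmaT_factor_not_sep _ _ (sigmaT c S) _ (fun w => w) (fun f => f)); auto.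
now apply sigmaT_bounded.
Qed.

(** Branches are not points of the index set of [linf]; a limit over these nodes, one on each level,
    replaces evaluation at the branch. *)
Definition branch_node (B : list nat -> Prop) (n : nat) : list nat :=
  epsilon (inhabits []) (fun s => B s /\ length s = n).

Lemma branch_node_spec B n : is_branch S B ->
  B (branch_node B n) /\ length (branch_node B n) = n.
Proof.
intros HB. unfold branch_node. apply epsilon_spec.
destruct (infinite_chain_long B (branch_infinite B HB) n) as (s & Hs & Hn).
exists (firstn n s). split; [|now apply firstn_length_le].
apply (branch_downward HS B HB) with s; [exact Hs|]. exists (skipn n s).
now rewrite firstn_skipn.
Qed.

Lemma SigmaT_not_sep :
  ~ adj_range_sep (l1 c S) (linf c S) (SigmaT c S) (mem (l1 c S)).
Proof.
destruct nonprincipal_ultrafilter as (U & HU & Hultra & Hinf).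
assert (HB := @l1_Banach c S).
apply (not_sep_of_branches (l1 c S) (linf c S) _ _ S
  (fun B (f : node S -> K c) => klimval U (fun n => ext f (branch_node B n))) 1); auto;
  try apply linf_Banach; try apply SigmaT_bounded; try lra.
- intros B HBr. apply (lfun_bounded_fun 1).
  assert (Hb : forall f s, mem (linf c S) f -> Kabs (ext f s) <= norm (linf c S) f).
  { intros f s [M HM]. unfold ext. destruct (excluded_middle_informative (S s)).
    - now apply (@sup_norm_ge c (node S) (mem (linf c S)) f M).
    - rewrite Kabs_0. apply (@sup_norm_pos c (node S) (mem (linf c S)) f M HM). }
  assert (L := fun f (Hf : mem (linf c S) f) => ultrafilter_klim U
    (fun n => ext f (branch_node B n)) _ HU Hultra (fun n => Hb f _ Hf)).
  split; [|split].
  + intros f g Hf Hg. apply (klimval_eq HU).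
    apply (klim_eventually HU) with (2 := klim_add HU _ _ _ _ (L f Hf) (L g Hg)).
    apply (pf_all HU). intros n. symmetry. apply (ext_add f g).
  + intros a f Hf. apply (klimval_eq HU).
    apply (klim_eventually HU) with (2 := klim_scal HU a _ _ (L f Hf)).
    apply (pf_all HU). intros n. symmetry. apply (ext_scal a f).
  + intros f Hf. rewrite Rmult_1_l. apply (klim_abs_le HU) with (1 := L f Hf).
    apply (pf_all HU). intros n. auto.
- intros B B' s HBr HBr' Hs Hs'. assert (HSs : S s) by now apply HBr.
  exists (unit_vector s). split; [apply unit_vector_mem|]. split; [apply unit_vector_norm|].
  assert (E : forall A, is_branch S A ->
    klimval U (fun n => ext (SigmaT c S (unit_vector s)) (branch_node A n)) = ind (A s)).
  { intros A HA. apply (klimval_eq HU).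
    apply (klim_eventually HU) with (2 := klim_const HU (ind (A s))).
    (* From level [length s] on, the node of the branch extends [s] exactly when [s] lies on the
       branch, so the values are eventually constant. *)
    apply Hinf. exists (length s). intros n Hn. destruct (branch_node_spec A n HA) as [H1 H2].
    assert (HSn : S (branch_node A n)) by now apply HA.
    assert (Ee := ext_node (SigmaT c S (unit_vector s)) (exist _ _ HSn)). cbn [proj1_sig] in Ee.
    rewrite Ee. unfold SigmaT.
    rewrite tsum_unit_vector by exact HSs. apply ind_ext. simpl. split; intros H.
    - destruct HA as (_ & Hc & _). destruct (Hc s _ H H1) as [Hp|Hp]; [exact Hp|].
      replace s with (branch_node A n); [apply prefix_refl|].
      apply prefix_same_length; [exact Hp|]. destruct Hp as [r Hr]. rewrite Hr in Hn.
      rewrite length_app in Hn. rewrite Hr, length_app. lia.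
    - now apply (branch_downward HS A HA) with (branch_node A n). }
  rewrite !E by assumption. unfold ind.
  destruct (excluded_middle_informative (B s)); [|contradiction].
  destruct (excluded_middle_informative (B' s)); [contradiction|].
  replace (Ksub _ _) with (K1 c) by ring. rewrite Kabs_1. lra.
Qed.

End Nonseparability.

(** A supremum over fewer vectors is smaller; the norm bounds are there to make both values of
    [Rsup] genuine suprema. *)
Lemma adj_range_sep_mono {c} (X Y : NS c) (T : car X -> car Y) (Z Z' : car X -> Prop) :
  is_Banach X -> is_Banach Y -> bounded_op X Y T -> (forall z, Z z -> Z' z) ->
  (forall z, Z' z -> mem X z) -> adj_range_sep X Y T Z' -> adj_range_sep X Y T Z.
Proof.
intros HX HY HT HZ HZ' (phi & Hphi & H). exists phi. split; [exact Hphi|].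
intros psi Hpsi e He. destruct (H psi Hpsi e He) as [n Hn]. exists n.
eapply Rle_lt_trans; [|exact Hn].
destruct (bounded_op_bound X Y T HX HT) as (MT & HMT & HMT').
destruct (bounded_fun_lfun HY _ (Hphi n)) as (M1 & HM1 & L1).
destruct (bounded_fun_lfun HY _ Hpsi) as (M2 & HM2 & L2).
assert (L := lfun_comp X Y T MT _ _ HT HMT' (Rplus_le_le_0_compat _ _ HM1 HM2)
  (lfun_sub _ _ _ _ L1 L2)).
assert (HM : 0 <= (M1 + M2) * MT) by (apply Rmult_le_pos; lra).
apply Rsup_le; [exists 0; now left|]. intros r Hr.
apply Rsup_ub with ((M1 + M2) * MT).
- intros t [->|(z & Hz & Hz1 & ->)]; [exact HM|].
  eapply Rle_trans; [apply L; auto|]. rewrite <- (Rmult_1_r ((M1 + M2) * MT)) at 2.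
  now apply Rmult_le_compat_l.
- destruct Hr as [->|(z & Hz & Hz1 & ->)]; [now left|]. right. exists z. auto.
Qed.

Lemma closed_subspace_whole {c} (X : NS c) : is_Banach X -> closed_subspace X (mem X).
Proof.
intros HX. split; [auto|]. split; [apply (mem_zero HX)|]. split; [apply (mem_add HX)|].
split; [apply (mem_scal HX)|]. auto.
Qed.

(** * The closure of the range of an operator *)

Section RangeClosure.
Context {c : bool} {W X : NS c} {U : car W -> car X}.
Context (HW : is_Banach W) (HX : is_Banach X) (HU : bounded_op W X U).

Definition range_closure (x : car X) : Prop :=
  mem X x /\ forall eps, 0 < eps -> exists w, mem W w /\ dist X (U w) x < eps.

Lemma range_closure_range w : mem W w -> range_closure (U w).
Proof.
assert (HUm : forall w, mem W w -> mem X (U w)) by apply HU.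
intros Hw. split; [auto|]. intros e He. exists w. split; [exact Hw|].
unfold dist. rewrite (add_opp HX), (norm_zero HX) by auto. exact He.
Qed.

Lemma range_closure_closed : closed_subspace X range_closure.
Proof.
destruct HU as (HUm & HUa & HUs & _).
split; [now intros z [Hz _]|]. split; [|split; [|split]].
- rewrite <- (scal_0 HX (U (zero W))) by apply HUm, (mem_zero HW).
  rewrite <- HUs by apply (mem_zero HW).
  apply range_closure_range, (mem_scal HW), (mem_zero HW).
- intros x y [Hx Hx'] [Hy Hy']. split; [now apply (mem_add HX)|]. intros e He.
  destruct (Hx' (e/2) ltac:(lra)) as (w & Hw & Hwx), (Hy' (e/2) ltac:(lra)) as (w' & Hw' & Hwy).
  exists (add W w w'). split; [now apply (mem_add HW)|]. rewrite HUa by assumption.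
  eapply Rle_lt_trans; [apply (dist_add HX); auto|]. lra.
- intros a x [Hx Hx']. split; [now apply (mem_scal HX)|]. intros e He.
  assert (Ha := Kabs_pos a).
  destruct (Hx' (e / (Kabs a + 1))) as (w & Hw & Hwx); [apply Rdiv_lt_0_compat; lra|].
  exists (scal W a w). split; [now apply (mem_scal HW)|]. rewrite HUs by assumption.
  rewrite (dist_scal HX) by auto.
  assert (P := dist_pos HX _ _ (HUm w Hw) Hx).
  apply Rle_lt_trans with ((Kabs a + 1) * dist X (U w) x); [nra|].
  replace e with ((Kabs a + 1) * (e / (Kabs a + 1))) by (field; lra).
  apply Rmult_lt_compat_l; lra.
- intros u x Hu Hx Hlim. split; [exact Hx|]. intros e He.
  destruct (Hlim (e/2) ltac:(lra)) as [N HN]. specialize (HN N (le_n N)).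
  destruct (Hu N) as [HuN HuN']. destruct (HuN' (e/2) ltac:(lra)) as (w & Hw & Hwu).
  exists w. split; [exact Hw|].
  eapply Rle_lt_trans; [apply (dist_tri HX (u N)); auto|]. lra.
Qed.

Lemma range_closure_separable : separable W -> separable_set X range_closure.
Proof.
assert (HUm : forall w, mem W w -> mem X (U w)) by apply HU.
intros Hsep.
destruct (separable_seq W (mem W) Hsep (ex_intro _ _ (mem_zero HW))) as (s & Hs & Hdense).
destruct (bounded_op_bound W X U HW HU) as (M & HM & HM').
right. exists (fun n => U (s n)). split; [intros n; now apply range_closure_range|].
intros x [Hx Hx'] e He. destruct (Hx' (e/2) ltac:(lra)) as (w & Hw & Hwx).
destruct (Hdense w Hw (e / (2 * (M + 1)))) as [n Hn]; [apply Rdiv_lt_0_compat; lra|].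
exists n. eapply Rle_lt_trans; [apply (dist_tri HX (U w)); auto|].
assert (D := op_dist W X U M (s n) w HW HX HU HM' (Hs n) Hw).
assert (P := dist_pos HW _ _ (Hs n) Hw).
assert ((M + 1) * dist W (s n) w < e / 2).
{ replace (e/2) with ((M + 1) * (e / (2 * (M + 1)))) by (field; lra).
  apply Rmult_lt_compat_l; lra. }
nra.
Qed.

End RangeClosure.

(** * Uncountably many branches by diagonalization *)

Definition binary_path (g : nat -> bool) (s : list nat) : Prop :=
  s = map (fun i => if g i then 1%nat else 0%nat) (seq 0 (length s)).

Lemma binary_path_branch g (Tr : list nat -> Prop) : (forall s, Dtree s -> Tr s) ->
  is_branch Tr (binary_path g).
Proof.
intros HTr.
assert (Hpre : forall s t, binary_path g t -> (length s <= length t)%nat ->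
  binary_path g s -> prefix s t).
{ intros s t Ht Hl Hs. rewrite Ht, Hs.
  replace (length t) with (length s + (length t - length s))%nat by lia.
  rewrite seq_app, map_app. eexists. reflexivity. }
apply infinite_chain_branch.
- intros s Hs. apply HTr. rewrite Hs. apply Forall_forall. intros n Hn.
  apply in_map_iff in Hn. destruct Hn as (i & <- & _). destruct (g i); lia.
- split.
  + intros s t Hs Ht. destruct (Nat.le_ge_cases (length s) (length t)); [left|right]; auto.
  + intros [l Hl].
    set (N := S (list_max (map (@length nat) l))).
    set (s := map (fun i => if g i then 1%nat else 0%nat) (seq 0 N)).
    assert (Hs : binary_path g s).
    { unfold binary_path, s. now rewrite length_map, length_seq. }
    assert (A := proj1 (list_max_le (map (@length nat) l) _) (le_n _)).
    rewrite Forall_forall in A. specialize (A (length s) (in_map _ _ _ (Hl s Hs))).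
    unfold s in A at 1. rewrite length_map, length_seq in A. unfold N in A. lia.
- intros s t Ht [r Hr]. unfold binary_path in *. rewrite Hr in Ht.
  rewrite length_app, seq_app, map_app in Ht. apply (f_equal (firstn (length s))) in Ht.
  rewrite !firstn_app, length_map, length_seq, Nat.sub_diag, !firstn_O, !app_nil_r in Ht.
  rewrite firstn_all, firstn_all2 in Ht; [exact Ht|]. rewrite length_map, length_seq. lia.
Qed.

Section Diagonal.
Context (f : nat -> list nat -> Prop).

(* The path leaves the [n]-th set [f n] at level [n]. *)
Fixpoint diagonal_prefix (n : nat) : list nat :=
  match n with
  | O => []
  | S n => diagonal_prefix n ++
      [if excluded_middle_informative (f n (diagonal_prefix n ++ [0%nat])) then 1%nat else 0%nat]
  end.

Definition diagonal (n : nat) : bool :=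
  if excluded_middle_informative (f n (diagonal_prefix n ++ [0%nat])) then true else false.

Lemma diagonal_prefix_eq n :
  diagonal_prefix n = map (fun i => if diagonal i then 1%nat else 0%nat) (seq 0 n).
Proof.
induction n as [|n IH]; [reflexivity|].
rewrite seq_S, map_app, <- IH. simpl. unfold diagonal.
destruct (excluded_middle_informative _); reflexivity.
Qed.

(** The test node is [diagonal_prefix n ++ [0]]: the path turns to 1 there exactly when [f n]
    contains it. *)
Lemma diagonal_differs n : ~ forall s, f n s <-> binary_path diagonal s.
Proof.
intros H. specialize (H (diagonal_prefix n ++ [0%nat])).
assert (E : binary_path diagonal (diagonal_prefix n ++ [0%nat]) <-> diagonal n = false).
{ unfold binary_path. rewrite length_app, diagonal_prefix_eq, length_map, length_seq.
  simpl length. rewrite Nat.add_1_r, seq_S, map_app. simpl. split.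
  - intros Heq. apply app_inv_head in Heq. injection Heq as Heq.
    destruct (diagonal n); [discriminate|reflexivity].
  - intros ->. reflexivity. }
rewrite E in H. unfold diagonal in H.
destruct (excluded_middle_informative (f n (diagonal_prefix n ++ [0%nat]))) as [h|h].
- apply H in h. discriminate.
- apply h, H. reflexivity.
Qed.

End Diagonal.

Lemma uncountable_of_Dtree (S : list nat -> Prop) : (forall s, Dtree s -> S s) ->
  uncountable_boundary S.
Proof.
intros HS [f Hf].
destruct (Hf _ (binary_path_branch (diagonal f) S HS)) as [n Hn].
now apply (diagonal_differs f n).
Qed.

Lemma Omega_downward : downward_closed Omega.
Proof. intros s t _ _. exact I. Qed.

Lemma Dtree_downward : downward_closed Dtree.
Proof. intros s t Ht [r ->]. now apply Forall_app in Ht. Qed.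

(** For the forward direction a separable subspace must be produced inside a possibly non-separable
    domain. Factoring sigma of the binary tree through [T] supplies it: the range of [U] on the
    separable space [l1] has a separable closure, and it already separates the branches. Conversely,
    separability of the whole range passes to every subspace. *)
Lemma sep_cod_class {c} (X Y : NS c) (T : car X -> car Y) :
  sep_cod_nonsep_adj X Y T <-> (nonAsplund X Y T /\ separable Y).
Proof.
split.
- intros (HX & HY & HT & Hsep & Hns). split; [|exact Hsep].
  split; [exact HX|]. split; [exact HY|]. split; [exact HT|]. intros HA.
  destruct (factors_sep_codomain X Y T Dtree HX HY HT Hns Dtree_downward Hsep)
    as [(U & V & HU & HV & HVTU) _].
  assert (HB := @l1_Banach c Dtree).
  apply (sigmaT_factor_not_sep (uncountable_of_Dtree Dtree (fun s H => H))
    X Y T (range_closure (U := U)) U V); auto.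
  + now intros z [Hz _].
  + intros w Hw. now apply (range_closure_range HX HU).
  + apply HA; [now apply (range_closure_closed HB HX HU)|].
    apply (range_closure_separable HB HX HU), l1_separable.
- intros ((HX & HY & HT & Hna) & Hsep).
  split; [exact HX|]. split; [exact HY|]. split; [exact HT|]. split; [exact Hsep|].
  intros HA. apply Hna. intros Z HZ _.
  assert (HZm : forall z, Z z -> mem X z) by apply HZ.
  now apply (adj_range_sep_mono X Y T Z (mem X)).
Qed.

Lemma universal_of_uncountable (c : bool) (S : list nat -> Prop) :
  downward_closed S -> uncountable_boundary S -> universal_iii_iv c S.
Proof.
intros HS HSu. assert (HB := @l1_Banach c S). split; [|split].
- split.
  + split; [exact HB|]. split; [apply linf_Banach|]. split; [apply SigmaT_bounded|].
    intros HA. apply (SigmaT_not_sep (c := c) HS HSu). apply HA.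
    * now apply closed_subspace_whole.
    * apply l1_separable.
  + intros X Y T HT. now apply SigmaT_factors_nonAsplund.
- split.
  + split; [exact HB|]. split; [apply Cspace_Banach|]. split; [now apply sigmaT_bounded|].
    split; [now apply Cspace_separable|now apply sigmaT_not_sep].
  + intros X Y T (HX & HY & HT & Hsep & Hns). now apply factors_sep_codomain.
- intros X Y T. apply sep_cod_class.
Qed.

Theorem theorem5p5 (c : bool) :
  (forall (X Y : NS c) (T : car X -> car Y) (Tr : list nat -> Prop),
     is_Banach X -> is_Banach Y -> bounded_op X Y T ->
     ~ adj_range_sep X Y T (mem X) -> downward_closed Tr ->
     (separable X -> factors (SigmaT c Tr) T) /\
     (separable Y -> factors (sigmaT c Tr) T /\ factors (SigmaT c Tr) T)) /\
  (forall S : list nat -> Prop, downward_closed S -> uncountable_boundary S ->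
     universal_iii_iv c S) /\
  universal_iii_iv c Omega /\ universal_iii_iv c Dtree.
Proof.
split; [|split; [|split]].
- intros X Y T Tr HX HY HT Hns HTr. split; intros Hsep.
  + now apply SigmaT_factors_sep_domain.
  + now apply factors_sep_codomain.
- apply universal_of_uncountable.
- apply universal_of_uncountable; [exact Omega_downward|].
  apply uncountable_of_Dtree. intros s _. exact I.
- apply universal_of_uncountable; [exact Dtree_downward|].
  now apply uncountable_of_Dtree.
Qed.
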